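(* Assume that the smallness condition $$\frac{\mathcal N_h}{\nu^2}\|f\|_{*,h}<1$$ holds. Then the weak Galerkin scheme (WG) defined in the context admits a unique solution $(u_h,p_h)\in V_h^0\times Q_h^0$.
   Context: $\Omega\subset\mathbb R^n$ ($n\in\{2,3\}$) is a bounded Lipschitz polygonal/polyhedral domain; $\nu>0$, $\alpha>0$, $r\ge2$ are real numbers and $f\in[L^2(\Omega)]^n$. $L^2_0(\Omega)=\{q\in L^2(\Omega):\int_\Omega q=0\}$. Mesh and notation. $\mathcal T_h$ is a shape regular partition of $\Omega$ into closed simplexes, $\mathcal E_h$ is the set of all edges (faces) of its elements, $h_K$ is the diameter of $K\in\mathcal T_h$, and $n$ also denotes the outward unit normal on $\partial K$. $(\cdot,\cdot)_D$ is the $L^2(D)$ inner product, $(\cdot,\cdot)=(\cdot,\cdot)_\Omega$, $\|\cdot\|_0$ the $L^2(\Omega)$ norm, $\langle\cdot,\cdot\rangle_{\partial\mathcal T_h}=\sum_{K\in\mathcal T_h}\langle\cdot,\cdot\rangle_{\partial K}$ with $\langle\cdot,\cdot\rangle_{\partial K}$ the $L^2(\partial K)$ inner product, $\|\cdot\|_{0,\partial\mathcal T_h}=(\sum_K\|\cdot\|_{0,\partial K}^2)^{1/2}$. $P_j(D)$ denotes polynomials of degree at most $j$ on $D$. $(u\otimes v)_{ij}=u_iv_j$. Integers $m\ge1$ and $k\in\{m-1,m\}$ are fixed; $\eta|_{\partial K}=h_K^{-1}$; $\Pi_k^B$ is the (componentwise) $L^2$-projection onto $P_k(e)$ on each $e\in\mathcal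 E_h$. Discrete weak operators. For an integer $\gamma\ge0$ and $v=\{v_i,v_b\}$ ($v_i$ on element interiors, $v_b$ on element boundaries), $\nabla_{w,\gamma}v|_K\in[P_\gamma(K)]^n$ is defined by $(\nabla_{w,\gamma}v,\varsigma)_K=-(v_i,\nabla\cdot\varsigma)_K+\langle v_b,\varsigma\cdot n\rangle_{\partial K}$ for all $\varsigma\in[P_\gamma(K)]^n$; for vector-valued $v$ it is applied componentwise. For vector-valued $w=\{w_i,w_b\}$, $\nabla_{w,\gamma}\cdot w|_K\in P_\gamma(K)$ is defined by $(\nabla_{w,\gamma}\cdot w,\varsigma)_K=-(w_i,\nabla\varsigma)_K+\langle w_b\cdot n,\varsigma\rangle_{\partial K}$ for all $\varsigma\in P_\gamma(K)$; for tensors it is applied row by row. Discrete spaces. $V_h^0$ is the set of $v_h=\{v_{hi},v_{hb}\}$ with $v_{hi}|_K\in[P_m(K)]^n$ for all $K\in\mathcal T_h$, $v_{hb}|_e\in[P_k(e)]^n$ for all $e\in\mathcal E_h$, and $v_{hb}|_{\partial\Omega}=0$. $Q_h^0$ is the set of $q_h=\{q_{hi},q_{hb}\}$ with $q_{hi}|_K\in P_{m-1}(K)$, $q_{hb}|_e\in P_m(e)$, and $q_{hi}\in L^2_0(\Omega)$. Forms. $a_h(u_h,v_h)=\nu(\nabla_{w,m-1}u_h,\nabla_{w,m-1}v_h)+\nu\langle\eta(\Pi_k^Bu_{hi}-u_{hb}),\Pi_k^Bv_{hi}-v_{hb}\rangle_{\partial\mathcal T_h}$, $b_h(v_h,q_h)=(\nabla_{w,m}q_h,v_{hi})$,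 $c_h(\kappa_h;u_h,v_h)=\alpha(|\kappa_{hi}|^{r-2}u_{hi},v_{hi})$, $d_h(\kappa_h;u_h,v_h)=\tfrac12(\nabla_{w,m}\cdot\{u_{hi}\otimes\kappa_{hi},u_{hb}\otimes\kappa_{hb}\},v_{hi})-\tfrac12(\nabla_{w,m}\cdot\{v_{hi}\otimes\kappa_{hi},v_{hb}\otimes\kappa_{hb}\},u_{hi})$. Scheme (WG): find $(u_h,p_h)\in V_h^0\times Q_h^0$ such that $a_h(u_h,v_h)+b_h(v_h,p_h)+c_h(u_h;u_h,v_h)+d_h(u_h;u_h,v_h)=(f,v_{hi})$ for all $v_h\in V_h^0$, and $b_h(u_h,q_h)=0$ for all $q_h\in Q_h^0$. Norm and constants. $|||v_h|||_V^2=\|\nabla_{w,m-1}v_h\|_0^2+\|\eta^{1/2}(\Pi_k^Bv_{hi}-v_{hb})\|_{0,\partial\mathcal T_h}^2$ (a norm on $V_h^0$), $V_{0h}=\{\kappa_h\in V_h^0: b_h(\kappa_h,q_h)=0\ \forall q_h\in Q_h^0\}$, $$\mathcal N_h=\sup_{0\ne\kappa_h,u_h,v_h\in V_{0h}}\frac{d_h(\kappa_h;u_h,v_h)}{|||\kappa_h|||_V\,|||u_h|||_V\,|||v_h|||_V},\qquad \|f\|_{*,h}=\sup_{0\ne v_h\in V_{0h}}\frac{(f,v_{hi})}{|||v_h|||_V}.$$ *)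

(* Defs.v *)
From HB Require Import structures.
From mathcomp Require Import all_boot all_order all_algebra.
From mathcomp Require Import all_classical all_reals all_analysis.
Set Implicit Arguments.
Unset Strict Implicit.
Unset Printing Implicit Defensive.
Import Order.TTheory GRing.Theory Num.Theory.
Import numFieldNormedType.Exports.
Local Open Scope classical_set_scope.
Local Open Scope ring_scope.

(* The product sigma-algebra on the space of row vectors, as the library does
   for tuples. *)
Section rV_measurable.
Context {R : realType} {n : nat}.

Definition rV_coord (i : 'I_n) (x : 'rV[R]_n) : measurableTypeR R := x 0 i.

Let rV_set0 : g_sigma_preimage rV_coord set0.
Proof. exact: sigma_algebra0. Qed.

Let rV_setC A : g_sigma_preimage rV_coord A -> g_sigma_preimage rV_coord (~` A).
Proof. exact: sigma_algebraC. Qed.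

Let rV_bigcup (F : _^nat) : (forall i, g_sigma_preimage rV_coord (F i)) ->
  g_sigma_preimage rV_coord (\bigcup_i (F i)).
Proof. exact: sigma_algebra_bigcup. Qed.

HB.instance Definition _ := @isMeasurable.Build
  default_measure_display 'rV[R]_n
  (g_sigma_preimage rV_coord) rV_set0 rV_setC rV_bigcup.
End rV_measurable.

Lemma measurable_rV_coord (R : realType) n (i : 'I_n) :
  measurable_fun [set: 'rV[R]_n] (rV_coord i).
Proof.
move=> _ Y mY; rewrite setTI; apply: sub_sigma_algebra => /=.
rewrite -bigcup_seq/=; exists i => /=; first by rewrite mem_index_enum.
by exists Y => //; rewrite setTI.
Qed.

Lemma measurable_fun_rVP d (T : measurableType d) (R : realType) n
    (f : T -> 'rV[R]_n) :
  (forall i, measurable_fun [set: T] (rV_coord i \o f)) ->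
  measurable_fun [set: T] f.
Proof.
move=> mf.
suff prefS : g_sigma_preimage (fun i => @rV_coord R n i \o f) `<=` measurable.
  by move=> _ A mA; apply: prefS; rewrite g_sigma_preimage_comp; exists A.
apply: smallest_sub; first exact: sigma_algebra_measurable.
case: n => [|n] in f mf *; first by rewrite big_ord0.
rewrite -bigcup_mkord_ord; apply: bigcup_sub => i Ii.
by move=> A [B mB <-]; exact: mf.
Qed.

Section lebesgue_rV.
Variable R : realType.

Definition consrV n (p : measurableTypeR R * 'rV[R]_n) : 'rV[R]_n.+1 :=
  row_mx (const_mx p.1 : 'rV_1) p.2.
Definition unconsrV n (x : 'rV[R]_n.+1) : measurableTypeR R * 'rV[R]_n :=
  (x 0 ord0, rsubmx (x : 'rV_(1 + n))).

Lemma consrVK n : cancel (@consrV n) (@unconsrV n).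
Proof.
move=> [a x]; rewrite /unconsrV /consrV row_mxKr; congr pair.
by rewrite mxE; case: splitP => // j _; rewrite mxE.
Qed.

Lemma measurable_consrV n : measurable_fun setT (@consrV n).
Proof.
apply: measurable_fun_rVP => i; rewrite /rV_coord/=.
rewrite [X in measurable_fun _ X](_ : _ =
  match @fintype.split 1 n i with inl _ => fst | inr j => rV_coord j \o snd end); last first.
  by apply/funext => x; rewrite /= /consrV mxE; case: fintype.split => j //; rewrite mxE.
case: fintype.split => j; first exact: measurable_fst.
exact: measurableT_comp (measurable_rV_coord j) measurable_snd.
Qed.

Lemma measurable_unconsrV n : measurable_fun setT (@unconsrV n).
Proof.
apply: measurable_fun_pair; first exact: measurable_rV_coord.
apply: measurable_fun_rVP => i.
rewrite [X in measurable_fun _ X](_ : _ = rV_coord (rshift 1 i : 'I_n.+1)).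
  exact: measurable_rV_coord.
by apply/funext => x; rewrite /rV_coord /= mxE.
Qed.

Section step.
Context n (mu : {sigma_finite_measure set 'rV[R]_n -> \bar R}).

Definition lebesgue_cons : set 'rV[R]_n.+1 -> \bar R :=
  pushforward (product_measure1 (@lebesgue_measure R) mu) (@consrV n).

HB.instance Definition _ := Measure.copy lebesgue_cons
  (measure_function_pushforward__canonical__measure_function_Measure
     (product_measure1 (@lebesgue_measure R) mu) (@measurable_consrV n)).
Let lebesgue_cons_sigma_finite : sigma_finite setT lebesgue_cons.
Proof.
have /sigma_finiteP[F [TF ndF Foo]] := sigma_finiteT (@lebesgue_measure R).
have /sigma_finiteP[G [TG ndG Goo]] := sigma_finiteT mu.
exists (fun i => @unconsrV n @^-1` (F i `*` G i)).
  rewrite -preimage_bigcup; apply/esym/seteqP; split => // x _.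
  have [i _ Fi] : (\bigcup_i F i) (unconsrV x).1 by rewrite -TF.
  have [j _ Gj] : (\bigcup_i G i) (unconsrV x).2 by rewrite -TG.
  exists (maxn i j) => //; split.
    by move: Fi; exact/subsetPset/ndF/leq_maxl.
  by move: Gj; exact/subsetPset/ndG/leq_maxr.
move=> i; have [mF Fi] := Foo i; have [mG Gi] := Goo i; split.
  rewrite -[X in measurable X]setTI; apply: measurable_unconsrV => //.
  exact: measurableX.
rewrite /lebesgue_cons /pushforward -comp_preimage.
rewrite (_ : _ \o _ = id) ?preimage_id; last first.
  by apply/funext => p /=; rewrite consrVK.
by rewrite product_measure1E// lte_mul_pinfty// ge0_fin_numE.
Qed.

HB.instance Definition _ := Measure_isSigmaFinite.Build _ _ _ lebesgue_cons
  lebesgue_cons_sigma_finite.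
End step.

Let dirac_sigma_finite : sigma_finite setT (@dirac _ 'rV[R]_0 0 R).
Proof. by apply: fin_num_fun_sigma_finite; rewrite ?measure0//; exact: fin_num_measure. Qed.

(* The n-dimensional Lebesgue measure, as the iterated product of the
   one-dimensional one. *)
Fixpoint lebesgue_rV n : {sigma_finite_measure set 'rV[R]_n -> \bar R} :=
  match n with
  | 0 => @dirac _ 'rV[R]_0 0 R
  | n'.+1 => lebesgue_cons (lebesgue_rV n')
  end.
End lebesgue_rV.

Section euclidean.
Context {R : realType} {n : nat}.
Implicit Types (x y : 'rV[R]_n) (D : set 'rV[R]_n).

(* The library norm on row vectors is the sup norm: it defines the topology
   used below, but metric quantities are Euclidean. *)
Definition dotv x y : R := \sum_i x 0 i * y 0 i.
Definition enorm x : R := Num.sqrt (dotv x x).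

Definition frob (A B : 'M[R]_n) : R := \sum_i \sum_j A i j * B i j.

(* The tensor with entries [x_i y_j]. *)
Definition tensor x y : 'M[R]_n := x^T *m y.

Definition diam D : R := sup [set enorm (p.1 - p.2) | p in D `*` D].

(* The diameter of the largest closed ball contained in D. *)
Definition indiam D : R :=
  sup [set 2 * rho | rho in
    [set rho | 0 <= rho /\ exists x, [set y | enorm (y - x) <= rho] `<=` D]].

Definition boundary D : set 'rV[R]_n := closure D `\` D°.

Definition ebasis (i : 'I_n) : 'rV[R]_n := delta_mx 0 i.

Definition grad (s : 'rV[R]_n -> R) x : 'rV[R]_n := \row_i 'D_(ebasis i) s x.

Definition div (s : 'rV[R]_n -> 'rV[R]_n) x : R :=
  \sum_i 'D_(ebasis i) (fun y => s y 0 i) x.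

(* Near each boundary point, in suitable orthonormal coordinates, D is the
   region lying strictly below the graph of a Lipschitz function of the
   coordinates other than the [i]-th. *)
Definition lipschitz_boundary D : Prop :=
  forall x, boundary D x ->
  exists (Q : 'M[R]_n) (i : 'I_n) (L : R) (gamma : 'rV[R]_n.-1 -> R^o),
    [/\ Q *m Q^T = 1%:M, L.-lipschitz gamma &
        \forall y \near x,
          D y <-> ((y - x) *m Q) 0 i < gamma (col' i ((y - x) *m Q))].

Definition polyhedral D : Prop :=
  exists2 s : seq ('rV[R]_n * R), (forall h, h \in s -> h.1 != 0) &
    boundary D `<=` [set x | exists2 h, h \in s & dotv h.1 x = h.2].

Definition lipschitz_polyhedral_domain D : Prop :=
  [/\ [/\ D !=set0, open D & connected D],
      bounded_set D, lipschitz_boundary D & polyhedral D].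

Definition L2 D (g : 'rV[R]_n -> R) : Prop :=
  measurable_fun D g /\
  (lebesgue_rV R n).-integrable D (fun x => (g x ^+ 2)%:E).

Definition polyfun (j : nat) (g : 'rV[R]_n -> R) : Prop :=
  exists c : {ffun 'I_n -> 'I_j.+1} -> R, forall x,
    g x = \sum_(a : {ffun 'I_n -> 'I_j.+1} | (\sum_i a i <= j)%N)
            c a * \prod_i x 0 i ^+ a i.

Definition polyfunV (j : nat) (g : 'rV[R]_n -> 'rV[R]_n) : Prop :=
  forall i, polyfun j (fun x => g x 0 i).

(* Functions on D are represented by their extension by zero, so that equality
   of functions on D is plain equality. *)
Definition Pol (j : nat) D : set ('rV[R]_n -> R) :=
  [set p \_ D | p in [set p | polyfun j p]].

Definition PolV (j : nat) D : set ('rV[R]_n -> 'rV[R]_n) :=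
  [set g | forall i, Pol j D (fun x => g x 0 i)].

End euclidean.

(* Simplices are given by their finite sets of vertices. *)
Record mesh (R : realType) (n : nat) := Mesh {
  nvert : nat ;
  vert : 'I_nvert -> 'rV[R]_n ;
  cells : {set {set 'I_nvert}} }.

Section mesh_theory.
Context {R : realType} {n : nat} (T : mesh R n).
Local Notation V := 'I_(nvert T).
Implicit Types (Omega : set 'rV[R]_n).

Definition hull (s : {set V}) : set 'rV[R]_n :=
  [set x | exists w : V -> R, [/\ forall v, v \in s -> 0 <= w v,
     \sum_(v in s) w v = 1 & x = \sum_(v in s) w v *: vert v]].

Definition affinely_independent (s : {set V}) : Prop :=
  forall w : V -> R, \sum_(v in s) w v = 0 ->
    \sum_(v in s) w v *: vert v = 0 -> forall v, v \in s -> w v = 0.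

(* Edges (n = 2) or faces (n = 3) of the elements. *)
Definition faces : {set {set V}} :=
  [set e : {set V} | (#|e| == n) && [exists K in cells T, e \subset K]]%SET.

Definition cell : finType := {K : {set V} | K \in cells T}.
Definition face : finType := {e : {set V} | e \in faces}.

(* A conforming partition of Omega into nondegenerate closed simplexes: two
   elements meet along the simplex spanned by their common vertices. *)
Definition partition_of Omega : Prop :=
  [/\ forall K, K \in cells T -> #|K| = n.+1 /\ affinely_independent K,
      forall K L, K \in cells T -> L \in cells T ->
        hull K `&` hull L = hull (K :&: L) &
      closure Omega = \bigcup_(K in [set K | K \in cells T]) hull K].

Definition shape_regular (sigma : R) : Prop :=
  forall K, K \in cells T -> diam (hull K) <= sigma * indiam (hull K).

Definition celldom (K : cell) : set 'rV[R]_n := hull (val K).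
Definition facedom (e : face) : set 'rV[R]_n := hull (val e).
Definition incident (K : cell) (e : face) : bool := val e \subset val K.

Definition hK (K : cell) : R := diam (celldom K).

Definition cint (K : cell) (g : 'rV[R]_n -> R) : R :=
  \int[lebesgue_rV R n]_(x in celldom K) g x.

(* Surface integral over a face, by the affine parametrization
   [t |-> y_0 + t E] over the unit simplex, where the rows of [E] are
   [y_i - y_0] for an enumeration [y_0, ..., y_(n-1)] of the vertices. *)
Definition unit_simplex (d : nat) : set 'rV[R]_d :=
  [set t | (forall i, 0 <= t 0 i) /\ \sum_i t 0 i <= 1].

Definition fvert (e : face) (i : nat) : 'rV[R]_n :=
  nth 0 [seq vert v | v <- enum (val e)] i.

Definition fedges (e : face) : 'M[R]_(n.-1, n) :=
  \matrix_(i < n.-1) (fvert e i.+1 - fvert e 0).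

Definition fint (e : face) (g : 'rV[R]_n -> R) : R :=
  Num.sqrt (\det (fedges e *m (fedges e)^T)) *
  \int[lebesgue_rV R n.-1]_(t in @unit_simplex n.-1)
     g (fvert e 0 + t *m fedges e).

(* [normal], [projB], [wgrad] and [wdiv] are selected by [xget] from the
   property that defines them, which has exactly one solution on a
   nondegenerate simplex: the outward unit normal, and Riesz representatives in
   finite-dimensional spaces of polynomials. *)
Definition normal (K : cell) (e : face) : 'rV[R]_n :=
  xget 0 [set nu : 'rV[R]_n | [/\ enorm nu = 1,
    forall a b, a \in val e -> b \in val e ->
      dotv (vert b - vert a) nu = 0 &
    forall a b, a \in val e -> b \in val K -> b \notin val e ->
      dotv (vert b - vert a) nu < 0]].

Definition projB (k : nat) (e : face) (g : 'rV[R]_n -> R) : 'rV[R]_n -> R :=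
  xget (fun=> 0) [set p | Pol k (facedom e) p /\
    forall q, polyfun k q ->
      fint e (fun x => p x * q x) = fint e (fun x => g x * q x)].

Definition projBV (k : nat) (e : face) (g : 'rV[R]_n -> 'rV[R]_n) x
    : 'rV[R]_n :=
  \row_i projB k e (fun y => g y 0 i) x.

Definition wgrad (gam : nat) (K : cell) (vi : 'rV[R]_n -> R)
    (vb : face -> 'rV[R]_n -> R) : 'rV[R]_n -> 'rV[R]_n :=
  xget (fun=> 0) [set G | PolV gam (celldom K) G /\
    forall s, polyfunV gam s ->
      cint K (fun x => dotv (G x) (s x)) =
      - cint K (fun x => vi x * div s x) +
      \sum_(e : face | incident K e) fint e (fun x => vb e x * dotv (s x) (normal K e))].

Definition wgradV (gam : nat) (K : cell) (vi : 'rV[R]_n -> 'rV[R]_n)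
    (vb : face -> 'rV[R]_n -> 'rV[R]_n) x : 'M[R]_n :=
  \matrix_i wgrad gam K (fun y => vi y 0 i) (fun e y => vb e y 0 i) x.

Definition wdiv (gam : nat) (K : cell) (wi : 'rV[R]_n -> 'rV[R]_n)
    (wb : face -> 'rV[R]_n -> 'rV[R]_n) : 'rV[R]_n -> R :=
  xget (fun=> 0) [set G | Pol gam (celldom K) G /\
    forall s, polyfun gam s ->
      cint K (fun x => G x * s x) =
      - cint K (fun x => dotv (wi x) (grad s x)) +
      \sum_(e : face | incident K e) fint e (fun x => dotv (wb e x) (normal K e) * s x)].

Definition wdivT (gam : nat) (K : cell) (wi : 'rV[R]_n -> 'M[R]_n)
    (wb : face -> 'rV[R]_n -> 'M[R]_n) x : 'rV[R]_n :=
  \row_i wdiv gam K (fun y => row i (wi y)) (fun e y => row i (wb e y)) x.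

(* Weak functions: an interior part on each element and a boundary part,
   single-valued on each face. *)
Definition wfunV : Type :=
  ((cell -> 'rV[R]_n -> 'rV[R]_n) * (face -> 'rV[R]_n -> 'rV[R]_n))%type.
Definition wfunS : Type :=
  ((cell -> 'rV[R]_n -> R) * (face -> 'rV[R]_n -> R))%type.

Definition wzeroV : wfunV := (fun _ _ => 0, fun _ _ => 0).

Definition Vh0 Omega (m k : nat) : set wfunV :=
  [set v | [/\ forall K, PolV m (celldom K) (v.1 K),
               forall e, PolV k (facedom e) (v.2 e) &
               forall e, facedom e `<=` boundary Omega ->
                 forall x, facedom e x -> v.2 e x = 0]].

Definition Qh0 (m : nat) : set wfunS :=
  [set q | [/\ forall K, Pol m.-1 (celldom K) (q.1 K),
               forall e, Pol m (facedom e) (q.2 e) &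
               \sum_(K : cell) cint K (q.1 K) = 0]].

Definition gradh (gam : nat) (v : wfunV) (K : cell) : 'rV[R]_n -> 'M[R]_n :=
  wgradV gam K (v.1 K) v.2.

Definition jump (k : nat) (v : wfunV) (K : cell) (e : face) x : 'rV[R]_n :=
  projBV k e (v.1 K) x - v.2 e x.

Definition ah (nu : R) (m k : nat) (u v : wfunV) : R :=
  nu * \sum_(K : cell)
         cint K (fun x => frob (gradh m.-1 u K x) (gradh m.-1 v K x)) +
  nu * \sum_(K : cell) \sum_(e : face | incident K e)
         fint e (fun x => (hK K)^-1 * dotv (jump k u K e x) (jump k v K e x)).

Definition bh (m : nat) (v : wfunV) (q : wfunS) : R :=
  \sum_(K : cell) cint K (fun x => dotv (wgrad m K (q.1 K) q.2 x) (v.1 K x)).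

Definition ch (alpha r : R) (kap u v : wfunV) : R :=
  alpha * \sum_(K : cell) cint K (fun x =>
    enorm (kap.1 K x) `^ (r - 2) * dotv (u.1 K x) (v.1 K x)).

Definition divtensor (gam : nat) (u kap : wfunV) (K : cell)
    : 'rV[R]_n -> 'rV[R]_n :=
  wdivT gam K (fun x => tensor (u.1 K x) (kap.1 K x))
              (fun e x => tensor (u.2 e x) (kap.2 e x)).

Definition dh (m : nat) (kap u v : wfunV) : R :=
  2^-1 * \sum_(K : cell)
           cint K (fun x => dotv (divtensor m u kap K x) (v.1 K x)) -
  2^-1 * \sum_(K : cell)
           cint K (fun x => dotv (divtensor m v kap K x) (u.1 K x)).

(* f is only given on Omega, which the closed elements cover up to a
   Lebesgue-null set. *)
Definition load Omega (f : 'rV[R]_n -> 'rV[R]_n) (v : wfunV) : R :=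
  \sum_(K : cell)
    \int[lebesgue_rV R n]_(x in Omega `&` celldom K) dotv (f x) (v.1 K x).

Definition WG_solution Omega (nu alpha r : R) (f : 'rV[R]_n -> 'rV[R]_n)
    (m k : nat) (u : wfunV) (p : wfunS) : Prop :=
  [/\ Vh0 Omega m k u, Qh0 m p,
      forall v, Vh0 Omega m k v ->
        ah nu m k u v + bh m v p + ch alpha r u u v + dh m u u v =
        load Omega f v &
      forall q, Qh0 m q -> bh m u q = 0].

Definition normV (m k : nat) (v : wfunV) : R :=
  Num.sqrt (
    \sum_(K : cell)
       cint K (fun x => frob (gradh m.-1 v K x) (gradh m.-1 v K x)) +
    \sum_(K : cell) \sum_(e : face | incident K e)
       fint e (fun x => (hK K)^-1 * dotv (jump k v K e x) (jump k v K e x))).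

Definition V0h Omega (m k : nat) : set wfunV :=
  [set v | Vh0 Omega m k v /\ forall q, Qh0 m q -> bh m v q = 0].

(* Both suprema are finite, the spaces being finite-dimensional; they are 0,
   by the convention [sup set0 = 0], if V0h is trivial. *)
Definition Nh Omega (m k : nat) : R :=
  sup [set y | exists kap u v : wfunV,
    [/\ V0h Omega m k kap /\ kap <> wzeroV, V0h Omega m k u /\ u <> wzeroV,
        V0h Omega m k v /\ v <> wzeroV &
        y = dh m kap u v / (normV m k kap * normV m k u * normV m k v)]].

Definition dual_norm Omega (f : 'rV[R]_n -> 'rV[R]_n) (m k : nat) : R :=
  sup [set y | exists v : wfunV,
    [/\ V0h Omega m k v, v <> wzeroV & y = load Omega f v / normV m k v]].

End mesh_theory.

(* Main.v *)
(* The scheme is a saddle point problem on finite-dimensional spaces. Its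
   skew-symmetric convection term vanishes on the diagonal and its damping term
   is monotone, so that every velocity has norm at most [||f|| / nu]; on a ball of
   radius between [||f|| / nu] and [nu / N_h], which is nonempty by the smallness
   condition, the velocity equation on the discretely divergence-free functions
   is Lipschitz and strongly monotone, and has exactly one solution. The pressure
   is the multiplier of the divergence constraint. What remains is specific to
   the weak operators: by the divergence formula on simplices, a weak function
   with zero weak gradient (and jump) is piecewise constant and matches its
   traces; as the cells are connected through faces, it is constant, hence zero
   by the condition on a boundary face (velocity) or on the mean (pressure). *)

(* [fingroup] comes before [Defs], whose [normal] has to hide its own. *)
From mathcomp Require Import all_boot fingroup perm.
Require Import Defs.
From mathcomp Require Import all_boot all_order all_algebra.
From mathcomp Require Import all_classical all_reals all_analysis measurable_realfun.
From mathcomp Require Import ring lra.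
Set Implicit Arguments.
Unset Strict Implicit.
Unset Printing Implicit Defensive.
Import Order.TTheory GRing.Theory Num.Theory.
Import numFieldNormedType.Exports.
Local Open Scope classical_set_scope.
Local Open Scope ring_scope.

(** * Lebesgue measure and affine maps *)

(** [normal], [projB], [wgrad] and [wdiv] are chosen by [xget], so even the linearity of the forms
    has to wait until the defining properties are shown solvable, and for the operators uniquely so.
    This forces the geometric prelude: [lebesgue_rV] is an iterated product and [fint] a Gram factor
    times a reference integral, so the determinant rule for affine maps and the rule that volume is
    height times base must be proved before the divergence formula can be reduced to one-dimensional
    calculus.

    Definiteness turns on polynomial degrees. For the velocity, [m.-1 <= k] lets the components of
    the gradient serve as tests both inside a cell and against the jump moments on its faces. The
    pressure has no stabilization; there the test degree [m] exceeds that of the interior pressure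
    by one, which leaves room for a bubble [lambda_i lambda_j] times a derivative of degree [m - 2].

    Finite dimension replaces completeness: the fixed point of the contraction is a minimizer over a
    compact ball, and instead of an inf-sup constant only injectivity of the transpose of [bh] is
    used. *)

Section affine_measure.
Context {R : realType}.
Local Notation mu := (@lebesgue_rV R).

(** The factor sits on the preimage side, so that only measurability of [f] is involved and factors
    multiply under composition. For [x |-> b + x *m M] it will be the absolute value of the
    determinant. *)
Definition measure_scaling d (T : measurableType d) (m : set T -> \bar R)
    (c : R) (f : T -> T) : Prop :=
  measurable_fun setT f /\
  forall A, measurable A -> (c%:E * m (f @^-1` A) = m A)%E.

Lemma measure_scaling_comp d (T : measurableType d) (m : set T -> \bar R)
    c1 c2 f1 f2 :
  measure_scaling m c1 f1 -> measure_scaling m c2 f2 ->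
  measure_scaling m (c1 * c2) (f1 \o f2).
Proof.
move=> [m1 H1] [m2 H2]; split; first exact: measurableT_comp.
move=> A mA; rewrite comp_preimage EFinM -muleA H2 ?H1//.
by rewrite -[X in measurable X]setTI; exact: m1.
Qed.

Lemma measurable_affine (a b : R) :
  measurable_fun setT (fun x : measurableTypeR R => a * x + b : measurableTypeR R).
Proof. by apply: measurable_funD => //; exact: measurable_funM. Qed.

(** Uniqueness of Lebesgue measure reduces the claim to intervals []c, d]]; a negative slope turns
    the preimage into an interval closed on the other side, of the same length. *)
Lemma lebesgue_measure_affine (a b : R) : a != 0 ->
  measure_scaling (@lebesgue_measure R) `|a| (fun x => a * x + b).
Proof.
move=> a0; split; first exact: measurable_affine.
move=> A mA; apply/esym.
pose f (x : measurableTypeR R) : measurableTypeR R := a * x + b.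
have mf : measurable_fun setT f by exact: measurable_affine.
have a0' : 0 < `|a| by rewrite normr_gt0.
pose pf := measure_function_pushforward__canonical__measure_function_Measure
  (@lebesgue_measure R) mf.
pose m : {measure set _ -> \bar R} := mscale (NngNum (ltW a0')) pf.
rewrite (@lebesgue_measure_unique R m) //.
move=> X [[c d] _ <-] /=.
rewrite /m /mscale /= /pushforward.
have [cd|dc] := ltP c d; last first.
  by rewrite set_itv_ge ?bnd_simp -?leNgt// preimage_set0 !measure0 mule0.
have [a1|a1|a1] := ltgtP a 0; last by rewrite a1 eqxx in a0.
- have -> : f @^-1` `]c, d] = `[(d - b) / a, (c - b) / a[%classic.
    apply/seteqP; split => x /=; rewrite !in_itv/= /f => /andP[] h1 h2; apply/andP; split.
    + by rewrite ler_ndivrMr//; lra.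
    + by rewrite ltr_ndivlMr//; lra.
    + by move: h2; rewrite ltr_ndivlMr//; lra.
    + by move: h1; rewrite ler_ndivrMr//; lra.
  rewrite !lebesgue_measure_itv/= !lte_fin cd ltr_nM2r ?invr_lt0// ltrD2r cd.
  by rewrite -!EFinD -EFinM ltr0_norm//; congr EFin; field.
- have -> : f @^-1` `]c, d] = `](c - b) / a, (d - b) / a]%classic.
    apply/seteqP; split => x /=; rewrite !in_itv/= /f => /andP[] h1 h2; apply/andP; split.
    + by rewrite ltr_pdivrMr//; lra.
    + by rewrite ler_pdivlMr//; lra.
    + by move: h1; rewrite ltr_pdivrMr//; lra.
    + by move: h2; rewrite ler_pdivlMr//; lra.
  rewrite !lebesgue_measure_itv/= !lte_fin cd ltr_pM2r ?invr_gt0// ltrD2r cd.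
  by rewrite -!EFinD -EFinM gtr0_norm//; congr EFin; field.
Qed.

Lemma measurable_affine_rV n m (b : 'rV[R]_m) (M : 'M[R]_(n, m)) :
  measurable_fun setT (fun t : 'rV[R]_n => b + t *m M).
Proof.
apply: measurable_fun_rVP => j.
rewrite [X in measurable_fun _ X](_ : _ =
  fun t : 'rV[R]_n => \sum_i rV_coord i t * M i j + b 0 j); last first.
  by apply/funext => t; rewrite /rV_coord /= !mxE addrC.
apply: measurable_funD => //; apply: measurable_sum => i.
by apply: measurable_funM => //; exact: measurable_rV_coord.
Qed.

Lemma lebesgue_rVSx n (A : set 'rV[R]_n.+1) : measurable A ->
  (mu n.+1 A = \int[@lebesgue_measure R]_x mu n [set y | A (consrV (x, y))])%E.
Proof.
move=> mA; rewrite /= /lebesgue_cons /pushforward /product_measure1.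
apply: eq_integral => x _ /=; congr (_ _).
by apply/seteqP; split => y; rewrite /xsection /= inE.
Qed.

Lemma measurable_consrV_preimage n (A : set 'rV[R]_n.+1) :
  measurable A -> measurable (@consrV R n @^-1` A).
Proof.
by move=> mA; rewrite -[X in measurable X]setTI; exact: measurable_consrV.
Qed.

(** [lebesgue_rV] is built by integrating in one order; the other order comes from uniqueness of the
    product measure. Shears that move the first coordinate by the others need it. *)
Lemma lebesgue_rVSy n (A : set 'rV[R]_n.+1) : measurable A ->
  (mu n.+1 A = \int[mu n]_y (@lebesgue_measure R) [set x | A (consrV (x, y))])%E.
Proof.
move=> mA; rewrite /= /lebesgue_cons /pushforward.
rewrite (product_measure_unique
  (m' := product_measure2 (@lebesgue_measure R) (mu n)))/=; last first.
- exact: measurable_consrV_preimage.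
- by move=> B C mB mC; exact: product_measure2E.
rewrite /product_measure2; apply: eq_integral => x _ /=; congr (_ _).
by apply/seteqP; split => y; rewrite /ysection /= inE.
Qed.


Lemma measurable_headrV n :
  measurable_fun setT (fun x : 'rV[R]_n.+1 => (unconsrV x).1).
Proof. exact: measurable_rV_coord. Qed.

Lemma measurable_tailrV n :
  measurable_fun setT (fun x : 'rV[R]_n.+1 => (unconsrV x).2).
Proof. exact: measurableT_comp measurable_snd (@measurable_unconsrV R n). Qed.

Lemma measure_scaling_integral_ge0 d (T : measurableType d)
    (m : {measure set T -> \bar R}) c f (D : set T) (g : T -> \bar R) :
  0 <= c -> measure_scaling m c f -> measurable D ->
  measurable_fun D g -> (forall x, D x -> 0 <= g x)%E ->
  (c%:E * \int[m]_(x in f @^-1` D) g (f x) = \int[m]_(x in D) g x)%E.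
Proof.
move=> c0 [mf fE] mD mg g0.
pose pf := measure_function_pushforward__canonical__measure_function_Measure m mf.
rewrite -(ge0_integral_pushforward mf)//; last by move=> x /set_mem /g0.
rewrite -[c]/(NngNum c0)%:num -(ge0_integral_mscale pf)//.
by apply: eq_measure_integral => A mA _; rewrite /= /mscale /= /pushforward fE.
Qed.

Lemma measurable_sectionx n (A : set 'rV[R]_n.+1) : measurable A ->
  measurable_fun setT
    (fun x : measurableTypeR R => mu n [set y | A (consrV (x, y))]).
Proof.
move=> mA; have := measurable_fun_xsection (mu n) (measurable_consrV_preimage mA).
congr measurable_fun; apply/funext => x /=; congr (mu n _).
by apply/seteqP; split => y; rewrite /xsection /= inE.
Qed.

Lemma measurable_sectiony n (A : set 'rV[R]_n.+1) : measurable A ->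
  measurable_fun setT
    (fun y : 'rV[R]_n => (@lebesgue_measure R) [set x | A (consrV (x, y))]).
Proof.
move=> mA; have := measurable_fun_ysection (@lebesgue_measure R) (measurable_consrV_preimage mA).
congr measurable_fun; apply/funext => x /=; congr (lebesgue_measure _).
by apply/seteqP; split => y; rewrite /ysection /= inE.
Qed.

Section block.
Variables (n : nat) (a : R) (D : 'M[R]_n).
Hypotheses (a0 : a != 0)
  (covD : forall b, measure_scaling (mu n) `|\det D| (fun x => b + x *m D)).

Let mD b : measurable_fun setT (fun x : 'rV[R]_n => b + x *m D).
Proof. exact: (covD b).1. Qed.

(** With the first coordinate fixed, the map acts on the others as [D] followed by a translation, so
    the slices scale by [|\det D|] and the outer integral by [|a|]. *)
Lemma measure_scaling_ublock (b0 : R) (b b' : 'rV[R]_n) :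
  measure_scaling (mu n.+1) (`|a| * `|\det D|)
    (fun x => consrV (a * (unconsrV x).1 + b0,
       ((unconsrV x).1 *: b + b') + (unconsrV x).2 *m D)).
Proof.
set f := (X in measure_scaling _ _ X).
have mf : measurable_fun setT f.
  apply: (measurableT_comp (@measurable_consrV R n)).
  apply: measurable_fun_pair.
    exact: (measurableT_comp (measurable_affine a b0) (@measurable_headrV n)).
  apply: measurable_fun_rVP => i.
  rewrite [X in measurable_fun _ X](_ : _ = fun x =>
    rV_coord i (b' + (unconsrV x).2 *m D) + (unconsrV x).1 * b 0 i); last first.
    by apply/funext => x; rewrite /rV_coord /= !mxE; ring.
  apply: measurable_funD.
    apply: (measurableT_comp (measurable_rV_coord i)).
    exact: (measurableT_comp (mD b') (@measurable_tailrV n)).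
  by apply: measurable_funM => //; exact: measurable_headrV.
split=> // A mA.
have mfA : measurable (f @^-1` A) by rewrite -[X in measurable X]setTI; exact: mf.
have fE x y : f (consrV (x, y)) = consrV (a * x + b0, x *: b + b' + y *m D).
  by rewrite /f consrVK.
rewrite lebesgue_rVSx// lebesgue_rVSx// EFinM -muleA.
rewrite -ge0_integralZl//; last 1 first.
  exact: measurable_sectionx.
rewrite -[RHS](measure_scaling_integral_ge0 _ (lebesgue_measure_affine b0 a0))//; last first.
  exact: measurable_sectionx.
rewrite preimage_setT; congr (_ * _)%E; apply: eq_integral => x _.
rewrite -[RHS](covD (x *: b + b')).2; last first.
  have := measurable_xsection (a * x + b0) (measurable_consrV_preimage mA).
  by congr measurable; apply/seteqP; split => y; rewrite /xsection /= inE.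
congr (_ * mu n _)%E; apply/seteqP; split => y; by rewrite /preimage/mkset fE.
Qed.

(** Here the translation depends on the tail, so the slicing goes the other way: with the tail
    fixed, the head undergoes a one-dimensional affine map. *)
Lemma measure_scaling_lblock (c : 'cV[R]_n) :
  measure_scaling (mu n.+1) (`|a| * `|\det D|)
    (fun x => consrV (a * (unconsrV x).1 + ((unconsrV x).2 *m c) 0 0,
       0 + (unconsrV x).2 *m D)).
Proof.
set f := (X in measure_scaling _ _ X).
have mf : measurable_fun setT f.
  apply: (measurableT_comp (@measurable_consrV R n)).
  apply: measurable_fun_pair; last first.
    exact: (measurableT_comp (mD 0) (@measurable_tailrV n)).
  apply: measurable_funD.
    by apply: measurable_funM => //; exact: measurable_headrV.
  rewrite [X in measurable_fun _ X](_ : _ = fun x =>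
    rV_coord 0 (0 + (unconsrV x).2 *m c)); last first.
    by apply/funext => x; rewrite /rV_coord add0r.
  apply: (measurableT_comp (measurable_rV_coord 0)).
  exact: (measurableT_comp (measurable_affine_rV 0 c) (@measurable_tailrV n)).
split=> // A mA.
have mfA : measurable (f @^-1` A) by rewrite -[X in measurable X]setTI; exact: mf.
have fE x y : f (consrV (x, y)) = consrV (a * x + (y *m c) 0 0, 0 + y *m D).
  by rewrite /f consrVK.
rewrite lebesgue_rVSy// lebesgue_rVSy// mulrC EFinM -muleA.
rewrite -ge0_integralZl//; last 1 first.
  exact: measurable_sectiony.
rewrite -[RHS](measure_scaling_integral_ge0 _ (covD 0))//; last first.
  exact: measurable_sectiony.
rewrite preimage_setT; congr (_ * _)%E; apply: eq_integral => y _.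
rewrite -[RHS](lebesgue_measure_affine ((y *m c) 0 0) a0).2; last first.
  have := measurable_ysection (0 + y *m D) (measurable_consrV_preimage mA).
  by congr measurable; apply/seteqP; split => x; rewrite /ysection /= inE.
congr (_ * lebesgue_measure _)%E; apply/seteqP; split => x; by rewrite /preimage/mkset fE.
Qed.

End block.


Lemma unconsrVK n : cancel (@unconsrV R n) (@consrV R n).
Proof.
move=> x; apply: etrans (@hsubmxK _ 1 1 n x); congr (row_mx _ _).
by apply/rowP => i; rewrite !mxE !ord1; congr (x 0 _); exact: val_inj.
Qed.

Lemma consrV_mul_block n (p t : measurableTypeR R * 'rV[R]_n) (a : R)
    (b : 'rV_n) (c : 'cV_n) (D : 'M[R]_n) :
  consrV t + consrV p *m (block_mx a%:M b c D : 'M[R]_(1 + n)) =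
  consrV (a * p.1 + (p.2 *m c) 0 0 + t.1, (p.1 *: b + t.2) + p.2 *m D).
Proof.
have mE : consrV p *m (block_mx a%:M b c D : 'M[R]_(1 + n)) =
    row_mx ((const_mx (p.1 : R) : 'M[R]_1) *m a%:M + p.2 *m c)
           ((const_mx (p.1 : R) : 'M[R]_1) *m b + p.2 *m D).
  exact: (@mul_row_block R 1 1 n 1 n).
rewrite mE; apply: etrans (@add_row_mx _ 1 1 n _ _ _ _) _; congr (row_mx _ _).
  apply/rowP => i; rewrite !ord1 mul_mx_scalar !mxE /=; ring.
apply/rowP => i; rewrite !mxE big_ord1 !mxE /=; ring.
Qed.

(** Induction by block elimination: a matrix with nonzero corner is a unipotent lower block times an
    upper block carrying the Schur complement, and each factor scales by slicing. *)
Theorem measure_scaling_lebesgue_rV n (M : 'M[R]_n) (b : 'rV[R]_n) :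
  M \in unitmx -> measure_scaling (mu n) `|\det M| (fun x => b + x *m M).
Proof.
elim: n M b => [|n IH] M b uM.
  have -> : (fun x : 'rV[R]_0 => b + x *m M) = id.
    by apply/funext => x; rewrite !thinmx0; apply/rowP => -[].
  split; first exact: measurable_id.
  by move=> A mA; rewrite det_mx00 normr1 mul1e preimage_id.
have step (M' : 'M[R]_n.+1) (b' : 'rV[R]_n.+1) : M' 0 0 != 0 -> M' \in unitmx ->
    measure_scaling (mu n.+1) `|\det M'| (fun x => b' + x *m M').
  move=> m0 uM'; pose a := M' 0 0.
  pose c := @dlsubmx _ 1 n 1 n M'; pose r := @ursubmx _ 1 n 1 n M'.
  pose D := @drsubmx _ 1 n 1 n M' - a^-1 *: (c *m r).
  have aE : @ulsubmx _ 1 n 1 n M' = a%:M.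
    by apply/matrixP => i j; rewrite !mxE !ord1 /= mulr1n; congr (M' _ _); exact: val_inj.
  have ME : M' = (block_mx 1%:M 0 (a^-1 *: c) 1%:M : 'M[R]_(1 + n)) *m
                 (block_mx a%:M r 0 D : 'M[R]_(1 + n)).
    rewrite (@mulmx_block R 1 n 1 n 1 n) !mul1mx !mul0mx !addr0.
    rewrite mul_mx_scalar scalerA mulfV// scale1r -aE -scalemxAl addrCA subrr addr0.
    exact/esym/(@submxK _ 1 n 1 n).
  have dE : \det M' = a * \det D.
    rewrite ME det_mulmx (@det_lblock _ 1 n) (@det_ublock _ 1 n) !det1 !mul1r.
    by rewrite det_mx11 mxE mulr1n.
  have uD : D \in unitmx.
    by move: uM'; rewrite !unitmxE dE unitrM => /andP[].
  have -> : (fun x => b' + x *m M') = (fun x => b' + x *m (block_mx a%:M r 0 D : 'M[R]_(1 + n))) \o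
     (fun x => 0 + x *m (block_mx 1%:M 0 (a^-1 *: c) 1%:M : 'M[R]_(1 + n))).
    by apply/funext => x /=; rewrite add0r -mulmxA -ME.
  rewrite dE normrM -[X in measure_scaling _ X]mulr1.
  apply: measure_scaling_comp.
    have := measure_scaling_ublock m0 (fun b => IH D b uD)
      (unconsrV b').1 r (unconsrV b').2.
    congr measure_scaling; apply/funext => x.
    rewrite -[in RHS](unconsrVK b') -[in RHS](unconsrVK x) consrV_mul_block.
    by rewrite mulmx0 mxE addr0.
  have := measure_scaling_lblock (oner_neq0 R) (fun b => IH 1%:M b (unitmx1 _ _)) (a^-1 *: c).
  rewrite det1 normr1 mulr1.
  congr measure_scaling; apply/funext => x.
  rewrite -[in RHS](unconsrVK x) -[X in _ = X + _](unconsrVK 0) consrV_mul_block.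
  congr (consrV (_, _)); first by rewrite /= [X in _ = _ + X]mxE addr0.
  by rewrite scaler0; congr (_ + _); apply/rowP => i; rewrite !mxE ?addr0.
(* A vanishing pivot is repaired by adding to row 0 a row [i] with [M i 0 != 0]: this is
   multiplication by the unipotent [U 1] of determinant 1, and [U (-1)] undoes it. *)
have [m0|m0] := eqVneq (M 0 0) 0; last exact: step.
have [i Mi] : exists i, M i 0 != 0.
  apply/existsP; apply: contraT; rewrite negb_exists => /forallP M0.
  move: uM; rewrite unitmxE (expand_det_col _ 0) big1 ?unitr0// => i _.
  by have := M0 i; rewrite negbK => /eqP ->; rewrite mul0r.
have [j ij] : exists j, i = lift 0 j.
  by case: (unliftP 0 i) Mi => [j ->|->]; [exists j|rewrite m0 eqxx].
pose e : 'rV[R]_n := delta_mx 0 j.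
pose U (s : R) : 'M[R]_n.+1 := (block_mx 1%:M (s *: e) 0 1%:M : 'M[R]_(1 + n)).
have UK : U (-1) *m U 1 = 1%:M.
  rewrite /U (@mulmx_block R 1 n 1 n 1 n) !mul1mx !mulmx0 !mul0mx !mulmx1.
  by rewrite !addr0 add0r scaleN1r scale1r subrr (@scalar_mx_block _ 1 n).
have dU s : \det (U s) = 1 by rewrite (@det_ublock _ 1 n) !det1 mulr1.
have -> : (fun x => b + x *m M) = (fun x => b + x *m (U 1 *m M)) \o
   (fun x => 0 + x *m U (-1)).
  by apply/funext => x /=; rewrite add0r -mulmxA (mulmxA (U (-1))) UK mul1mx.
rewrite -[X in measure_scaling _ X]mulr1; apply: measure_scaling_comp.
  have -> : \det M = \det (U 1 *m M) by rewrite det_mulmx dU mul1r.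
  apply: step.
    have -> : (U 1 *m M) 0 0 = M i 0.
      have Ue k : U 1 0 (lift 0 k) = (k == j)%:R.
        transitivity (U 1 (@lshift 1 n 0) (@rshift 1 n k)).
          by congr (U 1 _ _); exact: val_inj.
        by rewrite /U (@block_mxEur R 1 n 1 n) !mxE mul1r eqxx.
      rewrite mxE big_ord_recl m0 mulr0 add0r (bigD1 j)//= big1 ?addr0.
        by rewrite Ue eqxx mul1r ij.
      by move=> k /negPf kj; rewrite Ue kj mul0r.
    exact: Mi.
  by rewrite unitmx_mul uM andbT unitmxE dU unitr1.
have := measure_scaling_ublock (oner_neq0 R) (fun b => IH 1%:M b (unitmx1 _ _)) 0 (-1 *: e) 0.
rewrite det1 normr1 mulr1.
congr measure_scaling; apply/funext => x.
rewrite -[in RHS](unconsrVK x) -[X in _ = X + _](unconsrVK 0) consrV_mul_block.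
congr (consrV (_, _)); first by rewrite /= mulmx0 !mxE !addr0.
by congr (_ + _ + _); apply/rowP => k; rewrite !mxE.
Qed.


End affine_measure.

(** * Change of variables, cubes and measurability of open sets *)

Section Rintegral_affine.
Context {R : realType}.
Local Notation mu := (@lebesgue_rV R).

Lemma measure_scaling_integral d (T : measurableType d)
    (m : {measure set T -> \bar R}) c f (D : set T) (g : T -> R) :
  0 < c -> measure_scaling m c f -> measurable D ->
  m.-integrable D (EFin \o g) ->
  m.-integrable (f @^-1` D) (EFin \o (g \o f)) /\
  c * \int[m]_(x in f @^-1` D) g (f x) = \int[m]_(x in D) g x.
Proof.
move=> c0 fc mD ig; have [mf fE] := fc.
have mg := measurable_int _ ig.
have mfD : measurable (f @^-1` D) by rewrite -[X in measurable X]setTI; exact: mf.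
have mgf : measurable_fun (f @^-1` D) (EFin \o g \o f).
  apply: (measurable_comp mD) => //; first by move=> _ [x fx <-].
  exact: measurable_funTS.
have igf : m.-integrable (f @^-1` D) (EFin \o (g \o f)).
  apply/integrableP; split => //.
  have := integrableP _ _ _ ig => -[_].
  rewrite -(measure_scaling_integral_ge0 (ltW c0) fc mD); last 2 first.
    exact: measurableT_comp.
    by [].
  apply: contraPP => /negP; rewrite -leNgt leye_eq => /eqP ->.
  by rewrite gt0_muley// ltxx.
split => //; rewrite /Rintegral.
rewrite [in RHS]integralE [in LHS]integralE.
have mgp := measurable_funepos mg; have mgn := measurable_funeneg mg.
rewrite -(measure_scaling_integral_ge0 (ltW c0) fc mD mgp)//.
rewrite -(measure_scaling_integral_ge0 (ltW c0) fc mD mgn)//.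
have fP := integrable_pos_fin_num mfD igf.
have fN := integrable_neg_fin_num mfD igf.
have pE : (EFin \o (g \o f))^\+%E = (EFin \o g)^\+%E \o f by exact: (funepos_comp (EFin \o g) f).
have nE : (EFin \o (g \o f))^\-%E = (EFin \o g)^\-%E \o f by exact: (funeneg_comp (EFin \o g) f).
rewrite pE in fP; rewrite nE in fN.
rewrite (_ : (fun x : T => ((g \o f) x)%:E) = EFin \o (g \o f))// pE nE.
set P := (X in (_ * X - _)%E); set N := (X in (_ - _ * X)%E).
rewrite -/P -/N.
change (c * fine (P - N)%E = fine (c%:E * P - c%:E * N)%E).
have -> : P = (fine P)%:E by exact/esym/fineK/fP.
have -> : N = (fine N)%:E by exact/esym/fineK/fN.
by rewrite -!EFinM -!EFinB /= mulrBr.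
Qed.

Lemma Rintegral_affine n (M : 'M[R]_n) (b : 'rV[R]_n) D (g : 'rV[R]_n -> R) :
  M \in unitmx -> measurable D -> (mu n).-integrable D (EFin \o g) ->
  let f := fun x => b + x *m M in
  (mu n).-integrable (f @^-1` D) (EFin \o (g \o f)) /\
  `|\det M| * \int[mu n]_(x in f @^-1` D) g (f x) = \int[mu n]_(x in D) g x.
Proof.
move=> uM mD ig f; apply: measure_scaling_integral => //.
  by rewrite normr_gt0 -unitfE -unitmxE.
exact: measure_scaling_lebesgue_rV.
Qed.

Lemma ball_rVE n (c x : 'rV[R]_n) e : 0 < e ->
  ball c e x <-> forall i, `|c 0 i - x 0 i| < e.
Proof.
move=> e0; split=> [[_ h] i|h]; first exact: h.
by split => // i j; rewrite ord1; exact: h.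
Qed.

Lemma ball_consrV n (c : 'rV[R]_n.+1) e : 0 < e ->
  @consrV R n @^-1` (ball c e) =
  ball ((unconsrV c).1 : R) e `*` ball (unconsrV c).2 e.
Proof.
move=> e0; apply/seteqP; split => -[x0 x] /=.
  move=> /(ball_rVE _ _ e0) h; split.
    have := h ord0; rewrite /ball /= /consrV mxE; case: splitP => // j _.
    by rewrite mxE.
  apply/(ball_rVE _ _ e0) => i.
  have := h (@rshift 1 n i); rewrite /consrV (@row_mxEr _ _ 1 n) !mxE; exact.
move=> [h0 /(ball_rVE _ _ e0) h]; apply/(ball_rVE _ _ e0) => i.
rewrite /consrV mxE; case: (@splitP 1 n i) => j ij.
  by rewrite mxE; move: h0; rewrite /ball /=; congr (`|c _ _ - _| < _); apply: val_inj; rewrite /= ij ord1.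
by have := h j; rewrite !mxE; congr (`|c _ _ - _| < _); exact: val_inj.
Qed.

Lemma measurable_ball_rV n (c : 'rV[R]_n) e : measurable (ball c e).
Proof.
have [e0|e0] := ltP 0 e; last first.
  rewrite (_ : ball c e = set0) //; apply/seteqP; split => // x [].
  by rewrite ltNge e0.
have -> : ball c e = ~` \bigcup_i ~` (rV_coord i @^-1` ball (c 0 i) e).
  rewrite setC_bigcup; apply/seteqP; split => x.
    by move=> /(ball_rVE _ _ e0) h i _; rewrite setCK; exact: h.
  by move=> h; apply/(ball_rVE _ _ e0) => i; have := h i I; rewrite setCK.
apply: measurableC; apply: countable_bigcupT_measurable; first exact: countableP.
move=> i; apply: measurableC; rewrite -[X in measurable X]setTI.
apply: measurable_rV_coord => //; exact: measurable_ball.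
Qed.

(** Balls of the sup norm are cubes, hence products of intervals, so the induction follows the
    product definition of the measure. *)
Lemma lebesgue_rV_ball n (c : 'rV[R]_n) e : 0 < e ->
  mu n (ball c e) = ((e *+ 2) ^+ n)%:E.
Proof.
elim: n c => [|n IH] c e0.
  rewrite expr0 /= diracE mem_set//; apply/(ball_rVE _ _ e0) => -[].
  by [].
rewrite /= /lebesgue_cons /pushforward ball_consrV// product_measure1E//=; last 2 first.
  exact: measurable_ball.
  exact: measurable_ball_rV.
by rewrite IH// lebesgue_measure_ball ?ltW// exprS EFinM.
Qed.

(** The sigma-algebra is generated by the coordinates, not by the open sets; an open set is
    recovered as a countable union of cubes with rational centres and radii [1 / (k + 1)]. *)
Lemma open_measurable_rV n (A : set 'rV[R]_n) : open A -> measurable A.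
Proof.
move=> oA.
pose B (i : 'rV[rat]_n * nat) : set 'rV[R]_n :=
  if asbool (ball (map_mx ratr i.1 : 'rV[R]_n) i.2.+1%:R^-1 `<=` A)
  then ball (map_mx ratr i.1 : 'rV[R]_n) i.2.+1%:R^-1 else set0.
have -> : A = \bigcup_i B i.
  apply/seteqP; split => x; last first.
    by case=> i _; rewrite /B; case: asboolP => // h /h.
  move=> Ax; have /nbhs_ballP[e /= e0 eA] := open_nbhs_nbhs (conj oA Ax).
  have [k ke] : exists k, 2 * k.+1%:R^-1 < e.
    have [k hk] := @ltr_add_invr R 0 (e / 2) ltac:(by rewrite divr_gt0).
    by exists k; rewrite add0r ltr_pdivlMr// in hk; rewrite mulrC.
  move: ke; set z : R := k.+1%:R^-1 => ke; have k0 : 0 < z by rewrite invr_gt0.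
  have [q qx] : exists q : 'rV[rat]_n, forall i, `|x 0 i - ratr (q 0 i)| < z.
    have : forall i, exists q : rat, `|x 0 i - ratr q| < z.
      move=> i; have [q] := @rat_in_itvoo R (x 0 i - z) (x 0 i + z) ltac:(lra).
      by rewrite in_itv /= => /andP[? ?]; exists q; rewrite ltr_norml; apply/andP; split; lra.
    by move=> /choice[q hq]; exists (\row_i q i) => i; rewrite mxE.
  have qA : ball (map_mx ratr q : 'rV[R]_n) z `<=` A.
    move=> y /(ball_rVE _ _ k0) h; apply: eA; apply/(ball_rVE _ _ e0) => i.
    have := h i; have := qx i; rewrite mxE => h1 h2.
    rewrite (_ : _ - _ = (x 0 i - ratr (q 0 i)) + (ratr (q 0 i) - y 0 i)); last by ring.
    by rewrite (le_lt_trans (ler_normD _ _))//; lra.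
  exists (q, k) => //; rewrite /B; case: asboolP => // _.
  by apply/(ball_rVE _ _ k0) => i; rewrite mxE distrC.
apply: countable_bigcupT_measurable; first exact: countableP.
by move=> i; rewrite /B; case: asboolP => // _; exact: measurable_ball_rV.
Qed.

Lemma closed_measurable_rV n (A : set 'rV[R]_n) : closed A -> measurable A.
Proof. move=> /closed_openC /open_measurable_rV mA; rewrite -[A]setCK.
exact: measurableC. Qed.

Lemma bounded_lebesgue_rV n (A : set 'rV[R]_n) :
  measurable A -> bounded_set A -> (mu n A < +oo)%E.
Proof.
move=> mA [M [_ AM]].
have b : A `<=` ball (0 : 'rV[R]_n) (`|M| + 2).
  move=> x Ax; rewrite mx_norm_ball /ball_ /= sub0r normrN.
  have hM : M < `|M| + 1 by rewrite ltr_pwDr// ler_norm.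
  by have /= := AM _ hM _ Ax; lra.
apply: (le_lt_trans (le_measure _ _ _ b)); rewrite ?inE//.
  exact: measurable_ball_rV.
have h : 0 < `|M| + 2 by rewrite ltr_wpDl.
exact: (eq_ind _ (fun z => (z < +oo)%E) (ltry _) _ (esym (@lebesgue_rV_ball n 0 _ h))).
Qed.

End Rintegral_affine.

(** * Polynomial functions *)

Section pol.
Context {R : realType}.

(** An inductive form of [polyfun], equivalent to it by [polyfunP]: closure properties become
    inductions on the construction instead of manipulations of coefficient families. The index is
    only an upper bound for the degree. *)
Inductive pol n : nat -> ('rV[R]_n -> R) -> Prop :=
| pol_cst j c : pol j (fun=> c)
| pol_coordM j i p : pol j p -> pol j.+1 (fun x => x 0 i * p x)
| polD j p q : pol j p -> pol j q -> pol j (fun x => p x + q x).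

Lemma pol_ext n j (p q : 'rV[R]_n -> R) : (forall x, p x = q x) -> pol j p -> pol j q.
Proof. by move=> /funext ->. Qed.

Lemma pol_le n i j (p : 'rV[R]_n -> R) : (i <= j)%N -> pol i p -> pol j p.
Proof.
move=> ij pp; elim: pp j ij => {i p}.
- by move=> i c j _; exact: pol_cst.
- by move=> i k p _ ih [//|j] ij; apply: pol_coordM; exact: ih.
- by move=> i p q _ ihp _ ihq j ij; apply: polD; [exact: ihp|exact: ihq].
Qed.

Lemma polZ n j c (p : 'rV[R]_n -> R) : pol j p -> pol j (fun x => c * p x).
Proof.
elim=> {j p}.
- by move=> j d; exact: pol_cst.
- move=> j i p _ ih; apply: pol_ext (pol_coordM i ih) => x; ring.
- move=> j p q _ ihp _ ihq; apply: pol_ext (polD ihp ihq) => x; ring.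
Qed.

Lemma polM n i j (p q : 'rV[R]_n -> R) :
  pol i p -> pol j q -> pol (i + j) (fun x => p x * q x).
Proof.
move=> pp pq; elim: pp => {i p}.
- by move=> i c; apply/polZ/(pol_le (leq_addl i j)).
- move=> i k p _ ih; rewrite addSn; apply: pol_ext (pol_coordM k ih) => x; ring.
- move=> i p r _ ihp _ ihr; apply: pol_ext (polD ihp ihr) => x; ring.
Qed.

Lemma polN n j (p : 'rV[R]_n -> R) : pol j p -> pol j (fun x => - p x).
Proof. by move=> /(polZ (-1)); apply: pol_ext => x; rewrite mulN1r. Qed.

Lemma polB n j (p q : 'rV[R]_n -> R) : pol j p -> pol j q ->
  pol j (fun x => p x - q x).
Proof. by move=> pp /polN; exact: polD. Qed.

Lemma pol_sum n j (I : Type) (s : seq I) (P : pred I) (p : I -> 'rV[R]_n -> R) :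
  (forall i, P i -> pol j (p i)) -> pol j (fun x => \sum_(i <- s | P i) p i x).
Proof.
move=> pp; elim: s => [|i s ih].
  by apply: pol_ext (pol_cst _ j 0) => x; rewrite big_nil.
have [Pi|Pi] := boolP (P i).
  by apply: pol_ext (polD (pp i Pi) ih) => x; rewrite big_cons Pi.
by apply: pol_ext ih => x; rewrite big_cons (negPf Pi).
Qed.

Lemma pol_coord n (i : 'I_n) : pol 1 (fun x => x 0 i).
Proof. by apply: pol_ext (pol_coordM i (pol_cst _ 0 1)) => x; rewrite mulr1. Qed.

Lemma pol_dotv n (b : 'rV[R]_n) : pol 1 (fun x => dotv x b).
Proof.
apply: pol_sum => i _.
by apply: pol_ext (polZ (b 0 i) (pol_coord i)) => x; rewrite mulrC.
Qed.

Lemma pol_affine n (b : 'rV[R]_n) c : pol 1 (fun x => dotv x b + c).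
Proof. by apply: polD; [exact: pol_dotv|exact: pol_cst]. Qed.

Lemma pol_exp n k j (p : 'rV[R]_n -> R) : pol j p -> pol (k * j) (fun x => p x ^+ k).
Proof.
move=> pp; elim: k => [|k ih]; first exact: pol_cst.
by apply: pol_ext (polM pp ih) => x; rewrite exprS.
Qed.

Lemma pol_monomial n (a : 'I_n -> nat) (s : seq 'I_n) :
  pol (\sum_(i <- s) a i) (fun x : 'rV[R]_n => \prod_(i <- s) x 0 i ^+ a i).
Proof.
elim: s => [|i s ih].
  by apply: pol_ext (pol_cst _ _ 1) => x; rewrite big_nil.
rewrite big_cons; have := polM (pol_exp (a i) (pol_coord i)) ih.
by rewrite muln1; apply: pol_ext => x; rewrite big_cons.
Qed.

Lemma monomial_polyfun n j (a : 'I_n -> nat) c : (\sum_i a i <= j)%N ->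
  polyfun j (fun x : 'rV[R]_n => c * \prod_i x 0 i ^+ a i).
Proof.
move=> aj.
have aj' i : (a i <= j)%N.
  by apply: leq_trans aj; rewrite (bigD1 i)//= leq_addr.
pose b : {ffun 'I_n -> 'I_j.+1} := [ffun i => inord (a i)].
have bE i : b i = a i :> nat by rewrite ffunE inordK // ltnS.
exists (fun b' => if b' == b then c else 0) => x.
rewrite (bigD1 b)/=; last by under eq_bigr do rewrite bE.
rewrite eqxx [X in _ + X]big1 ?addr0.
  by congr (_ * _); apply: eq_bigr => i _; rewrite bE.
by move=> d /andP[_ /negPf ->]; rewrite mul0r.
Qed.

Lemma polyfunD n j (p q : 'rV[R]_n -> R) :
  polyfun j p -> polyfun j q -> polyfun j (fun x => p x + q x).
Proof.
move=> [c hc] [d hd]; exists (fun a => c a + d a) => x.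
by rewrite hc hd -big_split; apply: eq_bigr => a _; rewrite mulrDl.
Qed.

Lemma polyfunP n j (p : 'rV[R]_n -> R) : polyfun j p <-> pol j p.
Proof.
split=> [[c hc]|].
  apply: (@pol_ext _ _ (fun x => \sum_(a : {ffun 'I_n -> 'I_j.+1} | (\sum_i a i <= j)%N)
            c a * \prod_i x 0 i ^+ a i)) => //.
  by apply: pol_sum => a aj; apply/polZ/(pol_le aj)/pol_monomial.
(* The claim is strengthened by a monomial factor that absorbs the coordinates met on the way down;
   the degree spent on it is deducted from [l]. *)
suff : pol j p -> forall (a : 'I_n -> nat) l c, (\sum_i a i + j <= l)%N ->
    polyfun l (fun x : 'rV[R]_n => c * \prod_i x 0 i ^+ a i * p x).
  move=> h /h /(_ (fun=> 0%N) j 1); rewrite big1// add0n => /(_ (leqnn _)).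
  by congr polyfun; apply/funext => x; rewrite big1 ?mul1r.
elim=> {j p}.
- move=> j d a l c al.
  have := @monomial_polyfun n l a (c * d) (leq_trans (leq_addr _ _) al).
  by congr polyfun; apply/funext => x; ring.
- move=> j i p _ ih a l c al.
  pose a' k := (a k + (k == i))%N.
  have a'E : (\sum_k a' k + j <= l)%N.
    rewrite big_split/= (_ : \sum_k (k == i) = 1)%N ?addn1 ?addSnnS//.
    by rewrite (bigD1 i)//= eqxx big1 ?addn0// => k /negPf ->.
  have := ih a' l c a'E; congr polyfun; apply/funext => x.
  rewrite -!mulrA; congr (_ * _); rewrite mulrA; congr (_ * _).
  rewrite (eq_bigr (fun k => x 0 k ^+ a k * x 0 k ^+ (k == i))) => [|k _]; last by rewrite exprD.
  rewrite big_split/=; congr (_ * _); rewrite (bigD1 i)//= eqxx expr1 big1 ?mulr1//.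
  by move=> k /negPf ->; rewrite expr0.
- move=> j p q _ ihp _ ihq a l c al; have := polyfunD (ihp a l c al) (ihq a l c al).
  by congr polyfun; apply/funext => x; ring.
Qed.

Lemma pol_comp_affine n d j (p : 'rV[R]_n -> R) (b : 'rV[R]_n) (M : 'M[R]_(d, n)) :
  pol j p -> pol j (fun t => p (b + t *m M)).
Proof.
elim=> {j p}.
- by move=> j c; exact: pol_cst.
- move=> j i p _ ih; rewrite -add1n; apply: polM => //.
  apply: pol_ext (@pol_affine _ (\row_k M k i) (b 0 i)) => t.
  by rewrite !mxE addrC; congr (_ + _); apply: eq_bigr => k _; rewrite mxE.
- by move=> j p q _ ihp _ ihq; exact: polD.
Qed.

Lemma pol_measurable n j (p : 'rV[R]_n -> R) D : pol j p -> measurable_fun D p.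
Proof.
move=> pp; apply: measurable_funTS; elim: pp => {j p}.
- by move=> j c; exact: measurable_cst.
- by move=> j i p _ ih; apply: measurable_funM => //; exact: measurable_rV_coord.
- by move=> j p q _ ihp _ ihq; exact: measurable_funD.
Qed.

Lemma is_derive_coord n (i : 'I_n) (x v : 'rV[R]_n) :
  is_derive x v (fun y : 'rV[R]_n => y 0 i) (v 0 i).
Proof.
have @f : {linear 'rV[R]_n -> R}.
  by exists (fun N : 'rV[R]_n => N 0 i); do 2![eexists]; do ?[constructor];
     rewrite ?mxE// => ? *; rewrite ?mxE//; move=> ?; rewrite !mxE.
rewrite (_ : (fun _ => _) = f) // (_ : v 0 i = f v)//.
have cf : continuous f by exact: coord_continuous.
have df : differentiable f x by exact: linear_differentiable.
by apply: DeriveDef; [exact: diff_derivable|rewrite deriveE// diff_lin].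
Qed.

(** The clause for [j = 0] compensates for [0.-1 = 0]: without it the product rule would assign
    degree 1 to [x_i p'] when [p] is constant, and the bound [j.-1] would be lost. *)
Lemma pol_derive n j (p : 'rV[R]_n -> R) (v : 'rV[R]_n) : pol j p ->
  exists p', [/\ pol j.-1 p', j = 0%N -> forall x, p' x = 0 &
    forall x, is_derive x v p (p' x)].
Proof.
elim=> {j p}.
- by move=> j c; exists (fun=> 0); split => //; [exact: pol_cst|move=> x; exact: is_derive_cst].
- move=> j i p pp [p' [pp' p'0 hp']]; exists (fun x => v 0 i * p x + x 0 i * p' x).
  split => //.
    apply: polD; first exact: polZ.
    case: j pp pp' p'0 {hp'} => [|j] pp pp' p'0.
      by apply: pol_ext (pol_cst _ _ 0) => x; rewrite p'0 // mulr0.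
    exact: pol_coordM.
  move=> x; have h1 := is_derive_coord i x v; have h2 := hp' x.
  by apply: is_derive_eq; rewrite /GRing.scale /= addrC mulrC [X in _ + X]mulrC.
- move=> j p q _ [p' [pp' p'0 hp']] _ [q' [pq' q'0 hq']].
  exists (fun x => p' x + q' x); split; first exact: polD.
    by move=> j0 x; rewrite p'0// q'0// addr0.
  by move=> x; have h1 := hp' x; have h2 := hq' x; apply: is_derive_eq.
Qed.

Lemma pol_differentiable n j (p : 'rV[R]_n -> R) x : pol j p -> differentiable p x.
Proof.
elim=> {j p}.
- by move=> j c; exact: differentiable_cst.
- move=> j i p _ ih; apply: differentiableM => //; exact: differentiable_coord.
- by move=> j p q _ ihp _ ihq; exact: differentiableD.
Qed.

Lemma pol_continuous n j (p : 'rV[R]_n -> R) : pol j p -> continuous p.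
Proof. by move=> pp x; exact/differentiable_continuous/(pol_differentiable _ pp). Qed.

Lemma pol_derive_pol n j (p : 'rV[R]_n -> R) v : pol j p -> pol j.-1 ('D_v p).
Proof.
move=> /(pol_derive v)[p' [pp' _ hp']]; apply: pol_ext pp' => x.
by have := hp' x => hx; rewrite derive_val.
Qed.

Lemma pol_derivable n j (p : 'rV[R]_n -> R) v x : pol j p -> derivable p x v.
Proof. by move=> /(pol_differentiable x); exact: diff_derivable. Qed.

Lemma pol_derive_lin n j (p : 'rV[R]_n -> R) v x : pol j p ->
  'D_v p x = \sum_i v 0 i * 'D_(ebasis i) p x.
Proof.
move=> pp; have dp := pol_differentiable x pp.
rewrite deriveE// [v in LHS]row_sum_delta linear_sum; apply: eq_bigr => i _.
by rewrite linearZ deriveE.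
Qed.

Lemma pol_line n j (p : 'rV[R]_n -> R) (x v : 'rV[R]_n) : pol j p ->
  exists q : {poly R}, forall t, p (x + t *: v) = q.[t].
Proof.
elim=> {j p}.
- by move=> j c; exists c%:P => t; rewrite hornerC.
- move=> j i p _ [q hq]; exists (((x 0 i)%:P + (v 0 i)%:P * 'X) * q) => t.
  by rewrite !mxE hq !hornerE mulrC [t * _]mulrC mulrC.
- by move=> j p q _ [p1 h1] _ [q1 h2]; exists (p1 + q1) => t; rewrite hornerD h1 h2.
Qed.

(** On the line from a point of [A] to [x] the polynomial becomes univariate; it vanishes near the
    start of the segment, hence identically. *)
Lemma pol_eq0 n j (p : 'rV[R]_n -> R) (A : set 'rV[R]_n) : pol j p ->
  open A -> A !=set0 -> (forall x, A x -> p x = 0) -> forall x, p x = 0.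
Proof.
move=> pp oA [x0 Ax0] pA x.
have [q hq] := pol_line x0 (x - x0) pp.
suff q0 : q = 0 by have := hq 1; rewrite scale1r addrC subrK q0 horner0.
apply/eqP/negPn/negP => qn0.
have [e e0 he] : exists2 e : R, 0 < e & forall t, 0 < t < e -> q.[t] = 0.
  have /nbhs_ballP[e /= e0 eA] := open_nbhs_nbhs (conj oA Ax0).
  have d0 : 0 < `|x - x0| + 1 by rewrite ltr_wpDl.
  exists (e / (`|x - x0| + 1)); first by rewrite divr_gt0.
  move=> t /andP[t0 te]; rewrite -hq; apply/pA/eA.
  rewrite mx_norm_ball /ball_ /= opprD addrA subrr add0r normrN normrZ gtr0_norm//.
  rewrite ltr_pdivlMr// in te; apply: le_lt_trans te.
  by rewrite ler_pM2l// lerDl.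
(* The points [e / (i + 2)] with [i < size q] are [size q] distinct roots in []0, e[], one more than
   a nonzero [q] can have. *)
have := max_poly_roots qn0.
move=> /(_ [seq e / (i.+2)%:R | i <- iota 0 (size q)]).
rewrite size_map size_iota ltnn => H; have : false; last by [].
apply: H.
  apply/allP => t /mapP[i _ ->]; apply/rootP/he; rewrite divr_gt0//=.
  by rewrite ltr_pdivrMr// ltr_pMr// ltr1n.
rewrite map_inj_in_uniq ?iota_uniq// => i k _ _ /(mulfI (lt0r_neq0 e0)) /invr_inj /eqP.
by rewrite eqr_nat => /eqP [].
Qed.

End pol.

(** * Bounded measurable integrands *)

Section bounded_measurable.
Context {R : realType}.

(** Large enough for the damping term, whose powers are not polynomial, and closed under sums and
    products; on sets of finite measure it yields integrability without further estimates. *)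
Definition bm d (T : measurableType d) (D : set T) (g : T -> R) : Prop :=
  measurable_fun D g /\ exists M, forall x, D x -> `|g x| <= M.

Context d (T : measurableType d) (D : set T).
Implicit Types g h : T -> R.

Lemma bm_ext g h : (forall x, D x -> g x = h x) -> bm D g -> bm D h.
Proof.
move=> gh [mg [M hM]]; split.
  by apply: eq_measurable_fun mg => x /set_mem; exact: gh.
by exists M => x Dx; rewrite -gh// hM.
Qed.

Lemma bm_cst c : bm D (fun=> c).
Proof. by split; [exact: measurable_cst|exists `|c|]. Qed.

Lemma bmD g h : bm D g -> bm D h -> bm D (fun x => g x + h x).
Proof.
move=> [mg [M hM]] [mh [N hN]]; split; first exact: measurable_funD.
by exists (M + N) => x Dx; rewrite (le_trans (ler_normD _ _))// lerD ?hM ?hN.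
Qed.

Lemma bmM g h : bm D g -> bm D h -> bm D (fun x => g x * h x).
Proof.
move=> [mg [M hM]] [mh [N hN]]; split; first exact: measurable_funM.
by exists (M * N) => x Dx; rewrite normrM ler_pM ?hM ?hN.
Qed.

Lemma bmZ c g : bm D g -> bm D (fun x => c * g x).
Proof. by apply: bmM; exact: bm_cst. Qed.

Lemma bmN g : bm D g -> bm D (fun x => - g x).
Proof. by move=> /(bmZ (-1)); apply: bm_ext => x _; rewrite mulN1r. Qed.

Lemma bm_sum (I : Type) (s : seq I) (P : pred I) (g : I -> T -> R) :
  (forall i, bm D (g i)) -> bm D (fun x => \sum_(i <- s | P i) g i x).
Proof.
move=> hg; elim: s => [|i s ih].
  by apply: bm_ext (bm_cst 0) => x _; rewrite big_nil.
have [Pi|Pi] := boolP (P i).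
  by apply: bm_ext (bmD (hg i) ih) => x _; rewrite big_cons Pi.
by apply: bm_ext ih => x _; rewrite big_cons (negPf Pi).
Qed.

Lemma bm_integrable (m : {measure set T -> \bar R}) g :
  measurable D -> (m D < +oo)%E -> bm D g -> m.-integrable D (EFin \o g).
Proof.
move=> mD fD [mg [M hM]]; apply: measurable_bounded_integrable => //.
exists M; split; first exact: num_real.
by move=> x /= Mx t Dt; apply: le_trans (ltW Mx); exact: hM.
Qed.

End bounded_measurable.

Lemma ler_coord_norm (R : realType) n (x : 'rV[R]_n) i : `|x 0 i| <= `|x|.
Proof.
rewrite [leRHS]mx_normrE.
exact: (le_bigmax _ (fun k : 'I_1 * 'I_n => `|x k.1 k.2|) (0, i)).
Qed.

Lemma pol_bm (R : realType) n j (p : 'rV[R]_n -> R) (D : set 'rV[R]_n) :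
  pol j p -> bounded_set D -> bm D p.
Proof.
move=> pp [M [_ bD]]; elim: pp => {j p}.
- by move=> j c; exact: bm_cst.
- move=> j i p _ ih; apply: bmM => //; split.
    exact: measurable_funTS (measurable_rV_coord i).
  exists (`|M| + 1) => x Dx.
  have hM : M < `|M| + 1 by rewrite ltr_pwDr// ler_norm.
  apply: le_trans (bD _ hM _ Dx).
  exact: ler_coord_norm.
- by move=> j p q _ ihp _ ihq; exact: bmD.
Qed.

(** * Integrals over simplices *)

Section simplex.
Context {R : realType}.
Local Notation mu := (@lebesgue_rV R).

Definition simplex_map n d (p : nat -> 'rV[R]_n) (t : 'rV[R]_d) : 'rV[R]_n :=
  p 0%N + t *m \matrix_(i < d) (p i.+1 - p 0%N).

(** Barycentric coordinates on the unit simplex, with index 0 for the vertex at the origin; they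
    make the inequalities of [unit_simplex] symmetric in the vertices. *)
Definition bweight d (t : 'rV[R]_d) (i : 'I_d.+1) : R :=
  if unlift ord0 i is Some j then t 0 j else 1 - \sum_j t 0 j.

Lemma bweight0 d (t : 'rV[R]_d) : bweight t ord0 = 1 - \sum_j t 0 j.
Proof. by rewrite /bweight unlift_none. Qed.

Lemma bweight_lift d (t : 'rV[R]_d) j : bweight t (lift ord0 j) = t 0 j.
Proof. by rewrite /bweight liftK. Qed.

Lemma sum_bweight d (t : 'rV[R]_d) : \sum_i bweight t i = 1.
Proof.
rewrite big_ord_recl bweight0.
under [X in _ + X]eq_bigr do rewrite bweight_lift.
by rewrite subrK.
Qed.

Lemma simplex_mapE n d (p : nat -> 'rV[R]_n) (t : 'rV[R]_d) :
  simplex_map p t = \sum_i bweight t i *: p i.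
Proof.
rewrite big_ord_recl bweight0; under [X in _ = _ + X]eq_bigr do rewrite bweight_lift.
rewrite /simplex_map mulmx_sum_row.
rewrite (eq_bigr (fun i => t 0 i *: p i.+1 - t 0 i *: p 0%N)); last first.
  by move=> i _; rewrite rowK scalerBr.
by rewrite sumrB -scaler_suml scalerBl scale1r addrA addrAC.
Qed.

Lemma unit_simplexE d : @unit_simplex R d = [set t | forall i, 0 <= bweight t i].
Proof.
apply/seteqP; split => t /=.
  move=> [t0 t1] i; case: (unliftP ord0 i) => [j ->|->].
    by rewrite bweight_lift.
  by rewrite bweight0 subr_ge0.
move=> h; split => [i|]; first by have := h (lift ord0 i); rewrite bweight_lift.
by have := h ord0; rewrite bweight0 subr_ge0.
Qed.

Lemma pol_bweight d (i : 'I_d.+1) : pol 1 (fun t : 'rV[R]_d => bweight t i).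
Proof.
case: (unliftP ord0 i) => [j ->|->].
  by apply: pol_ext (pol_coord j) => t; rewrite bweight_lift.
apply: (@pol_ext _ _ _ (fun t : 'rV[R]_d => 1 - \sum_j t 0 j)).
  by move=> t; rewrite bweight0.
apply: polB; first exact: pol_cst.
by apply: pol_sum => j _; exact: pol_coord.
Qed.

Lemma pol_closed_ge0 n j (p : 'rV[R]_n -> R) : pol j p -> closed [set x | 0 <= p x].
Proof.
move=> pp; have h := @closed_comp _ _ p [set y | 0 <= y].
by apply: h => [x _|]; [exact: pol_continuous pp x|exact: closed_ge].
Qed.

Lemma closed_unit_simplex d : closed (@unit_simplex R d).
Proof.
rewrite unit_simplexE.
have -> : [set t : 'rV[R]_d | forall i, 0 <= bweight t i] =
   \bigcap_(i in [set: 'I_d.+1]) [set t | 0 <= bweight t i].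
  by apply/seteqP; split => t /= h i; [move=> _|]; exact: h.
apply: closed_bigI => i _; exact: pol_closed_ge0 (pol_bweight i).
Qed.

Lemma measurable_unit_simplex d : measurable (@unit_simplex R d).
Proof. by apply: closed_measurable_rV; exact: closed_unit_simplex. Qed.

Lemma unit_simplex_coord_le1 d (t : 'rV[R]_d) i : unit_simplex t -> 0 <= t 0 i <= 1.
Proof.
move=> [t0 t1]; rewrite t0/=; apply: le_trans t1.
by rewrite (bigD1 i)//= lerDl sumr_ge0.
Qed.

Lemma bounded_unit_simplex d : bounded_set (@unit_simplex R d).
Proof.
exists 1; split; first exact: num_real.
move=> M hM t /= ht; apply: le_trans (ltW hM).
rewrite [leLHS]mx_normrE; apply/bigmax_leP; split => //= -[i j] _ /=.
rewrite ord1; have /andP[h0 h1] := unit_simplex_coord_le1 j ht.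
by rewrite ger0_norm.
Qed.

Lemma lebesgue_unit_simplex_lty d : (mu d (@unit_simplex R d) < +oo)%E.
Proof.
apply: bounded_lebesgue_rV; [exact: measurable_unit_simplex|exact: bounded_unit_simplex].
Qed.

Lemma integrable_unit_simplex d (g : 'rV[R]_d -> R) : bm (@unit_simplex R d) g ->
  (mu d).-integrable (@unit_simplex R d) (EFin \o g).
Proof.
apply: bm_integrable; [exact: measurable_unit_simplex|exact: lebesgue_unit_simplex_lty].
Qed.

Lemma unit_simplex_interior d : exists (c : 'rV[R]_d) e,
  0 < e /\ ball c e `<=` @unit_simplex R d.
Proof.
have d0 : 0 < d.+1%:R :> R by [].
(* Since [2 e (d + 1) = 1] and [u (d + 1) = e], the cube of radius [u] about the point with all
   coordinates [2 e] keeps the coordinates above [e] and their sum at most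
   [d (2 e + u) = 1 - e - u]. *)
have [e e0 eE] : exists2 e : R, 0 < e & 2 * e * d.+1%:R = 1.
  exists (2 * d.+1%:R)^-1; first by rewrite invr_gt0 mulr_gt0.
  by field; rewrite gt_eqF.
have [u u0 uE] : exists2 u : R, 0 < u & u * d.+1%:R = e.
  by exists (e / d.+1%:R); rewrite ?divr_gt0// divfK// gt_eqF.
have ue : u <= e by rewrite -uE ler_peMr ?ler1n// ltW.
exists (const_mx (2 * e)), u; split=> // t; rewrite ball_rVE// => h; split => [i|].
  by have := h i; rewrite mxE ltr_norml => /andP[]; lra.
apply: (@le_trans _ _ (\sum_(i < d) (2 * e + u))).
  by apply: ler_sum => i _; have := h i; rewrite mxE ltr_norml => /andP[]; lra.
rewrite sumr_const card_ord -mulr_natl.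
move: eE uE d0; rewrite -natr1; have : 0 <= d%:R :> R by rewrite ler0n.
by move: (d%:R : R) => x; nra.
Qed.

Lemma ball_Rintegral1_gt0 d (A : set 'rV[R]_d) c e :
  measurable A -> (mu d A < +oo)%E -> 0 < e -> ball c e `<=` A ->
  0 < \int[mu d]_(t in A) (1 : R).
Proof.
move=> mA fA e0 cA; rewrite Rintegral_cst// mul1r fine_gt0// fA andbT.
apply: (@lt_le_trans _ _ (mu d (ball c e))); last first.
  by apply: le_measure; rewrite ?inE//; exact: measurable_ball_rV.
by rewrite lebesgue_rV_ball// lte_fin exprn_gt0// mulrn_wgt0.
Qed.

Lemma unit_simplex_vol_gt0 d : 0 < \int[mu d]_(t in @unit_simplex R d) (1 : R).
Proof.
have [c [e [e0 he]]] := unit_simplex_interior d.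
apply: ball_Rintegral1_gt0 e0 he; last exact: lebesgue_unit_simplex_lty.
exact: measurable_unit_simplex.
Qed.

Definition rint n d (p : nat -> 'rV[R]_n) (g : 'rV[R]_n -> R) : R :=
  \int[mu d]_(t in @unit_simplex R d) g (simplex_map p t).

Section perm.
Variable d : nat.

Definition refvert (i : nat) : 'rV[R]_d := if i is j.+1 then
  (if insub j is Some k then delta_mx 0 k else 0) else 0.

Lemma refvert_lift (i : 'I_d) : refvert (lift ord0 i) = delta_mx 0 i.
Proof. by rewrite /refvert lift0 valK. Qed.

Lemma bweight_refvert (i j : 'I_d.+1) : bweight (refvert i) j = (i == j)%:R.
Proof.
case: (unliftP ord0 i) => [i' ->|->]; case: (unliftP ord0 j) => [j' ->|->].
- by rewrite bweight_lift refvert_lift mxE eqxx/= (inj_eq lift_inj) eq_sym.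
- rewrite bweight0 refvert_lift (bigD1 i')//= big1 => [|k /negPf ki]; rewrite mxE eqxx/=.
    by rewrite eqxx addr0 subrr.
  by rewrite ki.
- by rewrite bweight_lift mxE.
- by rewrite bweight0 big1 ?subr0 ?eqxx// => k _; rewrite mxE.
Qed.

Lemma bweight_comb (w : 'I_d.+1 -> R) (q : 'I_d.+1 -> 'rV[R]_d) j :
  \sum_i w i = 1 -> bweight (\sum_i w i *: q i) j = \sum_i w i * bweight (q i) j.
Proof.
move=> w1; case: (unliftP ord0 j) => [k ->|->].
  rewrite bweight_lift summxE; apply: eq_bigr => i _.
  by rewrite bweight_lift mxE.
rewrite bweight0; under [in RHS]eq_bigr do rewrite bweight0 mulrBr mulr1.
rewrite sumrB w1; congr (_ - _).
under eq_bigr do rewrite summxE.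
rewrite exchange_big/=; apply: eq_bigr => i _; rewrite mulr_sumr.
by apply: eq_bigr => k _; rewrite mxE.
Qed.

Variable s : {perm 'I_d.+1}.

Definition permvert (s : {perm 'I_d.+1}) (i : nat) : 'rV[R]_d := refvert (s (inord i)).

Lemma bweight_perm (s' : {perm 'I_d.+1}) t j :
  bweight (simplex_map (permvert s') t) j = bweight t ((s'^-1)%g j).
Proof.
rewrite simplex_mapE bweight_comb ?sum_bweight// (bigD1 ((s'^-1)%g j))//= big1.
  by rewrite /permvert inord_val permKV bweight_refvert eqxx mulr1 addr0.
move=> i /negPf ij; rewrite /permvert inord_val bweight_refvert.
by rewrite (can2_eq (permK s') (permKV s')) ij mulr0.
Qed.

Lemma bweight_inj (t t' : 'rV[R]_d) : (forall i, bweight t i = bweight t' i) -> t = t'.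
Proof. by move=> h; apply/rowP => i; have := h (lift ord0 i); rewrite !bweight_lift. Qed.

(** Reordering the vertices amounts to precomposing with the affine map of the unit simplex that
    permutes its own vertices. *)
Lemma rint_perm n (p p' : nat -> 'rV[R]_n) g :
  (forall i : 'I_d.+1, p' i = p (s i)) ->
  bm (@unit_simplex R d) (g \o simplex_map p) ->
  rint d p' g = rint d p g.
Proof.
move=> pE bg.
pose b := permvert s 0; pose M := \matrix_(i < d) (permvert s i.+1 - permvert s 0).
pose b' := permvert (s^-1)%g 0.
pose M' := \matrix_(i < d) (permvert (s^-1)%g i.+1 - permvert (s^-1)%g 0).
have SK t : b + (b' + t *m M') *m M = t.
  apply: bweight_inj => i.
  by rewrite (bweight_perm s (simplex_map (permvert (s^-1)%g) t)) bweight_perm invgK permKV.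
have uM : M \in unitmx.
  suff : M' *m M = 1%:M by move=> /mulmx1_unit[].
  have b0 := SK 0; rewrite mul0mx addr0 in b0.
  apply/row_matrixP => i; rewrite row1 -[RHS]SK mulmxDl addrA b0 add0r.
  by rewrite rowE mulmxA.
have SD : (fun t => b + t *m M) @^-1` @unit_simplex R d = @unit_simplex R d.
  rewrite unit_simplexE; apply/seteqP; split => t /= h i.
    by have := h (s i); rewrite (bweight_perm s t) permK.
  by rewrite (bweight_perm s t).
have mU : measurable (@unit_simplex R d) by exact: measurable_unit_simplex.
(* The determinant is not computed: the map preserves the unit simplex, whose volume is finite and
   positive, so integrating the constant 1 forces its absolute value to be 1. *)
have [_] := Rintegral_affine b uM mU (integrable_unit_simplex (bm_cst _ 1)).
rewrite SD; have /lt0r_neq0 vol0 := unit_simplex_vol_gt0 d.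
rewrite -[RHS]mul1r => /(mulIf vol0) detM.
have [_] := Rintegral_affine b uM mU (integrable_unit_simplex bg).
rewrite SD detM mul1r /rint => <-; apply: eq_Rintegral => t _ /=; congr g.
rewrite !simplex_mapE [RHS](reindex_perm s)/=; apply: eq_bigr => i _.
by rewrite pE (bweight_perm s t) permK.
Qed.

End perm.

End simplex.

(** * The fundamental theorem of calculus on a simplex *)

Section simplex_ftc.
Context {R : realType}.
Local Notation mu := (@lebesgue_rV R).
Local Notation lam := (@lebesgue_measure R).

Lemma derive_along n (p : 'rV[R]_n -> R) (q : R -> R) x v (t : R) :
  (forall s, p (x + s *: v) = q s) -> 'D_v p (x + t *: v) = 'D_1 q t.
Proof.
move=> h; rewrite /derive.
set f1 := (X in lim (X @ _) = _); set f2 := (X in _ = lim (X @ _)).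
suff -> : f1 = f2 by [].
apply/funext => s; rewrite /f1 /f2 /= -!h /shift /=.
by rewrite [s *: 1]mulr1 scalerDl addrCA.
Qed.

Lemma integral_deriv_poly (q : {poly R}) (b : R) : 0 <= b ->
  (\int[lam]_(x in `[0%R, b]) (q^`().[x])%:E = (q.[b] - q.[0])%:E)%E.
Proof.
rewrite le_eqVlt => /predU1P[<-|b0].
  by rewrite set_itv1 integral_set1 subrr.
rewrite (@continuous_FTC2 _ (horner q^`()) (horner q))//.
- by apply: continuous_subspaceT => x; exact: continuous_horner.
- split => //=.
  + by apply: cvg_at_right_filter; exact: continuous_horner.
  + by apply: cvg_at_left_filter; exact: continuous_horner.
- by move=> x _; rewrite -derivE.
Qed.

Lemma consrV_head d (p : measurableTypeR R * 'rV[R]_d) : consrV p 0 ord0 = p.1.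
Proof. by rewrite /consrV mxE; case: splitP => // j _; rewrite mxE. Qed.

Lemma consrV_tail d (p : measurableTypeR R * 'rV[R]_d) i :
  consrV p 0 (lift ord0 i) = p.2 0 i.
Proof.
have -> : lift ord0 i = @rshift 1 d i by exact: val_inj.
exact: (@row_mxEr _ 1 1 d).
Qed.

Lemma sum_consrV d (x : R) (t : 'rV[R]_d) :
  \sum_i consrV (x, t) 0 i = x + \sum_i t 0 i.
Proof.
rewrite big_ord_recl consrV_head; congr (_ + _).
by apply: eq_bigr => i _; exact: consrV_tail.
Qed.

Lemma simplex_section d (t : 'rV[R]_d) (x : R) :
  unit_simplex (consrV (x, t)) <-> unit_simplex t /\ 0 <= x <= 1 - \sum_i t 0 i.
Proof.
have /= e0 := consrV_head (x, t); have /= eS := consrV_tail (x, t).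
have sE := sum_consrV x t.
split=> [[h0]|[[t0 t1] /andP[x0 x1]]].
  rewrite sE => h1.
  have x0 : 0 <= x by have := h0 ord0; rewrite e0.
  split; last by rewrite x0/=; lra.
  split=> [i|]; last by lra.
  by have := h0 (lift ord0 i); rewrite eS.
split=> [i|].
  by case: (unliftP ord0 i) => [j ->|->]; rewrite ?eS ?e0.
by rewrite sE; lra.
Qed.

Lemma consrV_add d (x : R) (t : 'rV[R]_d) :
  consrV (x, t) = consrV (0 : R, t) + x *: delta_mx 0 ord0.
Proof.
apply/rowP => i; rewrite [RHS]mxE [X in _ + X]mxE [X in _ + _ * X]mxE eqxx /=; case: (unliftP ord0 i) => [k ->|->].
  by rewrite !consrV_tail/= mulr0 addr0.
by rewrite !consrV_head/= mulr1 add0r.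
Qed.

(** Fubini with the first coordinate innermost: its section over [t] is the interval from 0 to
    [1 - \sum_i t 0 i], on which the derivative integrates to a difference of end values. *)
Lemma unit_simplex_ftc d j (h : 'rV[R]_d.+1 -> R) : pol j h ->
  \int[mu d.+1]_(z in @unit_simplex R d.+1) 'D_(delta_mx 0 ord0) h z =
  \int[mu d]_(t in @unit_simplex R d)
     (h (consrV (1 - \sum_i t 0 i, t)) - h (consrV (0 : R, t))).
Proof.
move=> ph; set H := 'D_(delta_mx 0 ord0) h.
have pH : pol j.-1 H by exact: pol_derive_pol.
have mD := measurable_unit_simplex.
have iH : (mu d.+1).-integrable (@unit_simplex R d.+1) (EFin \o H).
  apply: integrable_unit_simplex; apply: pol_bm pH _; exact: bounded_unit_simplex.
have mH : measurable_fun setT (EFin \o H).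
  by apply/measurable_EFinP; exact: pol_measurable pH.
have mC := @measurable_consrV R d.
rewrite /Rintegral; congr fine.
pose pm : {measure set _ -> \bar R} :=
  product_measure1 lam (mu d).
pose D' := @consrV R d @^-1` @unit_simplex R d.+1.
have mD' := measurable_consrV_preimage (@measurable_unit_simplex R d.+1).
rewrite -/D' in mD'.
have bHc : bm D' (H \o @consrV R d).
  have [_ [M hM]] := pol_bm pH (@bounded_unit_simplex R d.+1).
  split; last by exists M => z hz; exact: hM.
  by apply: measurable_funTS; apply: measurableT_comp => //; exact/measurable_EFinP.
have fD' : (pm D' < +oo)%E by exact: (lebesgue_unit_simplex_lty d.+1).
have iHc := bm_integrable (m := pm) mD' fD' bHc.
transitivity (\int[pm]_(p in D') (EFin \o H \o @consrV R d) p)%E.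
  rewrite -(integral_pushforward mC mH iHc)//.
  exact: measurable_unit_simplex.
have iHc' : pm.-integrable setT (((EFin \o H) \o @consrV R d) \_ D').
  by apply/(integrable_mkcond _ mD').
rewrite [LHS]integral_mkcond.
apply: (eq_trans (esym (@integral21_prod_meas1 _ _ _ _ R lam (mu d) _ iHc'))).
rewrite [RHS]integral_mkcond; apply: eq_integral => t _.
rewrite /patch; case: ifPn => [/set_mem|/negP] ht; last first.
  apply: integral0_eq => x _ /=; case: ifPn => // /set_mem.
  by rewrite /D' /= => /simplex_section[h1 _]; exfalso; apply: ht; exact/mem_set.
have [q hq] := pol_line (consrV (0 : R, t)) (delta_mx 0 ord0) ph.
have hq' x : h (consrV (x, t)) = q.[x] by rewrite consrV_add hq.
rewrite !hq' -integral_deriv_poly; last by case: ht => _; rewrite subr_ge0.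
rewrite [RHS]integral_mkcond; apply: eq_integral => x _; rewrite /patch.
have -> : ((x, t) \in D') = (x \in `[0, 1 - \sum_i t 0 i]%classic).
  apply/idP/idP => /set_mem hx; apply/mem_set.
    by case/simplex_section : hx => _; rewrite /= in_itv.
  by apply/simplex_section; split => //; move: hx; rewrite /= in_itv.
case: ifP => // _ /=; rewrite /H consrV_add (derive_along _ hq).
by rewrite derive_val.
Qed.

(** The direction [p 1 - p 0] is the image of the first basis vector; the upper and lower ends of
    the sections sweep the faces opposite to [p 0] and to [p 1]. All integrals are over reference
    simplices, so no determinant occurs. *)
Theorem simplex_divergence n d j (p : nat -> 'rV[R]_n) (g : 'rV[R]_n -> R) : pol j g ->
  rint d.+1 p ('D_(p 1%N - p 0%N) g) =
  rint d (fun i => p i.+1) g - rint d (fun i => if i is 0 then p 0%N else p i.+1) g.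
Proof.
move=> pg; pose h := g \o @simplex_map R n d.+1 p.
have ph : pol j h by exact: pol_comp_affine.
have -> : rint d.+1 p ('D_(p 1%N - p 0%N) g) =
  \int[mu d.+1]_(z in @unit_simplex R d.+1) 'D_(delta_mx 0 ord0) h z.
  apply: eq_Rintegral => z _.
  have [q hq] := pol_line z (delta_mx 0 ord0) ph.
  have hg s : g (simplex_map p z + s *: (p 1%N - p 0%N)) = q.[s].
    rewrite -hq /h /=; congr g; rewrite /simplex_map mulmxDl addrA; congr (_ + _).
    by rewrite -scalemxAl -rowE rowK.
  have := derive_along 0 hq; have := derive_along 0 hg.
  by rewrite !scale0r !addr0 => -> ->.
have e1 (t : 'rV[R]_d) : simplex_map p (consrV (1 - \sum_i t 0 i, t)) =
   simplex_map (fun i => p i.+1) t.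
  rewrite [RHS]simplex_mapE simplex_mapE big_ord_recl bweight0.
  rewrite sum_consrV subrK subrr scale0r add0r; apply: eq_bigr => i _.
  rewrite bweight_lift lift0; congr (_ *: _); case: (unliftP ord0 i) => [k ->|->].
    by rewrite consrV_tail bweight_lift.
  by rewrite consrV_head bweight0.
have e2 (t : 'rV[R]_d) : simplex_map p (consrV (0 : R, t)) =
   simplex_map (fun i => if i is 0 then p 0%N else p i.+1) t.
  rewrite [RHS]simplex_mapE simplex_mapE !big_ord_recl !bweight0 !bweight_lift.
  rewrite sum_consrV add0r consrV_head/= scale0r add0r; congr (_ + _).
  apply: eq_bigr => i _.
  by rewrite !bweight_lift consrV_tail.
rewrite (unit_simplex_ftc ph) /rint -RintegralB; last 3 first.
- exact: measurable_unit_simplex.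
- apply: integrable_unit_simplex; apply: pol_bm; first exact: pol_comp_affine pg.
  exact: bounded_unit_simplex.
- apply: integrable_unit_simplex; apply: pol_bm; first exact: pol_comp_affine pg.
  exact: bounded_unit_simplex.
by apply: eq_Rintegral => t _; rewrite /h /= e1 e2.
Qed.

End simplex_ftc.

(** * Barycentric coordinates, faces and the divergence formula *)

Section dotv.
Context {R : realType} {n : nat}.
Implicit Types x y z : 'rV[R]_n.

Lemma dotvE x y : dotv x y = (x *m y^T) 0 0.
Proof. by rewrite mxE; apply: eq_bigr => i _; rewrite mxE. Qed.

Lemma dotvC x y : dotv x y = dotv y x.
Proof. by apply: eq_bigr => i _; rewrite mulrC. Qed.

Lemma dotvDl x y z : dotv (x + y) z = dotv x z + dotv y z.
Proof. by rewrite !dotvE mulmxDl mxE. Qed.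

Lemma dotvZl a x z : dotv (a *: x) z = a * dotv x z.
Proof. by rewrite !dotvE -scalemxAl mxE. Qed.

Lemma dotvNl x z : dotv (- x) z = - dotv x z.
Proof. by rewrite !dotvE mulNmx mxE. Qed.

Lemma dotvBl x y z : dotv (x - y) z = dotv x z - dotv y z.
Proof. by rewrite dotvDl dotvNl. Qed.

Lemma dotvDr x y z : dotv z (x + y) = dotv z x + dotv z y.
Proof. by rewrite dotvC dotvDl !(dotvC z). Qed.

Lemma dotvZr a x z : dotv z (a *: x) = a * dotv z x.
Proof. by rewrite dotvC dotvZl dotvC. Qed.

Lemma dotvNr x z : dotv z (- x) = - dotv z x.
Proof. by rewrite dotvC dotvNl dotvC. Qed.

Lemma dotvBr x y z : dotv z (x - y) = dotv z x - dotv z y.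
Proof. by rewrite dotvDr dotvNr. Qed.

Lemma dotv0l x : dotv 0 x = 0.
Proof. by rewrite dotvE mul0mx mxE. Qed.

Lemma dotv_suml (I : Type) (s : seq I) (P : pred I) (f : I -> 'rV[R]_n) z :
  dotv (\sum_(i <- s | P i) f i) z = \sum_(i <- s | P i) dotv (f i) z.
Proof. by apply: (big_morph (dotv^~ z)) => [x y|]; rewrite ?dotvDl ?dotv0l. Qed.

Lemma dotv_ge0 x : 0 <= dotv x x.
Proof. by apply: sumr_ge0 => i _; rewrite -expr2 sqr_ge0. Qed.

Lemma dotv_eq0 x : dotv x x = 0 -> x = 0.
Proof.
move=> h; apply/rowP => i; rewrite mxE; apply/eqP; rewrite -sqrf_eq0 expr2.
have h0 k : true -> 0 <= x 0 k * x 0 k by rewrite -expr2 sqr_ge0.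
by rewrite (psumr_eq0P h0 h).
Qed.

Lemma enorm1 x : enorm x = 1 <-> dotv x x = 1.
Proof.
rewrite /enorm; split=> [h|->]; last exact: sqrtr1.
by rewrite -(sqr_sqrtr (dotv_ge0 x)) h expr1n.
Qed.

End dotv.

Section height.
Context {R : realType} {d : nat}.

(** Volume is height times base. If [B] has first row [nu] instead of [w], then [A *m B^T] is block
    triangular and [B *m B^T] block diagonal; the two determinants compare [A] with the Gram matrix
    of [F]. *)
Lemma det_height (w nu : 'rV[R]_d.+1) (F : 'M[R]_(d, d.+1)) :
  dotv nu nu = 1 -> (forall i, dotv (row i F) nu = 0) ->
  (col_mx w F : 'M[R]_(1 + d)) \in unitmx ->
  0 < Num.sqrt (\det (F *m F^T)) /\
  `|\det (col_mx w F : 'M[R]_(1 + d))| = `|dotv w nu| * Num.sqrt (\det (F *m F^T)).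
Proof.
move=> nu1 Fnu uA; set A : 'M[R]_(1 + d) := col_mx w F in uA *.
pose B : 'M[R]_(1 + d) := col_mx nu F.
have FnuT : F *m nu^T = 0.
  apply/colP => i; rewrite [RHS]mxE -[RHS](Fnu i) dotvE -row_mul.
  by rewrite [RHS]mxE.
have nuF : nu *m F^T = 0 by rewrite -[LHS]trmxK trmx_mul trmxK FnuT trmx0.
have e1 : \det A * \det B = dotv w nu * \det (F *m F^T).
  rewrite -(det_tr B) -det_mulmx tr_col_mx mul_col_row FnuT (@det_ublock _ 1 d).
  by rewrite [X in X * _]det_mx11 dotvE.
have e2 : \det B ^+ 2 = \det (F *m F^T).
  rewrite expr2 -{2}(det_tr B) -det_mulmx tr_col_mx mul_col_row FnuT nuF.
  by rewrite (@det_ublock _ 1 d) [X in X * _]det_mx11 -dotvE nu1 mul1r.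
(* The rows of [A] span, so [nu = s w + y F]; pairing with [nu] gives [s != 0], which makes [B]
   invertible. *)
have [s [y nuE]] : exists s y, nu = s *: w + y *m F.
  pose c : 'rV[R]_(1 + d) := nu *m invmx A.
  exists (lsubmx c 0 0), (rsubmx c).
  have : nu = c *m A by rewrite mulmxKV.
  rewrite -[c in c *m _]hsubmxK mul_row_col => ->; congr (_ + _).
  by rewrite [lsubmx c in LHS]mx11_scalar mul_scalar_mx.
have sw : s * dotv w nu = 1.
  rewrite -dotvZl -nu1 {2}nuE dotvDl [X in _ + X]dotvE -mulmxA FnuT mulmx0 mxE addr0.
  by [].
have Bu : \det B != 0.
  have -> : B = (block_mx s%:M y 0 1%:M : 'M[R]_(1 + d)) *m A.
    rewrite /A (@mul_block_col _ 1 d 1 d) mul_scalar_mx mul0mx mul1mx add0r.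
    by rewrite -nuE.
  rewrite det_mulmx mulf_neq0//; last by rewrite -unitfE -unitmxE.
  rewrite (@det_ublock _ 1 d) det1 mulr1 det_mx11 mxE mulr1n.
  by apply: contra_eq_neq sw => ->; rewrite mul0r eq_sym oner_neq0.
have B0 : 0 < `|\det B| by rewrite normr_gt0.
rewrite -e2 sqrtr_sqr; split=> //; apply: (mulIf (lt0r_neq0 B0)).
by rewrite -normrM e1 normrM -e2 normrX expr2 mulrA.
Qed.

End height.

Section points.
Context {R : realType} {n : nat} {T : mesh R n}.
Local Notation V := 'I_(nvert T).
Implicit Types (s : seq V) (K : {set V}).

Definition points s (i : nat) : 'rV[R]_n := nth 0 [seq vert v | v <- s] i.

Lemma points_nth v0 s i : (i < size s)%N -> points s i = vert (nth v0 s i).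
Proof. by move=> h; rewrite /points (nth_map v0). Qed.

Lemma sum_points d v0 s (w : V -> R) : size s = d.+1 ->
  \sum_(v <- s) w v *: vert v = \sum_(i < d.+1) w (nth v0 s i) *: points s i.
Proof.
move=> sz; rewrite (big_nth v0) sz big_mkord; apply: eq_bigr => i _.
by rewrite (points_nth v0)// sz.
Qed.

Lemma sum_seq_nth d v0 s (w : V -> R) : size s = d.+1 ->
  \sum_(v <- s) w v = \sum_(i < d.+1) w (nth v0 s i).
Proof. by move=> sz; rewrite (big_nth v0) sz big_mkord. Qed.

Lemma sum_index d v0 s (c : 'I_d.+1 -> R) (W : lmodType R) (f : V -> W) : size s = d.+1 -> uniq s ->
  \sum_(v <- s) c (inord (index v s)) *: f v = \sum_(i < d.+1) c i *: f (nth v0 s i).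
Proof.
move=> sz us; rewrite (big_nth v0) sz big_mkord; apply: eq_bigr => i _.
by rewrite index_uniq ?sz// inord_val.
Qed.

Lemma sum_seq_set K s (W : nmodType) (f : V -> W) : uniq s -> s =i K ->
  \sum_(v <- s) f v = \sum_(v in K) f v.
Proof.
move=> us sK; rewrite -[RHS]big_enum; apply: perm_big.
by apply: uniq_perm; rewrite ?enum_uniq// => v; rewrite mem_enum sK.
Qed.

Lemma rint_perm_eq d s s' (g : 'rV[R]_n -> R) j : size s = d.+1 -> perm_eq s' s -> pol j g ->
  rint d (points s') g = rint d (points s) g.
Proof.
move=> sz /[dup] /perm_size sz' ps pg.
pose t : d.+1.-tuple V := tcast sz (in_tuple s).
have tE : t = s :> seq V by rewrite /t val_tcast.
move: ps; rewrite -tE => /tuple_permP[p s'E].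
have v0 : V by case: s sz {sz' t tE s'E}.
apply: (@rint_perm _ _ p).
  move=> i; rewrite (points_nth v0) ?sz' ?sz// (points_nth v0) ?tE ?sz//.
  rewrite s'E -tnth_nth.
  by rewrite (tnth_nth v0) /= (nth_map i) ?size_enum_ord// nth_ord_enum (tnth_nth v0) tE.
by apply: pol_bm; [exact: pol_comp_affine pg|exact: bounded_unit_simplex].
Qed.

End points.

Section barycentric.
Context {R : realType} {n : nat} {T : mesh R n}.
Local Notation V := 'I_(nvert T).
Local Notation mu := (@lebesgue_rV R).
Implicit Types (s : seq V) (K : {set V}).

Definition emat s : 'M[R]_n := \matrix_(i < n) (points s i.+1 - points s 0).

Definition nondegenerate K := #|K| = n.+1 /\ affinely_independent K.

(** Computed from one arbitrary enumeration of [K], but defined and polynomial on the whole space;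
    [bary_unique] frees it from the chosen order. *)
Definition bary K (v : V) (z : 'rV[R]_n) : R :=
  bweight ((z - points (enum K) 0) *m invmx (emat (enum K))) (inord (index v (enum K))).

Lemma affine_weights_unique K (w w' : V -> R) : affinely_independent K ->
  \sum_(v in K) w v = \sum_(v in K) w' v ->
  \sum_(v in K) w v *: vert v = \sum_(v in K) w' v *: vert v ->
  forall v, v \in K -> w v = w' v.
Proof.
move=> aK h1 h2 v vK; apply/eqP; rewrite -subr_eq0; apply/eqP.
apply: (aK (fun v => w v - w' v)) => //; first by rewrite sumrB h1 subrr.
by under eq_bigr do rewrite scalerBl; rewrite sumrB h2 subrr.
Qed.

Section cell.
Variable K : {set V}.
Hypothesis hK : nondegenerate K.

Section ordering.
Variable s : seq V.
Hypotheses (us : uniq s) (sK : s =i K).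

Lemma size_ordering : size s = n.+1.
Proof. by rewrite -(card_uniqP us) -(proj1 hK); apply: eq_card. Qed.

Lemma ordering_nth v0 (i : 'I_n.+1) : nth v0 s i \in K.
Proof. by rewrite -sK mem_nth// size_ordering. Qed.

Lemma simplex_map_weights (t : 'rV[R]_n) :
  simplex_map (points s) t = \sum_(v in K) bweight t (inord (index v s)) *: vert v.
Proof.
have v0 : V by case: s size_ordering.
rewrite simplex_mapE -(sum_seq_set _ us sK) (sum_index (d := n) v0)//; last exact: size_ordering.
by apply: eq_bigr => i _; rewrite (points_nth v0)// size_ordering.
Qed.

Lemma sum_weights (t : 'rV[R]_n) : \sum_(v in K) bweight t (inord (index v s)) = 1.
Proof.
have v0 : V by case: s size_ordering.
rewrite -(sum_seq_set _ us sK) (sum_seq_nth v0 _ size_ordering) -[RHS](sum_bweight t).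
by apply: eq_bigr => i _; rewrite index_uniq ?size_ordering// inord_val.
Qed.

Lemma simplex_map_inj : injective (@simplex_map R n n (points s)).
Proof.
have v0 : V by case: s size_ordering.
move=> t t' h; apply: bweight_inj => i.
have := @affine_weights_unique K (fun v => bweight t (inord (index v s)))
   (fun v => bweight t' (inord (index v s))) (proj2 hK).
rewrite !sum_weights -!simplex_map_weights => /(_ erefl h _ (ordering_nth v0 i)).
by rewrite index_uniq ?size_ordering// inord_val.
Qed.

(** A row killed by [emat s] would have the same image as 0 under the injective parametrization of
    the simplex. *)
Lemma emat_unit : emat s \in unitmx.
Proof.
rewrite -row_free_unit -kermx_eq0; apply/eqP/row_matrixP => i; rewrite row0.
apply: simplex_map_inj; rewrite /simplex_map -/(emat s) -row_mul mulmx_ker row0 mul0mx.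
by [].
Qed.

End ordering.

Let uE := enum_uniq K.
Let mE v : (v \in enum K) = (v \in K). Proof. exact: mem_enum. Qed.

Lemma bary_sum z : \sum_(v in K) bary K v z = 1.
Proof. exact: sum_weights. Qed.

Lemma bary_comb z : \sum_(v in K) bary K v z *: vert v = z.
Proof.
rewrite -simplex_map_weights// /simplex_map -/(emat _) mulmxKV ?emat_unit//.
by rewrite addrC subrK.
Qed.

Lemma bary_unique z (w : V -> R) : \sum_(v in K) w v = 1 ->
  \sum_(v in K) w v *: vert v = z -> forall v, v \in K -> bary K v z = w v.
Proof.
move=> h1 h2; apply: affine_weights_unique (proj2 hK) _ _.
  by rewrite bary_sum h1.
by rewrite bary_comb h2.
Qed.

Lemma bary_vert v w : v \in K -> w \in K -> bary K v (vert w) = (v == w)%:R.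
Proof.
move=> vK wK; apply: (@bary_unique _ (fun v => (v == w)%:R)) => //.
  by rewrite (bigD1 w)//= eqxx big1 ?addr0// => u /andP[_ /negPf ->].
by rewrite (bigD1 w)//= eqxx scale1r big1 ?addr0// => u /andP[_ /negPf ->]; rewrite scale0r.
Qed.

Lemma hullE : hull K = [set z | forall v, v \in K -> 0 <= bary K v z].
Proof.
apply/seteqP; split => z /=.
  by move=> [w [w0 w1 ->]] v vK; rewrite (@bary_unique _ w)// w0.
by move=> h; exists (bary K ^~ z); split; rewrite ?bary_sum ?bary_comb.
Qed.

(** Uniqueness of barycentric coordinates: weights on [s] extended by zero are the coordinates with
    respect to [K]. *)
Lemma hull_subE (s : {set V}) : s \subset K ->
  hull s = [set z | hull K z /\ forall v, v \in K :\: s -> bary K v z = 0].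
Proof.
move=> sK; have sumE (W : nmodType) (f : V -> W) : (forall v, v \notin s -> f v = 0) ->
    \sum_(v in s) f v = \sum_(v in K) f v.
  move=> f0; rewrite [RHS](big_setID s)/= (finset.setIidPr sK) [X in _ + X]big1 ?addr0//.
  by move=> v; rewrite inE => /andP[vs _]; exact: f0.
apply/seteqP; split => z /=.
  move=> [w [w0 w1 ->]].
  pose w' v := if v \in s then w v else 0.
  have h1 : \sum_(v in K) w' v = 1.
    rewrite -w1 -sumE; last by rewrite /w' => v /negPf ->.
    by apply: eq_bigr => v vs; rewrite /w' vs.
  have h2 : \sum_(v in K) w' v *: vert v = \sum_(v in s) w v *: vert v.
    rewrite -sumE; last by rewrite /w' => v /negPf ->; rewrite scale0r.
    by apply: eq_bigr => v vs; rewrite /w' vs.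
  split; first by rewrite hullE => v vK; rewrite (bary_unique h1 h2)// /w'; case: ifPn => //; exact: w0.
  move=> v; rewrite inE => /andP[vs vK].
  by rewrite (bary_unique h1 h2)// /w' (negPf vs).
move=> []; rewrite hullE => h0 h1; exists (bary K ^~ z); split.
- by move=> v /(fintype.subsetP sK); exact: h0.
- rewrite -[RHS](bary_sum z) [RHS](big_setID s)/= (finset.setIidPr sK) [X in _ = _ + X]big1 ?addr0//.
- rewrite -[LHS](bary_comb z) [LHS](big_setID s)/= (finset.setIidPr sK) [X in _ + X]big1 ?addr0//.
  by move=> v /h1 ->; rewrite scale0r.
Qed.

Lemma pol_bary v : pol 1 (bary K v).
Proof.
have := pol_comp_affine (- points (enum K) 0 *m invmx (emat (enum K)))
   (invmx (emat (enum K))) (pol_bweight (inord (index v (enum K)))).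
by apply: pol_ext => z; rewrite /bary mulmxBl mulNmx addrC.
Qed.

(** The gradient of a barycentric coordinate: the function is affine, so its differences along the
    basis vectors are exact, as [baryE] confirms. *)
Definition bgrad v : 'rV[R]_n := \row_i (bary K v (ebasis i) - bary K v 0).

Lemma bary_affine_comb (I : finType) (c : I -> R) (x : I -> 'rV[R]_n) v : v \in K ->
  \sum_i c i = 1 -> bary K v (\sum_i c i *: x i) = \sum_i c i * bary K v (x i).
Proof.
move=> vK c1.
apply: (@bary_unique _ (fun v => \sum_i c i * bary K v (x i))) => //.
  rewrite exchange_big/= -[RHS]c1; apply: eq_bigr => i _.
  by rewrite -mulr_sumr bary_sum mulr1.
under eq_bigr do rewrite scaler_suml.
rewrite exchange_big/=; apply: eq_bigr => i _.
under eq_bigr do rewrite -scalerA.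
by rewrite -scaler_sumr bary_comb.
Qed.

Lemma baryE v z : v \in K -> bary K v z = bary K v 0 + dotv z (bgrad v).
Proof.
move=> vK.
have := @bary_affine_comb _ (bweight z) (fun i => refvert n i) v vK (sum_bweight z).
rewrite !big_ord_recl bweight0 scaler0 add0r.
rewrite (_ : \sum_i _ *: _ = z); last first.
  rewrite [RHS]row_sum_delta; apply: eq_bigr => i _.
  by rewrite bweight_lift refvert_lift.
move=> ->; rewrite [X in _ + X](eq_bigr (fun i => z 0 i * bary K v (ebasis i))); last first.
  by move=> i _; rewrite bweight_lift refvert_lift.
rewrite mulrBl mul1r -addrA; congr (_ + _).
rewrite mulr_suml -sumrN -big_split/=; apply: eq_bigr => i _.
by rewrite [in RHS]mxE mulrBr addrC.
Qed.

Lemma bary_line v x u t : v \in K ->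
  bary K v (x + t *: u) = bary K v x + t * dotv u (bgrad v).
Proof. by move=> vK; rewrite (baryE (_ + _) vK) (baryE x vK) dotvDl dotvZl addrA. Qed.

(** The difference of the barycentric expansions of [u] and of 0; the coefficients of a direction
    therefore sum to 0 instead of 1, which is [sum_dotv_bgrad]. *)
Lemma direction_comb u : u = \sum_(v in K) dotv u (bgrad v) *: vert v.
Proof.
rewrite -[LHS]subr0 -[X in X - _](bary_comb u) -[X in _ - X](bary_comb 0) -sumrB.
apply: eq_bigr => v vK.
by rewrite -scalerBl (baryE u)// addrC addKr.
Qed.

Lemma sum_dotv_bgrad u : \sum_(v in K) dotv u (bgrad v) = 0.
Proof.
have := bary_sum u; under eq_bigr => v vK do rewrite baryE//.
by rewrite big_split/= bary_sum => h; apply: (addrI 1); rewrite addr0.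
Qed.

Lemma closed_hull : closed (hull K).
Proof.
rewrite hullE.
have -> : [set z | forall v, v \in K -> 0 <= bary K v z] =
  \bigcap_(v in [set v | v \in K]) [set z | 0 <= bary K v z].
  by apply/seteqP; split => z /= h v; exact: h.
by apply: closed_bigI => v _; exact: pol_closed_ge0 (pol_bary v).
Qed.

Lemma measurable_hull : measurable (hull K).
Proof. by apply: closed_measurable_rV; exact: closed_hull. Qed.

Lemma bounded_hull : bounded_set (hull K).
Proof.
exists (\sum_(v in K) `|vert v|); split; first exact: num_real.
move=> M hM z /= [w [w0 w1 ->]]; apply: le_trans (ltW hM).
apply: le_trans (ler_norm_sum _ _ _) _; apply: ler_sum => v vK.
rewrite normrZ ger0_norm ?w0// ler_piMl// -w1 (bigD1 v)//= lerDl.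
by apply: sumr_ge0 => u /andP[uK _]; exact: w0.
Qed.

Lemma lebesgue_hull_lty : (mu n (hull K) < +oo)%E.
Proof. by apply: bounded_lebesgue_rV; [exact: measurable_hull|exact: bounded_hull]. Qed.

Definition open_hull := [set z | forall v, v \in K -> 0 < bary K v z].

Lemma open_bary_pos (s : {set V}) : open [set z | forall v, v \in s -> 0 < bary K v z].
Proof.
have -> : [set z | forall v, v \in s -> 0 < bary K v z] =
    ~` \bigcup_(v in [set v | v \in s]) [set z | 0 <= - bary K v z].
  rewrite setC_bigcup; apply/seteqP; split => z /= h v vs.
    by have := h v vs => h'; apply/negP; rewrite oppr_ge0 -ltNge.
  by have := h v vs; rewrite /= oppr_ge0 => /negP; rewrite -ltNge.
rewrite openC; apply: closed_bigcup; first exact: finite_finset.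
by move=> v _; exact: pol_closed_ge0 (polN (pol_bary v)).
Qed.

Lemma open_open_hull : open open_hull.
Proof. exact: open_bary_pos. Qed.

Lemma open_hull_sub : open_hull `<=` hull K.
Proof. by rewrite hullE => z h v /h /ltW. Qed.

Lemma open_hull_nonempty : open_hull !=set0.
Proof.
have K0 : 0 < #|K|%:R :> R by rewrite (proj1 hK).
exists (\sum_(v in K) (#|K|%:R^-1) *: vert v) => v vK.
rewrite (@bary_unique _ (fun=> #|K|%:R^-1))// ?invr_gt0//.
by rewrite sumr_const -[_ *+ _]mulr_natl mulfV ?gt_eqF.
Qed.

Lemma hull_ball : exists c e, 0 < e /\ ball c e `<=` hull K.
Proof.
have [c hc] := open_hull_nonempty.
have /nbhs_ballP[e /= e0 he] := open_nbhs_nbhs (conj open_open_hull hc).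
by exists c, e; split => // z /he; exact: open_hull_sub.
Qed.

Lemma integrable_hull g : bm (hull K) g -> (mu n).-integrable (hull K) (EFin \o g).
Proof. by apply: bm_integrable; [exact: measurable_hull|exact: lebesgue_hull_lty]. Qed.

Lemma pol_bm_hull j (p : 'rV[R]_n -> R) : pol j p -> bm (hull K) p.
Proof. by move=> pp; apply: pol_bm pp _; exact: bounded_hull. Qed.

Lemma bary_simplex_map s (t : 'rV[R]_n) v : uniq s -> s =i K -> v \in K ->
  bary K v (simplex_map (points s) t) = bweight t (inord (index v s)).
Proof.
move=> us sK; apply: (@bary_unique _ (fun v => bweight t (inord (index v s)))).
  exact: sum_weights.
by rewrite -simplex_map_weights.
Qed.

Lemma simplex_map_hull s (t : 'rV[R]_n) : uniq s -> s =i K ->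
  hull K (simplex_map (points s) t) <-> unit_simplex t.
Proof.
move=> us sK; rewrite hullE unit_simplexE /=; split=> h.
  move=> i; have /card_gt0P[v0 _] : (0 < #|K|)%N by rewrite (proj1 hK).
  have := h _ (ordering_nth us sK v0 i).
  by rewrite (bary_simplex_map _ us sK) ?ordering_nth// index_uniq ?size_ordering// inord_val.
by move=> v vK; rewrite (bary_simplex_map _ us sK).
Qed.

Lemma integral_hull s g : uniq s -> s =i K -> bm (hull K) g ->
  \int[mu n]_(x in hull K) g x = `|\det (emat s)| * rint n (points s) g.
Proof.
move=> us sK bg.
have [_ <-] := Rintegral_affine (points s 0) (emat_unit us sK) measurable_hull (integrable_hull bg).
congr (_ * _); rewrite /rint; congr (Rintegral _ _ _).
by apply/seteqP; split => t /=; rewrite -/(simplex_map (points s) t) simplex_map_hull.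
Qed.

(** Both orderings compute the volume of the same hull, and the reference factor is nonzero. *)
Lemma det_emat s s' : uniq s -> s =i K -> uniq s' -> s' =i K ->
  `|\det (emat s)| = `|\det (emat s')|.
Proof.
move=> us sK us' sK'.
have := integral_hull us sK (bm_cst _ 1).
rewrite (integral_hull us' sK' (bm_cst _ 1)) /rint.
have h := lt0r_neq0 (@unit_simplex_vol_gt0 R n).
by move=> /(mulIf h).
Qed.

End cell.

End barycentric.

(** * Polynomials with vanishing integral *)

Section positivity.
Context {R : realType}.
Local Notation mu := (@lebesgue_rV R).

(** A nonnegative function with zero integral vanishes almost everywhere; were [p] nonzero at a
    point of the ball, it would be so on a smaller ball of positive measure. Then [pol_eq0] extends
    the zero set to the whole space. *)
Lemma integral_pol_eq0 n j (p : 'rV[R]_n -> R) (A : set 'rV[R]_n) c e :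
  pol j p -> measurable A -> bounded_set A -> 0 < e -> ball c e `<=` A ->
  (forall x, A x -> 0 <= p x) ->
  \int[mu n]_(x in A) p x = 0 -> forall x, p x = 0.
Proof.
move=> pp mA bA e0 cA pge0 h0.
have iA : (mu n).-integrable A (EFin \o p).
  by apply: bm_integrable; rewrite ?bounded_lebesgue_rV//; exact: pol_bm pp bA.
apply: (pol_eq0 pp (A := ball c e)).
- exact: ball_open.
- by exists c; exact: ballxx.
move=> x0 cx0; apply/eqP/negPn/negP => px0.
have d0 : 0 < `|p x0| by rewrite normr_gt0.
have [r r0 hr] : exists2 r, 0 < r & ball x0 r `<=` A `&` [set x | p x != 0].
  have oU : open (ball c e `&` [set x | p x != 0]).
    apply: openI; first exact: ball_open.
    have := @open_comp _ _ p [set y | y != 0].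
    by apply => [x _|]; [exact: pol_continuous pp x|exact: open_neq].
  have /nbhs_ballP[r /= r0 hr] := open_nbhs_nbhs (conj oU (conj cx0 px0)).
  by exists r => // x /hr[/cA]; split.
have hae : ae_eq (mu n) A (EFin \o p) (cst 0%E).
  apply/(ae_eq_integral_abs _ mA (measurable_int _ iA)).
  transitivity (\int[mu n]_(x in A) (p x)%:E)%E.
    by apply: eq_integral => x; rewrite inE => Ax /=; rewrite ger0_norm// pge0.
  rewrite -[LHS]fineK ?integrable_fin_num//; first by rewrite -/(Rintegral _ _ _) h0.
have [N [mN N0 hN]] := hae.
have sub : ball x0 r `<=` N.
  move=> x /hr[Ax px]; apply: hN => /= /(_ Ax) /= [] /eqP.
  by rewrite (negPf px).
have : (mu n (ball x0 r) <= mu n N)%E.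
  by apply: le_measure; rewrite ?inE//; exact: measurable_ball_rV.
rewrite N0 lebesgue_rV_ball// lee_fin leNgt => /negP; apply.
by rewrite exprn_gt0// mulrn_wgt0.
Qed.

Lemma integral_sqr_eq0 n j (p : 'rV[R]_n -> R) (A : set 'rV[R]_n) c e :
  pol j p -> measurable A -> bounded_set A -> 0 < e -> ball c e `<=` A ->
  \int[mu n]_(x in A) (p x ^+ 2) = 0 -> forall x, p x = 0.
Proof.
move=> pp mA bA e0 cA h0 x; apply/eqP; rewrite -sqrf_eq0; apply/eqP; move: x.
have p2 : pol (2 * j) (fun x => p x ^+ 2) by exact: pol_exp.
have := integral_pol_eq0 p2 mA bA e0 cA; apply=> // x _; exact: sqr_ge0.
Qed.

End positivity.

Lemma Rintegral_bm_sum d (T : measurableType d) (R : realType)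
    (m : {measure set T -> \bar R}) (D : set T) (I : Type) (s : seq I)
    (P : pred I) (F : I -> T -> R) : measurable D -> (m D < +oo)%E ->
  (forall i, bm D (F i)) ->
  \int[m]_(x in D) (\sum_(i <- s | P i) F i x) =
  \sum_(i <- s | P i) \int[m]_(x in D) F i x.
Proof.
move=> mD fD bF; elim: s => [|i s ih].
  rewrite big_nil; under eq_Rintegral do rewrite big_nil.
  by rewrite Rintegral_cst// mul0r.
rewrite big_cons; under eq_Rintegral do rewrite big_cons.
case: (P i) => //; rewrite -ih RintegralD//.
- exact: bm_integrable.
- by apply: bm_integrable => //; exact: bm_sum.
Qed.

(** In the divergence formula [b] is the integral over the face opposite to the base vertex, common
    to all edges; it cancels because the coefficients of a direction sum to zero. *)
Lemma sum_zero_weights (R : comRingType) (I : finType) (P : pred I) (c b : R)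
    (l B : I -> R) : \sum_(i | P i) l i = 0 ->
  c * \sum_(i | P i) (l i * b - l i * B i) = \sum_(i | P i) - l i * c * B i.
Proof.
move=> l0; rewrite sumrB -mulr_suml l0 mul0r sub0r mulrN mulr_sumr -sumrN.
by apply: eq_bigr => i _; ring.
Qed.

(** * Normals, faces and the divergence formula on a cell *)

Section cell_integrals.
Context {R : realType} {d : nat} {T : mesh R d.+1}.
Local Notation V := 'I_(nvert T).
Hypothesis mesh_nd : forall K : {set V}, K \in cells T -> nondegenerate K.

Lemma cell_nd (K : cell T) : nondegenerate (val K).
Proof. exact/mesh_nd/(valP K). Qed.

Section face.
Variables (K : cell T) (e : face T).
Hypothesis Ke : incident K e.

Lemma card_face : #|val e| = d.+1.
Proof. by have := valP e; rewrite inE => /andP[/eqP]. Qed.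

Lemma face_apex : exists a, a \in val K /\ val e = val K :\ a.
Proof.
have hc : #|val K :\: val e| = 1%N.
  by rewrite cardsDS// card_face (proj1 (cell_nd K)) subSnn.
have /cards1P[a ha] := introT eqP hc.
exists a; have := set11 a; rewrite -ha inE => /andP[ae aK]; split => //.
apply/setP => v; rewrite !inE negb_and negbK.
have [ve|ve] := boolP (v \in val e); first by rewrite (fintype.subsetP Ke).
by case: (v \in val K).
Qed.

Variable a : V.
Hypotheses (aK : a \in val K) (eE : val e = val K :\ a).

Lemma face_mem v : (v \in val e) = (v != a) && (v \in val K).
Proof. by rewrite eE !inE. Qed.

Lemma fvertE i : fvert e i = points (enum (val e)) i.
Proof. by []. Qed.

Lemma fintE g : fint e g =
  Num.sqrt (\det (fedges e *m (fedges e)^T)) * rint d (points (enum (val e))) g.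
Proof. by []. Qed.

(** The witness that excludes the default of [xget] is minus the normalized gradient of the
    coordinate of the apex [a], which is constant on the face and grows towards [a]. *)
Lemma normalP : let nu := normal K e in
  [/\ enorm nu = 1,
    forall a b, a \in val e -> b \in val e -> dotv (vert b - vert a) nu = 0 &
    forall a b, a \in val e -> b \in val K -> b \notin val e ->
      dotv (vert b - vert a) nu < 0].
Proof.
rewrite /= /normal; case: xgetP => // h.
pose g := bgrad (val K) a.
have bg v w : v \in val K -> w \in val K ->
    dotv (vert w - vert v) g = (a == w)%:R - (a == v)%:R.
  move=> vK wK; rewrite dotvBl -(bary_vert (cell_nd K) aK wK) -(bary_vert (cell_nd K) aK vK).
  by rewrite (baryE (cell_nd K) (vert w))// (baryE (cell_nd K) (vert v))// opprD addrACA subrr add0r.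
have [b be] : exists b, b \in val e by apply/card_gt0P; rewrite card_face.
have /andP[ba bK] : (b != a) && (b \in val K) by rewrite -face_mem.
have g0 : 0 < dotv g g.
  rewrite lt_def dotv_ge0 andbT; apply/eqP => /dotv_eq0 g0.
  have := bg b a bK aK; rewrite g0 dotvC dotv0l eqxx (eq_sym a) (negPf ba) subr0 => /eqP.
  by rewrite eq_sym oner_eq0.
have s0 : 0 < enorm g by rewrite sqrtr_gt0.
exfalso; apply: (h (- (enorm g)^-1 *: g)); split.
- apply/enorm1; rewrite dotvZl dotvZr -(sqr_sqrtr (dotv_ge0 g)) -/(enorm g).
  by field; rewrite gt_eqF.
- move=> v w; rewrite !face_mem => /andP[va vK] /andP[wa wK].
  by rewrite dotvZr bg// !(eq_sym a) (negPf va) (negPf wa) subrr mulr0.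
- move=> v w; rewrite !face_mem => /andP[va vK] wK; rewrite wK andbT negbK => /eqP ->.
  by rewrite dotvZr bg// eqxx (eq_sym a) (negPf va) subr0 mulr1 oppr_lt0 invr_gt0.
Qed.

(** Here [h] is the distance from the apex to the face: the gradient of the apex coordinate has
    length [1 / h], and volume is height times base. Multiplied, the two equations turn surface
    integrals against the normal into reference integrals without square roots. *)
Lemma face_flux u : exists h, [/\ 0 < h, 0 < Num.sqrt (\det (fedges e *m (fedges e)^T)),
  dotv u (normal K e) = - h * dotv u (bgrad (val K) a) &
  `|\det (emat (enum (val K)))| = h * Num.sqrt (\det (fedges e *m (fedges e)^T))].
Proof.
have [n1 n0 nneg] := normalP.
set nu := normal K e in n1 n0 nneg *.
have [b [l se]] : exists b l, enum (val e) = b :: l.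
  by have := card_face; rewrite cardE; case: (enum (val e)) => [//|b l _]; exists b, l.
have be : b \in val e by rewrite -mem_enum se mem_head.
have /andP[ba bK] : (b != a) && (b \in val K) by rewrite -face_mem.
have ae : a \notin val e by rewrite face_mem eqxx.
pose w := vert a - vert b.
have w0 : dotv w nu < 0 by exact: nneg.
(* With [b] first and the apex second, the first row of [emat s] is [w] and the others are those of
   [fedges e], the shape that [det_height] requires. *)
pose s := [:: b, a & l].
have us : uniq s.
  have := enum_uniq (val e); rewrite se /= => /andP[bl ul].
  rewrite /= ul andbT inE negb_or ba bl/=.
  by apply: contra ae => al; rewrite -mem_enum se inE al orbT.
have sK : s =i val K.
  move=> v; have := face_mem v.
  have -> : (v \in val e) = (v \in b :: l) by rewrite -se mem_enum.
  rewrite !inE; have [->|va] := eqVneq v a; first by rewrite orbT aK.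
  by rewrite /= => <-.
have eF : emat s = col_mx w (fedges e) :> 'M[R]_(1 + d, d.+1).
  apply/row_matrixP => i; rewrite rowK.
  case: (@split_ordP 1 d i) => k ->; [rewrite rowKu|rewrite rowKd].
    by rewrite ord1 row_id.
  by rewrite rowK /fvert se.
have hdet := @det_height R d w nu (fedges e) (iffLR (enorm1 _) n1).
have [] := hdet.
- move=> i; rewrite rowK.
  have sz : size (enum (val e)) = d.+1 by rewrite -cardE card_face.
  rewrite !fvertE !(points_nth b) ?sz ?ltnS//; apply: n0.
    by rewrite se.
  by rewrite -mem_enum mem_nth// sz ltnS.
- by have uA := emat_unit (cell_nd K) us sK; rewrite eF in uA.
rewrite -eF => G0 dE.
exists (- dotv w nu); split => //.
- by rewrite oppr_gt0.
- rewrite opprK {1}(direction_comb (cell_nd K) u) dotv_suml.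
  have -> : \sum_(v in val K) dotv (dotv u (bgrad (val K) v) *: vert v) nu =
     \sum_(v in val K) dotv u (bgrad (val K) v) * dotv (vert v - vert b) nu.
    under [RHS]eq_bigr do rewrite dotvBl mulrBr.
    rewrite sumrB -mulr_suml (sum_dotv_bgrad (cell_nd K)) mul0r subr0.
    by apply: eq_bigr => v _; rewrite dotvZl.
  rewrite (bigD1 a)//= big1 ?addr0 1?mulrC// => v /andP[vK va].
  by rewrite n0 ?mulr0// face_mem va.
- rewrite (det_emat (cell_nd K) (enum_uniq _) (mem_enum _) us sK) dE ltr0_norm//.
Qed.

End face.

(** The faces of a cell correspond to their opposite vertices. The reindexing is partial because
    removing [a] from [K] gives a face only when [a] is a vertex of [K]. *)
Lemma sum_faces (K : cell T) (F : face T -> R) (G : V -> R) :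
  (forall e a, incident K e -> a \in val K -> val e = val K :\ a -> F e = G a) ->
  \sum_(e : face T | incident K e) F e = \sum_(a in val K) G a.
Proof.
move=> FG.
have cardKa a : a \in val K -> #|val K :\ a| = d.+1.
  by move=> aK; have := proj1 (cell_nd K); rewrite (cardsD1 a) aK => -[].
have KaF a : a \in val K -> val K :\ a \in faces T.
  move=> aK; rewrite inE cardKa// eqxx; apply/existsP; exists (val K).
  by rewrite (valP K) subsetDl.
have /card_gt0P[v0 _] : (0 < #|val K|)%N by rewrite (proj1 (cell_nd K)).
pose apex (e : face T) := odflt v0 [pick a in val K :\: val e].
have apexE (e : face T) a : a \in val K -> val e = val K :\ a -> apex e = a.
  move=> aK eE; rewrite /apex; case: pickP => [b|/(_ a)]; rewrite eE !inE.
    by move=> /andP[+ bK]; rewrite bK andbT negbK => /eqP.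
  by rewrite eqxx aK.
rewrite [RHS](reindex_omap apex (fun a => insub (val K :\ a))); last first.
  move=> a aK; case: insubP => [e _ eE /=|]; last by rewrite KaF.
  by rewrite (apexE e a).
apply: eq_big => [e|e Ke].
  apply/idP/andP => [Ke|[aK /eqP]].
    have [a [aK eE]] := face_apex Ke.
    by rewrite (apexE e a)// aK -eE valK.
  case: insubP => // e' _ e'E [<-].
  by rewrite /incident e'E subsetDl.
by have [a [aK eE]] := face_apex Ke; rewrite (apexE e a)//; exact: FG.
Qed.

Definition rints k (s : {set V}) g := rint k (@points R d.+1 T (enum s)) g.

Lemma cint_hull (K : cell T) g s : uniq s -> s =i val K -> bm (hull (val K)) g ->
  cint K g = `|\det (emat (enum (val K)))| * rint d.+1 (points s) g.
Proof.
move=> us sK bg; rewrite -(det_emat (cell_nd K) us sK (enum_uniq _) (mem_enum _)).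
have := integral_hull (cell_nd K) us sK bg.
by rewrite /cint /celldom => ->.
Qed.

(* [u] is decomposed along the edges issued from a vertex [v0]; along an edge,
   the formula is [simplex_divergence]. *)
Theorem cell_divergence (K : cell T) j (g : 'rV[R]_d.+1 -> R) u : pol j g ->
  cint K ('D_u g) =
  \sum_(e : face T | incident K e) fint e (fun x => g x * dotv u (normal K e)).
Proof.
move=> pg; set D : R := `|\det (emat (enum (val K)))|.
have nK := cell_nd K.
pose l v := dotv u (bgrad (val K) v).
rewrite (sum_faces (G := fun a => - l a * D * rints d (val K :\ a) g)); last first.
  move=> e a Ke aK eE; have [h [h0 G0 uE DE]] := face_flux aK eE u.
  rewrite fintE uE /rint.
  under eq_Rintegral => t _ do rewrite mulrC.
  rewrite RintegralZl; last 2 first.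
  - exact: measurable_unit_simplex.
  - apply: integrable_unit_simplex; apply: pol_bm; first exact: pol_comp_affine pg.
    exact: bounded_unit_simplex.
  by rewrite -/(rint _ _ _) /D DE /rints -eE /l; ring.
have /card_gt0P[v0 v0K] : (0 < #|val K|)%N by rewrite (proj1 nK).
have pD v : pol j.-1 ('D_v g) by exact: pol_derive_pol.
rewrite (@cint_hull K _ (enum (val K)))//; last 3 first.
- exact: enum_uniq.
- exact: mem_enum.
- exact: pol_bm_hull (pD u).
rewrite -/D.
have uE : u = \sum_(v in val K) l v *: (vert v - vert v0).
  under eq_bigr do rewrite scalerBr.
  by rewrite sumrB -scaler_suml (sum_dotv_bgrad nK) scale0r subr0; exact: direction_comb.
have bU k (p : 'rV[R]_d.+1 -> R) s : pol k p ->
    (lebesgue_rV R d.+1).-integrable (@unit_simplex R d.+1) (EFin \o (p \o simplex_map (@points R _ T s))).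
  move=> pp; apply: integrable_unit_simplex; apply: pol_bm; first exact: pol_comp_affine pp.
  exact: bounded_unit_simplex.
have bU' k (p : 'rV[R]_d.+1 -> R) s : pol k p ->
    bm (@unit_simplex R d.+1) (fun t => p (simplex_map (@points R _ T s) t)).
  move=> pp; apply: pol_bm; first exact: pol_comp_affine pp.
  exact: bounded_unit_simplex.
have Du x : 'D_u g x = \sum_(v in val K) l v * 'D_(vert v - vert v0) g x.
  have dg := pol_differentiable x pg.
  rewrite deriveE// {1}uE linear_sum; apply: eq_bigr => v _.
  by rewrite linearZ deriveE.
have -> : rint d.+1 (points (enum (val K))) ('D_u g) =
    \sum_(v in val K) l v * rint d.+1 (points (enum (val K))) ('D_(vert v - vert v0) g).
  rewrite /rint; under eq_Rintegral do rewrite Du.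
  rewrite Rintegral_bm_sum; last 3 first.
  - exact: measurable_unit_simplex.
  - exact: lebesgue_unit_simplex_lty.
  - by move=> v; apply: bmZ; exact: bU' (pD _).
  apply: eq_bigr => v _; rewrite RintegralZl//; first exact: measurable_unit_simplex.
  exact: bU (pD _).
(* For [v = v0] both sides vanish; otherwise the vertices are reordered to begin with [v0, v], which
   [rint_perm_eq] allows. *)
have step v : v \in val K -> rint d.+1 (points (enum (val K))) ('D_(vert v - vert v0) g) =
    rints d (val K :\ v0) g - rints d (val K :\ v) g.
  move=> vK; have [->|vv0] := eqVneq v v0.
    rewrite !subrr /rint; under eq_Rintegral => t _.
      by rewrite (pol_derive_lin _ _ pg) big1 => [|i _]; [over|rewrite mxE mul0r].
    by rewrite Rintegral_cst ?mul0r//; exact: measurable_unit_simplex.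
  pose r := enum (val K :\ v0 :\ v).
  have sz : size r = d.
    rewrite -cardE; have := proj1 nK.
    rewrite (cardsD1 v0) v0K (cardsD1 v (val K :\ v0)) !inE vv0 vK /=.
    by move=> [].
  have pe w : w \in [:: v0; v] -> perm_eq (w :: r) (enum (val K :\ (if w == v then v0 else v))).
    move=> wvv; apply: uniq_perm; rewrite ?enum_uniq//.
      rewrite /= enum_uniq andbT mem_enum !inE.
      by move: wvv; rewrite !inE => /orP[] ->; rewrite /= ?andbF.
    move=> x; rewrite inE !mem_enum !inE.
    move: wvv; rewrite !inE => /orP[] /eqP ->; rewrite ?eqxx ?(eq_sym v0 v) ?(negPf vv0).
      have [->|xv0] := eqVneq x v0; first by rewrite eq_sym vv0 v0K.
      by rewrite /=.
    have [->|xv] := eqVneq x v; first by rewrite vv0 vK.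
    by rewrite /=.
  have -> : rint d.+1 (points (enum (val K))) ('D_(vert v - vert v0) g) =
     rint d.+1 (points [:: v0, v & r]) ('D_(vert v - vert v0) g).
    apply: rint_perm_eq (pD _); first by rewrite /= sz.
    rewrite perm_sym.
    have := pe v; rewrite !inE !eqxx orbT => /(_ isT) pv.
    rewrite -(perm_cons v0) in pv; apply: perm_trans pv _.
    apply: uniq_perm; rewrite ?enum_uniq//=.
      by rewrite enum_uniq mem_enum !inE eqxx.
    by move=> x; rewrite inE !mem_enum !inE; case: eqVneq => // ->.
  have e1 : (fun i => points [:: v0, v & r] i.+1) = points (v :: r) by [].
  have e2 : (fun i => if i is 0 then points [:: v0, v & r] 0 else points [:: v0, v & r] i.+1)
      = points (v0 :: r) by apply/funext => -[].
  have := simplex_divergence d (points [:: v0, v & r]) pg.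
  have -> : points [:: v0, v & r] 1 - points [:: v0, v & r] 0 = vert v - vert v0 by [].
  have r1 : rint d (points (v :: r)) g = rints d (val K :\ v0) g.
    have := pe v; rewrite !inE !eqxx orbT => /(_ isT) pv.
    by rewrite /rints perm_sym in pv *; rewrite (rint_perm_eq _ pv pg)//= sz.
  have r2 : rint d (points (v0 :: r)) g = rints d (val K :\ v) g.
    have := pe v0; rewrite !inE !eqxx eq_sym (negPf vv0) => /(_ isT) pv.
    by rewrite /rints perm_sym in pv *; rewrite (rint_perm_eq _ pv pg)//= sz.
  rewrite e1 e2 r1 r2.
  exact.
have l0 : \sum_(v in val K) l v = 0 := sum_dotv_bgrad nK u.
pose B v := rints d (val K :\ v) g.
have -> : \sum_(v in val K) l v * rint d.+1 (points (enum (val K))) ('D_(vert v - vert v0) g) =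
    \sum_(v in val K) (l v * B v0 - l v * B v).
  by apply: eq_bigr => v vK; rewrite step// mulrBr.
exact: sum_zero_weights.
Qed.

End cell_integrals.

(** * Strongly monotone equations on a ball *)

Section inner_product.
Context {R : realType} {N : nat}.
Variable A : 'rV[R]_N -> 'rV[R]_N -> R.
Hypotheses (AC : forall x y, A x y = A y x)
  (Alin : forall a x y z, A (a *: x + y) z = a * A x z + A y z)
  (A_ge0 : forall x, 0 <= A x x) (A_eq0 : forall x, A x x = 0 -> x = 0).

Definition formnorm x : R := Num.sqrt (A x x).
Local Notation nrm := formnorm.

Lemma form0l z : A 0 z = 0.
Proof. by have := Alin (-1) 0 0 z; rewrite scaler0 addr0 mulN1r addNr. Qed.

Lemma formDl x y z : A (x + y) z = A x z + A y z.
Proof. by have := Alin 1 x y z; rewrite scale1r mul1r. Qed.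

Lemma formZl a x z : A (a *: x) z = a * A x z.
Proof. by have := Alin a x 0 z; rewrite addr0 form0l addr0. Qed.

Lemma formNl x z : A (- x) z = - A x z.
Proof. by rewrite -scaleN1r formZl mulN1r. Qed.

Lemma formDr x y z : A z (x + y) = A z x + A z y.
Proof. by rewrite AC formDl AC [A y z]AC. Qed.

Lemma formZr a x z : A z (a *: x) = a * A z x.
Proof. by rewrite AC formZl AC. Qed.

Lemma formNr x z : A z (- x) = - A z x.
Proof. by rewrite AC formNl AC. Qed.

Lemma form_suml (I : Type) (s : seq I) (P : pred I) f z :
  A (\sum_(i <- s | P i) f i) z = \sum_(i <- s | P i) A (f i) z.
Proof. by apply: (big_morph (fun x => A x z)) => [x y|]; [exact: formDl|exact: form0l]. Qed.

Lemma formnorm_ge0 x : 0 <= nrm x. Proof. exact: sqrtr_ge0. Qed.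

Lemma sqr_formnorm x : nrm x ^+ 2 = A x x.
Proof. by rewrite sqr_sqrtr. Qed.

Lemma formnormZ a x : nrm (a *: x) = `|a| * nrm x.
Proof. by rewrite /formnorm formZl formZr mulrA sqrtrM -?expr2 ?sqr_ge0// sqrtr_sqr. Qed.

Lemma formnormN x : nrm (- x) = nrm x.
Proof. by rewrite /formnorm formNl formNr opprK. Qed.

Lemma form_CS x y : A x y <= nrm x * nrm y.
Proof.
have [y0|y0] := eqVneq (A y y) 0.
  by rewrite (A_eq0 y0) AC form0l mulr_ge0 ?formnorm_ge0.
have y1 : 0 < A y y by rewrite lt_def y0 A_ge0.
have h : A x y ^+ 2 <= A x x * A y y.
  have := A_ge0 (A y y *: x - A x y *: y).
  rewrite !(formDl, formDr, formNl, formNr, formZl, formZr) [A y x]AC => h.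
  have : 0 <= A y y * (A x x * A y y - A x y ^+ 2) by apply: le_trans h _; nra.
  by rewrite pmulr_rge0// subr_ge0.
apply: le_trans (ler_norm _) _; rewrite -(@ler_pXn2r _ 2)// ?nnegrE ?mulr_ge0 ?formnorm_ge0//.
by rewrite real_normK ?num_real// exprMn !sqr_formnorm.
Qed.

Lemma form_CS_norm x y : `|A x y| <= nrm x * nrm y.
Proof. by rewrite ler_norml form_CS andbT lerNl -formNl -(formnormN x) form_CS. Qed.

Lemma formnormD x y : nrm (x + y) <= nrm x + nrm y.
Proof.
rewrite -(@ler_pXn2r _ 2)// ?nnegrE ?addr_ge0 ?formnorm_ge0//.
rewrite sqr_formnorm sqrrD !sqr_formnorm formDl !formDr [A y x]AC.
by have := form_CS x y; nra.
Qed.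

Lemma formnormB x y : `|nrm x - nrm y| <= nrm (x - y).
Proof.
rewrite ler_norml; apply/andP; split.
  have := formnormD (y - x) x; rewrite subrK -(formnormN (y - x)) opprB; lra.
by have := formnormD (x - y) y; rewrite subrK; lra.
Qed.

(** A kernel vector of the Gram matrix would be orthogonal to itself, so definiteness of [A] makes
    the matrix invertible. *)
Lemma form_riesz (l : 'rV[R]_N -> R) :
  (forall a x y, l (a *: x + y) = a * l x + l y) ->
  exists w, forall v, A w v = l v.
Proof.
move=> llin.
have l0 : l 0 = 0 by have := llin (-1) 0 0; rewrite scaler0 addr0 mulN1r addNr.
have lD x y : l (x + y) = l x + l y by have := llin 1 x y; rewrite scale1r mul1r.
have lZ a x : l (a *: x) = a * l x by have := llin a x 0; rewrite addr0 l0 addr0.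
have lE v : l v = \sum_i v 0 i * l (delta_mx 0 i).
  rewrite [v in LHS]row_sum_delta (big_morph l lD l0).
  by apply: eq_bigr => i _; rewrite lZ.
pose G : 'M[R]_N := \matrix_(i, j) A (delta_mx 0 i) (delta_mx 0 j).
have GE w j : (w *m G) 0 j = A w (delta_mx 0 j).
  rewrite mxE [w in RHS]row_sum_delta form_suml; apply: eq_bigr => i _.
  by rewrite mxE formZl.
have AE w v : A w v = \sum_j v 0 j * (w *m G) 0 j.
  rewrite AC [v in LHS]row_sum_delta form_suml; apply: eq_bigr => j _.
  by rewrite formZl AC GE.
have uG : G \in unitmx.
  rewrite -row_free_unit -kermx_eq0; apply/eqP/row_matrixP => i; rewrite row0.
  apply: A_eq0; rewrite AE big1// => j _.
  by rewrite -row_mul mulmx_ker row0 [X in _ * X]mxE mulr0.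
exists ((\row_j l (delta_mx 0 j)) *m invmx G) => v.
rewrite AE lE; apply: eq_bigr => j _; congr (_ * _).
by rewrite mulmxKV// mxE.
Qed.

Lemma formnorm_le_norm : exists2 c, 0 <= c & forall x, nrm x <= c * `|x|.
Proof.
exists (\sum_i nrm (delta_mx 0 i)); first by apply: sumr_ge0 => i _; exact: formnorm_ge0.
move=> x; rewrite [x in leLHS]row_sum_delta.
apply: (@le_trans _ _ (\sum_i nrm (x 0 i *: delta_mx 0 i))).
  elim/big_ind2 : _ => //; first by rewrite /formnorm form0l sqrtr0.
  by move=> a b c d ab cd; apply: le_trans (formnormD _ _) _; exact: lerD.
rewrite mulr_suml; apply: ler_sum => i _; rewrite formnormZ mulrC.
rewrite ler_wpM2l ?formnorm_ge0// [leRHS]mx_normrE.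
exact: (le_bigmax _ (fun k : 'I_1 * 'I_N => `|x k.1 k.2|) (0, i)).
Qed.

(** Each coordinate is a linear functional, so by [form_riesz] it is the product with a fixed
    vector, and Cauchy-Schwarz bounds it; no compactness is involved. *)
Lemma norm_le_formnorm : exists2 c, 0 <= c & forall x, `|x| <= c * nrm x.
Proof.
have h i : exists c, 0 <= c /\ forall x : 'rV[R]_N, `|x 0 i| <= c * nrm x.
  have [|w hw] := @form_riesz (fun x => x 0 i); first by move=> a x y; rewrite !mxE.
  exists (nrm w); split; first exact: formnorm_ge0.
  by move=> x; rewrite -hw form_CS_norm.
have /choice[c hc] := h.
have c0 : 0 <= \sum_i c i by apply: sumr_ge0 => i _; have [] := hc i.
exists (\sum_i c i) => // x.
rewrite [leLHS]mx_normrE; apply/bigmax_leP; split => /=; first by rewrite mulr_ge0 ?formnorm_ge0.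
move=> [i j] _ /=; rewrite ord1; have [cj0 /(_ x)] := hc j; move/le_trans; apply.
rewrite ler_wpM2r ?formnorm_ge0// (bigD1 j)//= lerDl sumr_ge0// => k _.
by have [] := hc k.
Qed.

Lemma formnorm_continuous : continuous nrm.
Proof.
have [c c0 hc] := formnorm_le_norm => /= x.
apply/(@cvgrPdist_le _ _ _ (nbhs x) (nbhs_filter x)) => e e0.
near=> y; apply: le_trans (formnormB _ _) _; apply: le_trans (hc _) _.
have : `|x - y| <= e / (c + 1).
  by near: y; apply: cvgr_dist_le; [exact: cvg_id|rewrite divr_gt0// ltr_wpDl].
rewrite ler_pdivlMr ?ltr_wpDl// => h.
by apply: le_trans h; rewrite mulrC ler_wpM2l// lerDl.
Unshelve. all: by end_near. Qed.

Lemma formnorm_ball_compact rho : compact [set x | nrm x <= rho].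
Proof.
have [c c0 hc] := norm_le_formnorm.
apply: bounded_closed_compact.
  exists (c * rho); split; first exact: num_real.
  move=> M hM x /= hx; apply: le_trans (ltW hM); apply: le_trans (hc _) _.
  exact: ler_wpM2l.
have h := @closed_comp _ _ nrm [set y | y <= rho].
by apply: h; [move=> x _; exact: formnorm_continuous|exact: closed_le].
Qed.

Definition form_proj rho x := if nrm x <= rho then x else (rho / nrm x) *: x.

Section projection.
Variable rho : R.
Hypothesis rho0 : 0 < rho.
Local Notation proj := (form_proj rho).

Lemma form_proj_le x : nrm (proj x) <= rho.
Proof.
rewrite /form_proj; case: ifPn => // ; rewrite -ltNge => h.
have x0 : 0 < nrm x by apply: lt_trans h.
rewrite formnormZ ger0_norm; last by rewrite divr_ge0 ?ltW.
by rewrite divfK ?lt0r_neq0.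
Qed.

(** The variational inequality of the projection onto the ball; adding its instances at two points
    gives nonexpansiveness. *)
Lemma form_proj_vi x z : nrm z <= rho -> A (x - proj x) (z - proj x) <= 0.
Proof.
rewrite /form_proj; case: ifPn => [|]; first by rewrite subrr form0l.
rewrite -ltNge => h hz.
have x0 : 0 < nrm x by apply: lt_trans h.
set t := rho / nrm x.
have t1 : t < 1 by rewrite ltr_pdivrMr// mul1r.
have t0 : 0 < t by rewrite divr_gt0.
have -> : x - t *: x = (1 - t) *: x by rewrite scalerBl scale1r.
rewrite formZl formDr formNr formZr -sqr_formnorm.
rewrite pmulr_rle0; last by rewrite subr_gt0.
have -> : t * nrm x ^+ 2 = rho * nrm x by rewrite /t; field; rewrite lt0r_neq0.
by have := form_CS x z; have := formnorm_ge0 x; nra.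
Qed.

Lemma form_proj_nonexpansive x y : nrm (proj x - proj y) <= nrm (x - y).
Proof.
have h1 := form_proj_vi x (form_proj_le y).
have h2 := form_proj_vi y (form_proj_le x).
set p := proj x in h1 h2 *; set q := proj y in h1 h2 *.
have : nrm (p - q) ^+ 2 <= nrm (x - y) * nrm (p - q).
  apply: le_trans (form_CS _ _); rewrite sqr_formnorm.
  move: h1 h2; rewrite !(formDl, formDr, formNl, formNr) [A q p]AC; lra.
have := formnorm_ge0 (p - q); rewrite le_eqVlt => /predU1P[<- _|h].
  exact: formnorm_ge0.
by rewrite expr2 ler_pM2r.
Qed.

End projection.

(** Instead of iterating, the displacement [nrm (x - Theta x)] is minimized over the compact ball:
    at a minimizer [x] the displacement of [Theta x] is at most [q] times that of [x], against
    minimality unless it is 0. *)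
Lemma form_contraction_fixpoint rho q (Theta : 'rV[R]_N -> 'rV[R]_N) :
  0 <= rho -> q < 1 ->
  (forall x, nrm x <= rho -> nrm (Theta x) <= rho) ->
  (forall x y, nrm x <= rho -> nrm y <= rho ->
     nrm (Theta x - Theta y) <= q * nrm (x - y)) ->
  exists2 x, nrm x <= rho & Theta x = x.
Proof.
move=> rho0 q1 ThetaB ThetaC.
pose B := [set x | nrm x <= rho].
pose f x := nrm (x - Theta x).
have [c c0 hc] := formnorm_le_norm.
have cf : {within B, continuous f}.
  apply/subspace_continuousP => x Bx; apply/cvgrPdist_le => e e0.
  have d0 : 0 < e / (2 * c + 2) by rewrite divr_gt0// ltr_wpDl// mulr_ge0.
  have nb : \forall y \near x, `|x - y| <= e / (2 * c + 2).
    by apply/nbhs_ballP; exists (e / (2 * c + 2)) => //= y; rewrite mx_norm_ball => /ltW.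
  near=> y; apply: le_trans (formnormB _ _) _.
  have By : B y by near: y; exact: withinT.
  rewrite (_ : _ - _ = (x - y) + (Theta y - Theta x)); last first.
    by apply/rowP => i; rewrite !mxE; ring.
  apply: le_trans (formnormD _ _) _.
  have := ThetaC y x By Bx; have := formnorm_ge0 (x - y).
  rewrite -(formnormN (y - x)) opprB.
  have := hc (x - y).
  have : `|x - y| <= e / (2 * c + 2).
    by near: y; exact: cvg_within.
  rewrite ler_pdivlMr ?ltr_wpDl// ?mulr_ge0// => h1 h2 h3 h4.
  have := normr_ge0 (x - y); nra.
have cB : compact B by exact: formnorm_ball_compact.
have [|x] := EVT_min_rV _ cB cf.
  by exists 0; rewrite /B /= /formnorm form0l sqrtr0.
rewrite inE /= => Bx xmin; exists x => //.
have := xmin (Theta x); rewrite inE => /(_ (ThetaB _ Bx)); rewrite /f.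
have := ThetaC _ _ Bx (ThetaB _ Bx) => h1 h2.
have h0 := formnorm_ge0 (x - Theta x).
have : nrm (x - Theta x) = 0 by nra.
move=> /eqP; rewrite sqrtr_eq0 => hle.
have /A_eq0 /eqP : A (x - Theta x) (x - Theta x) = 0 by apply/eqP; rewrite eq_le hle A_ge0.
by rewrite subr_eq0 => /eqP.
Unshelve. all: by end_near. Qed.

(* Zeros of [P] on the ball are fixed points of the projected Richardson step
   [x - tau P x], a contraction for small [tau]; positivity on the sphere rules
   out that the projection is active. *)
Theorem form_monotone_zero rho delta Lam (P : 'rV[R]_N -> 'rV[R]_N -> R) :
  0 < rho -> 0 < delta ->
  (forall x a v w, P x (a *: v + w) = a * P x v + P x w) ->
  (forall x y, nrm x <= rho -> nrm y <= rho ->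
     delta * A (x - y) (x - y) <= P x (x - y) - P y (x - y)) ->
  (forall x y v, nrm x <= rho -> nrm y <= rho ->
     `|P x v - P y v| <= Lam * nrm (x - y) * nrm v) ->
  (forall x, nrm x = rho -> 0 < P x x) ->
  exists2 x, nrm x <= rho & forall v, P x v = 0.
Proof.
move=> rho0 delta0 Plin Pmon Plip Pout.
have /choice[S hS] : forall x, exists w, forall v, A w v = P x v.
  by move=> x; apply: form_riesz; exact: Plin.
(* Adding [delta] makes [L] positive and at least [delta], so that [q2] below is nonnegative. The
   step [tau = delta / L^2] minimizes [1 - 2 tau delta + tau^2 L^2], with minimal value [q2]. *)
pose L : R := `|Lam| + delta.
have L0 : 0 < L by rewrite ltr_wpDl.
pose tau := delta / L ^+ 2.
have tau0 : 0 < tau by rewrite divr_gt0// exprn_gt0.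
have dL : delta <= L by rewrite lerDr.
have Slip x y : nrm x <= rho -> nrm y <= rho -> nrm (S x - S y) <= L * nrm (x - y).
  move=> hx hy; have := formnorm_ge0 (S x - S y); rewrite le_eqVlt => /predU1P[<-|h].
    by rewrite mulr_ge0 ?formnorm_ge0// ltW.
  rewrite -(ler_pM2r h) -expr2 sqr_formnorm formDl formNl !hS.
  apply: le_trans (ler_norm _) _; apply: le_trans (Plip _ _ _ hx hy) _.
  rewrite ler_wpM2r ?formnorm_ge0// ler_wpM2r ?formnorm_ge0//.
  by rewrite (le_trans (ler_norm _))// lerDl ltW.
pose q2 := 1 - (delta / L) ^+ 2.
have q20 : 0 <= q2.
  by rewrite subr_ge0 exprn_ile1// ?divr_ge0 ?(ltW L0) ?(ltW delta0)// ler_pdivrMr// mul1r.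
have q21 : q2 < 1 by rewrite ltrBlDr ltrDl exprn_gt0// divr_gt0.
have [||x hx fx] := @form_contraction_fixpoint rho (Num.sqrt q2)
    (fun x => form_proj rho (x - tau *: S x)) (ltW rho0) _ (fun x _ => form_proj_le rho0 _).
- by rewrite -sqrtr1 ltr_sqrt.
- move=> x y hx hy; apply: le_trans (form_proj_nonexpansive rho0 _ _) _.
  rewrite -(@ler_pXn2r _ 2)// ?nnegrE ?mulr_ge0 ?formnorm_ge0 ?sqrtr_ge0//.
  rewrite exprMn [Num.sqrt q2 ^+ 2]sqr_sqrtr// !sqr_formnorm.
  have -> : x - tau *: S x - (y - tau *: S y) = (x - y) - tau *: (S x - S y).
    by apply/rowP => i; rewrite !mxE; ring.
  have h1 := Pmon x y hx hy.
  have h2 : A (S x - S y) (x - y) = P x (x - y) - P y (x - y) by rewrite formDl formNl !hS.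
  have h3 : A (S x - S y) (S x - S y) <= L ^+ 2 * A (x - y) (x - y).
    rewrite -!sqr_formnorm -exprMn ler_pXn2r ?nnegrE ?mulr_ge0 ?formnorm_ge0 ?(ltW L0)//.
    exact: Slip.
  have -> : A (x - y - tau *: (S x - S y)) (x - y - tau *: (S x - S y)) =
     A (x - y) (x - y) - 2 * tau * A (S x - S y) (x - y) +
     tau ^+ 2 * A (S x - S y) (S x - S y).
    move: (x - y) (S x - S y) => a b.
    by rewrite formDl !formDr !formNl !formNr !formZl !formZr [A a b]AC; ring.
  rewrite h2.
  have h4 : tau ^+ 2 * A (S x - S y) (S x - S y) <= tau ^+ 2 * (L ^+ 2 * A (x - y) (x - y)).
    by rewrite ler_wpM2l// sqr_ge0.
  have h5 : tau * (delta * A (x - y) (x - y)) <= tau * (P x (x - y) - P y (x - y)).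
    by rewrite ler_wpM2l// ltW.
  have e1 : tau ^+ 2 * (L ^+ 2 * A (x - y) (x - y)) = tau * (delta * A (x - y) (x - y)).
    by rewrite /tau; field; rewrite lt0r_neq0.
  have e2 : q2 * A (x - y) (x - y) = A (x - y) (x - y) - tau * (delta * A (x - y) (x - y)).
    by rewrite /tau /q2; field; rewrite lt0r_neq0.
  by rewrite e2; lra.
exists x => // v; rewrite -hS.
move: fx; rewrite /form_proj; case: ifPn => [_ fx|].
  suff -> : S x = 0 by rewrite form0l.
  have : tau *: S x = 0 by apply/eqP; rewrite -oppr_eq0 -(inj_eq (addrI x)) fx addr0.
  by move=> /eqP; rewrite scaler_eq0 (gt_eqF tau0) => /eqP.
rewrite -ltNge; set y := x - _ => hy fx; exfalso.
have y0 : 0 < nrm y by apply: lt_trans hy.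
have xr : nrm x = rho.
  rewrite -fx formnormZ ger0_norm ?divr_ge0 ?ltW//.
  by rewrite divfK// lt0r_neq0.
have := Pout _ xr; rewrite -hS.
have yx : y = (nrm y / rho) *: x.
  rewrite -[X in _ = _ *: X]fx scalerA (_ : _ * _ = 1) ?scale1r//.
  by field; rewrite !lt0r_neq0.
have : A y x = A x x - tau * A (S x) x by rewrite /y formDl formNl formZl.
rewrite yx formZl -sqr_formnorm xr.
have : nrm y / rho > 1 by rewrite ltr_pdivlMr// mul1r.
have r2 : 0 < rho ^+ 2 by rewrite exprn_gt0.
move=> h1 h2 h3; nra.
Qed.

End inner_product.

(** * Linear algebra *)

(** Taking for [c] the columns of the cokernel matrix tests membership of [l] in the row space. *)
Lemma fredholm_row (R : fieldType) p q (B : 'M[R]_(p, q)) (l : 'rV[R]_q) :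
  (forall c : 'cV[R]_q, B *m c = 0 -> l *m c = 0) -> exists x, x *m B = l.
Proof.
move=> h; suff /submxP[x ->] : (l <= B)%MS by exists x.
rewrite submxE; apply/eqP/rowP => j; rewrite mxE.
have := h (col j (cokermx B)); rewrite {1}colE mulmxA mulmx_coker mul0mx => /(_ erefl).
move=> /matrixP/(_ 0 0); rewrite !mxE => h0; apply: etrans h0.
by apply: eq_bigr => k _; rewrite [in RHS]mxE.
Qed.

(** No definiteness is assumed, since monomials restricted to a face are dependent and their Gram
    matrix may be singular. A null vector of the matrix is a null vector of the quadratic form,
    which is what the hypothesis controls. *)
Lemma semidefinite_solve (R : realFieldType) (I : finType) (g : I -> I -> R) (l : I -> R) :
  (forall c : I -> R, \sum_i \sum_j c i * c j * g i j = 0 ->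
     \sum_j c j * l j = 0) ->
  exists x : I -> R, forall j, \sum_i x i * g i j = l j.
Proof.
move=> h.
pose B : 'M[R]_#|I| := \matrix_(i, j) g (enum_val i) (enum_val j).
have [c hc|x hx] := @fredholm_row _ _ _ B (\row_j l (enum_val j)); last first.
  exists (fun i => x 0 (enum_rank i)) => j.
  move/rowP : hx => /(_ (enum_rank j)); rewrite !mxE enum_rankK => <-.
  rewrite (reindex_onto enum_val enum_rank) => [|i _]; last exact: enum_rankK.
  by apply: eq_big => [i|i _]; rewrite ?enum_valK ?eqxx// mxE enum_rankK.
apply/matrixP => a b; rewrite !ord1 mxE [RHS]mxE.
rewrite -[RHS](h (fun i => c (enum_rank i) 0)).
  rewrite [RHS](reindex_onto enum_val enum_rank) => [|i _]; last exact: enum_rankK.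
  by apply: eq_big => [i|i _]; rewrite ?enum_valK ?eqxx// mxE mulrC.
apply: big1 => i _.
have /matrixP/(_ (enum_rank i) 0) := hc; rewrite !mxE => h0.
under eq_bigr do rewrite -mulrA; rewrite -mulr_sumr.
rewrite (_ : \sum_j _ = 0) ?mulr0// -[RHS]h0.
rewrite (reindex_onto enum_val enum_rank) => [|j _]; last exact: enum_rankK.
by apply: eq_big => [j|j _]; rewrite ?enum_valK ?eqxx// mxE enum_rankK mulrC.
Qed.

Section basis.
Context {R : fieldType} {W : lmodType R}.
Variables (E : set W) (I : finType) (w : I -> W).
Hypothesis E0 : E 0.
Hypothesis Ew : forall u, E u -> exists c : I -> R, u = \sum_i c i *: w i.

Let indep N (b : 'I_N -> W) :=
  forall c : 'rV[R]_N, \sum_i c 0 i *: b i = 0 -> c = 0.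

(** The generators [w] may lie outside [E], so a basis cannot be selected among them. A free family
    in [E] of maximal length is taken instead: its length is at most [#|I|] because the coordinate
    rows are free, and maximality makes it span [E]. *)
Lemma exists_basis : exists N (b : 'I_N -> W),
  [/\ forall i, E (b i),
      forall c : 'rV[R]_N, \sum_i c 0 i *: b i = 0 -> c = 0 &
      forall u, E u -> exists c : 'rV[R]_N, u = \sum_i c 0 i *: b i].
Proof.
pose P N := `[< exists b : 'I_N -> W, (forall i, E (b i)) /\ indep b >].
have P0 : exists N, P N.
  exists 0%N; apply/asboolP; exists (fun=> 0); split=> // c _.
  by apply/rowP => -[].
have Pb N : P N -> (N <= #|I|)%N.
  move=> /asboolP[b [Eb ib]]; have /choice[c hc] := fun i => Ew (Eb i).
  pose C : 'M[R]_(N, #|I|) := \matrix_(i, j) c i (enum_val j).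
  suff : row_free C by rewrite /row_free => /eqP <-; exact: rank_leq_col.
  rewrite -kermx_eq0; apply/eqP/row_matrixP => k; rewrite row0; apply: ib.
  set v := row k _; under eq_bigr do rewrite hc scaler_sumr.
  rewrite exchange_big/= big1// => j _.
  under eq_bigr do rewrite scalerA; rewrite -scaler_suml.
  have : v *m C = 0 by rewrite -row_mul mulmx_ker row0.
  move=> /rowP/(_ (enum_rank j)); rewrite !mxE => h.
  rewrite (_ : \sum_i _ = 0) ?scale0r// -[RHS]h.
  by apply: eq_bigr => i _; rewrite [C _ _]mxE enum_rankK.
case: (ex_maxnP P0 Pb) => N /asboolP[b [Eb ib]] Nmax.
exists N, b; split => // u Eu.
have nP : ~ P N.+1 by move=> /Nmax; rewrite ltnn.
pose b' (i : 'I_N.+1) := if unlift ord_max i is Some j then b j else u.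
have [c hc c0] : exists2 c : 'rV[R]_N.+1, \sum_i c 0 i *: b' i = 0 & c != 0.
  apply: contrapT => nc; apply: nP; apply/asboolP; exists b'; split.
    by move=> i; rewrite /b'; case: unlift.
  by move=> c hc; apply/eqP/negPn/negP => c0; apply: nc; exists c.
pose c' := \row_i c 0 (lift ord_max i).
have hs : c 0 ord_max *: u + \sum_i c' 0 i *: b i = 0.
  rewrite -[RHS]hc (bigD1_ord ord_max)//= /b' unlift_none; congr (_ + _).
  by apply: eq_bigr => i _; rewrite liftK mxE.
have cN : c 0 ord_max != 0.
  apply: contraNneq c0 => cN; rewrite cN scale0r add0r in hs.
  move/ib/rowP : hs => hs; apply/eqP/rowP => i; rewrite mxE.
  case: (unliftP ord_max i) => [j ->|-> //].
  by have := hs j; rewrite !mxE.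
exists (- (c 0 ord_max)^-1 *: c').
move/eqP: hs; rewrite addr_eq0 => /eqP hs.
rewrite -[u]scale1r -(mulVf cN) -scalerA hs scalerN -scaleNr scaler_sumr.
by apply: eq_bigr => i _; rewrite [in RHS]mxE scalerA.
Qed.

End basis.

(** * Topology of the mesh *)

Section avoid.
Context {R : realType} {n : nat}.

(** Removing one hyperplane at a time leaves a nonempty open set, since an affine function with
    nonzero linear part cannot vanish on an open set. *)
Lemma avoid_hyperplanes (s : seq ('rV[R]_n * R)) (A : set 'rV[R]_n) :
  open A -> A !=set0 -> (forall h, h \in s -> h.1 != 0) ->
  exists x, A x /\ forall h, h \in s -> dotv x h.1 != h.2.
Proof.
elim: s A => [|[l c] s ih] A oA [x0 Ax0] hs; first by exists x0.
have l0 : l != 0 by apply: (hs (l, c)); rewrite mem_head.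
pose p x := dotv x l - c.
have pp : pol 1 p by exact: pol_affine.
have [x1 [Ax1 px1]] : exists x, A x /\ p x != 0.
  apply: contrapT => nx.
  have p0 : forall x, A x -> p x = 0.
    by move=> x Ax; apply/eqP/negPn/negP => px; apply: nx; exists x.
  have pT := pol_eq0 pp oA (ex_intro _ _ Ax0) p0.
  have := pT 0; have := pT l; rewrite /p dotv0l sub0r => h1 /eqP.
  rewrite oppr_eq0 => /eqP c0; move: h1; rewrite c0 subr0 => /dotv_eq0 lE.
  by rewrite lE eqxx in l0.
have oA' : open (A `&` [set x | p x != 0]).
  apply: openI => //.
  have := @open_comp _ _ p [set y | y != 0].
  by apply => [x _|]; [exact: pol_continuous pp x|exact: open_neq].
have [h hin|x [[Ax px] hx]] := ih _ oA' (ex_intro _ x1 (conj Ax1 px1)).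
  by apply: hs; rewrite inE hin orbT.
exists x; split => // h; rewrite inE => /predU1P[->|]; last exact: hx.
by rewrite /=; move: px; rewrite /= /p subr_eq0.
Qed.

Lemma normal_exists (z : seq 'rV[R]_n) : (size z < n)%N ->
  exists l : 'rV[R]_n, l != 0 /\ forall x, x \in z -> dotv x l = 0.
Proof.
move=> sz.
pose M : 'M[R]_(size z, n) := \matrix_(i < size z) nth 0 z i.
have : kermx M^T != 0.
  rewrite kermx_eq0 /row_free mxrank_tr; apply/eqP => h.
  by have := rank_leq_row M; rewrite h leqNgt sz.
move=> /rowV0Pn[l /sub_kermxP lM l0]; exists l; split => // x xz.
have := congr1 (fun N : 'rV[R]_(size z) => N 0 (Ordinal (introT idP (etrans (index_mem x z) xz)))) lM.
rewrite !mxE => h; rewrite -[RHS]h; apply: eq_bigr => i _.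
by rewrite !mxE nth_index// mulrC.
Qed.

End avoid.

Section segment.
Context {R : realType} {n : nat}.

Definition convex (U : set 'rV[R]_n) := forall x y t, U x -> U y -> 0 <= t <= 1 ->
  U (x + t *: (y - x)).

Lemma ball_convex (c : 'rV[R]_n) e : convex (ball c e).
Proof.
move=> x y t cx cy /andP[t0 t1].
have e0 : 0 < e by case: cx.
move: cx cy => /(ball_rVE _ _ e0) hx /(ball_rVE _ _ e0) hy; apply/(ball_rVE _ _ e0) => i.
have := hx i; have := hy i; rewrite !ltr_norml !mxE => /andP[? ?] /andP[? ?].
have [t1'|t1'] := ltP t 1.
  by apply/andP; split; nra.
have -> : t = 1 by apply/eqP; rewrite eq_le t1.
by apply/andP; split; lra.
Qed.

(** Otherwise the preimages of [A] and [B] would split the connected interval [[0, 1]] into two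
    nonempty closed parts. *)
Lemma segment_meet (A B : set 'rV[R]_n) x y : closed A -> closed B -> A x -> B y ->
  (forall t, 0 <= t <= 1 -> A (x + t *: (y - x)) \/ B (x + t *: (y - x))) ->
  exists t, [/\ 0 <= t <= 1, A (x + t *: (y - x)) & B (x + t *: (y - x))].
Proof.
move=> cA cB Ax By AB; pose f (t : R) := x + t *: (y - x).
have cf : continuous f.
  move=> t.
  have c1 := @cst_continuous R 'rV[R]_n x t.
  have c2 := @scalel_continuous R 'rV[R]_n (y - x) t.
  exact: continuousD c1 c2.
apply: contrapT => nAB.
have cl C : closed C -> closed (f @^-1` C).
  by move=> cC; apply: closed_comp => // t _; exact: cf.
have f0 : f 0 = x by rewrite /f scale0r addr0.
have f1 : f 1 = y by rewrite /f scale1r addrC subrK.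
have inAB t : t \in `[0, 1] -> A (f t) \/ B (f t).
  by rewrite in_itv /= => t01; exact: AB.
have nin t : t \in `[0, 1] -> A (f t) -> B (f t) -> False.
  by rewrite in_itv /= => t01 At Bt; apply: nAB; exists t.
have I0 : (0 : R) \in `[0, 1] by rewrite in_itv /= lexx ler01.
have I1 : (1 : R) \in `[0, 1] by rewrite in_itv /= lexx ler01.
have h := @segment_connected R 0 1 (`[0, 1]%classic `&` f @^-1` A).
have E : `[0, 1]%classic `&` f @^-1` A = `[0, 1]%classic.
  apply: h.
  - by exists 0; split => //=; rewrite f0.
  - exists (~` (f @^-1` B)); first by rewrite openC; exact: cl.
    apply/seteqP; split => t [It At]; split => //; first by move=> Bt; exact: nin It At Bt.
    by case: (inAB t It).
  - by exists (f @^-1` A) => //; exact: cl.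
have : (`[0, 1]%classic : set R) 1 by [].
by rewrite -E => -[_ A1]; apply: (nin 1) => //; rewrite f1.
Qed.

(** The affine span. With fewer than [n] points its dimension is at most [n - 2], so together with
    one more point it still lies in a hyperplane. *)
Definition flat (Z : seq 'rV[R]_n) : set 'rV[R]_n :=
  [set x | exists w : nat -> R, \sum_(i < size Z) w i = 1 /\
     x = \sum_(i < size Z) w i *: nth 0 Z i].

(* If z is outside A and y outside B, pick w in U off the finitely many
   hyperplanes through y or z that contain some [flat Z]: the segments from w to
   y and z then meet A and B together at y or z at most, so that w is neither in
   A nor in B. *)
Lemma convex_open_side (Zs : seq (seq 'rV[R]_n)) (A B U : set 'rV[R]_n) :
  closed A -> closed B -> convex U -> open U -> U `<=` A `|` B ->
  (forall Z, Z \in Zs -> (size Z < n)%N) ->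
  (forall x, A x -> B x -> exists2 Z, Z \in Zs & flat Z x) ->
  U `<=` A \/ U `<=` B.
Proof.
move=> cA cB cU oU UAB szZ ABZ.
apply: contrapT => /not_orP[/existsNP[z /not_implyP[Uz nAz]] /existsNP[y /not_implyP[Uy nBy]]].
have Ay : A y by case: (UAB _ Uy).
have Bz : B z by case: (UAB _ Uz).
have /choice[l hl] : forall p : seq 'rV[R]_n * 'rV[R]_n, exists l : 'rV[R]_n,
    (size p.1 < n)%N -> l != 0 /\ forall x, x \in p.1 -> dotv (x - p.2) l = 0.
  move=> [Z u]; have [sZ|_] := boolP (size Z < n)%N; last by exists 0.
  have [|l [l0 h]] := @normal_exists R n [seq x - u | x <- Z]; first by rewrite size_map.
  by exists l => _; split => // x xZ; apply: h; exact: map_f.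
have [h|w [Uw hw]] := @avoid_hyperplanes R n
    [seq (l (Z, u), dotv u (l (Z, u))) | Z <- Zs, u <- [:: y; z]] U oU (ex_intro _ _ Uz).
  by move=> /allpairsP[[Z u] /= [ZZs _ ->]] /=; have [] := hl (Z, u) (szZ _ ZZs).
(* [w] avoids the hyperplane through [u] and [flat Z]; a segment issued from [u] that met [flat Z]
   at a parameter other than 0 would lie in it entirely. *)
have nomeet u t : u \in [:: y; z] -> A (u + t *: (w - u)) -> B (u + t *: (w - u)) -> t = 0.
  move=> uyz h1 h2; have [Z ZZs [c [c1 cE]]] := ABZ _ h1 h2.
  have [l0 lZ] := hl (Z, u) (szZ _ ZZs).
  have : dotv (u + t *: (w - u) - u) (l (Z, u)) = 0.
    rewrite cE -[u in _ - u]scale1r -c1 scaler_suml -sumrB dotv_suml big1// => i _.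
    by rewrite -scalerBr dotvZl lZ ?mulr0// mem_nth.
  rewrite addrC addKr dotvZl => /eqP; rewrite mulf_eq0 => /predU1P[//|/eqP].
  rewrite dotvBl => /eqP; rewrite subr_eq0 => /eqP E.
  have := hw (l (Z, u), dotv u (l (Z, u))); rewrite E eqxx => H.
  have : false by apply: H; apply/allpairsP; exists (Z, u).
  by [].
have seg u v t : U u -> U v -> 0 <= t <= 1 -> A (u + t *: (v - u)) \/ B (u + t *: (v - u)).
  by move=> Uu Uv t01; apply: UAB; exact: cU.
have [Aw|Bw] := UAB _ Uw; last first.
  have [t [t01 h1 h2]] := segment_meet cA cB Ay Bw (fun t => @seg y w t Uy Uw).
  have t0 := nomeet y t (mem_head _ _) h1 h2.
  by apply: nBy; rewrite t0 scale0r addr0 in h2.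
have [t [t01 h1 h2]] := segment_meet cB cA Bz Aw 
  (fun t t01 => proj1 (or_comm _ _) (seg z w t Uz Uw t01)).
have t0 := nomeet z t _ h2 h1.
by apply: nAz; rewrite t0 ?scale0r ?addr0 ?inE ?eqxx ?orbT in h2.
Qed.

Lemma flat_thin (Zs : seq (seq 'rV[R]_n)) (A : set 'rV[R]_n) :
  open A -> A !=set0 -> (forall Z, Z \in Zs -> (size Z < n)%N) ->
  exists2 x, A x & forall Z, Z \in Zs -> ~ flat Z x.
Proof.
move=> oA A0 szZ.
have /choice[l hl] : forall Z : seq 'rV[R]_n, exists l : 'rV[R]_n * R,
    (size Z < n)%N -> l.1 != 0 /\ forall x, flat Z x -> dotv x l.1 = l.2.
  move=> Z; have [sZ|_] := boolP (size Z < n)%N; last by exists (0, 0).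
  have [|l [l0 h]] := @normal_exists R n [seq x - nth 0 Z 0 | x <- Z]; first by rewrite size_map.
  exists (l, dotv (nth 0 Z 0) l) => _; split => // x [w [w1 ->]] /=.
  apply/eqP; rewrite -subr_eq0 -dotvBl; apply/eqP.
  rewrite -[X in _ - X]scale1r -w1 scaler_suml -sumrB dotv_suml big1// => i _.
  by rewrite -scalerBr dotvZl h ?mulr0//; apply/map_f/mem_nth.
have [h|x [Ax hx]] := @avoid_hyperplanes R n [seq l Z | Z <- Zs] A oA A0.
  by move=> /mapP[Z ZZs ->]; have [] := hl Z (szZ _ ZZs).
exists x => // Z ZZs /(proj2 (hl Z (szZ _ ZZs))) E.
by have := hx (l Z) (map_f _ ZZs); rewrite E eqxx.
Qed.

End segment.

(** * Neighbouring cells and boundary faces *)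

Section mesh_topology.
Context {R : realType} {d : nat} {T : mesh R d.+1} {Omega : set 'rV[R]_d.+1}.
Local Notation V := 'I_(nvert T).
Hypotheses (oO : open Omega) (cO : connected Omega) (O0 : Omega !=set0)
  (bO : bounded_set Omega).
Hypothesis partT : partition_of T Omega.

Lemma partition_nd (K : {set V}) : K \in cells T -> nondegenerate K.
Proof. by case: partT => h _ _; exact: h. Qed.
Local Notation nd K := (cell_nd partition_nd K).

Lemma partition_hullI (K L : cell T) : hull (val K) `&` hull (val L) = hull (val K :&: val L).
Proof. by case: partT => _ h _; apply: h; exact: valP. Qed.

Lemma partition_closure x : closure Omega x <-> exists K : cell T, hull (val K) x.
Proof.
case: partT => _ _ ->; split=> [[K /= KT Kx]|[K Kx]]; first by exists (Sub K KT).
by exists (val K) => //=; exact: valP.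
Qed.

Lemma subOmega x : Omega x -> exists K : cell T, hull (val K) x.
Proof. by move=> /subset_closure /partition_closure. Qed.

Definition cells_of (P : pred (cell T)) : set 'rV[R]_d.+1 :=
  [set x | exists2 K, P K & hull (val K) x].

Lemma closed_cells_of P : closed (cells_of P).
Proof.
have -> : cells_of P = \bigcup_(K in [set K | P K]) hull (val K) by [].
apply: closed_bigcup; first exact: finite_finset.
by move=> K _; exact: closed_hull (nd K).
Qed.

Definition zset (Z : {set V}) : seq 'rV[R]_d.+1 := [seq vert v | v <- enum Z].

Lemma hull_flat (Z : {set V}) x : hull Z x -> flat (zset Z) x.
Proof.
move=> [w [w0 w1 ->]]; case: (set_0Vmem Z) => [Z0|[v0 _]].
  by move: w1; rewrite Z0 big_set0 => /eqP; rewrite eq_sym oner_eq0.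
exists (fun i => w (nth v0 (enum Z) i)); rewrite size_map; split.
  by apply: etrans w1; rewrite -[RHS]big_enum [RHS](big_nth v0) big_mkord.
rewrite -[LHS]big_enum [LHS](big_nth v0) big_mkord; apply: eq_bigr => i _.
by rewrite (nth_map v0).
Qed.

(** The cells cover the closure of [Omega] rather than [Omega]; but an open set that meets the
    closure meets [Omega] itself. *)
Lemma open_hull_Omega (K : cell T) : exists x, Omega x /\ open_hull (val K) x.
Proof.
have [x0 hx0] := open_hull_nonempty (nd K).
have cx0 : closure Omega x0 by apply/partition_closure; exists K; exact: open_hull_sub (nd K) _ hx0.
have /cx0[x [Ox hx]] := open_nbhs_nbhs (conj (@open_open_hull _ _ _ (val K)) hx0).
by exists x.
Qed.

Lemma exists_cell : exists K : cell T, True.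
Proof. by have [x /subOmega[K _]] := O0; exists K. Qed.

Lemma shared_face (K L : cell T) : K != L -> (d < #|val K :&: val L|)%N ->
  exists e : face T, [/\ val e = val K :&: val L, incident K e & incident L e].
Proof.
move=> KL dKL.
have cE : #|val K :&: val L| = d.+1.
  apply/eqP; rewrite eqn_leq dKL andbT leqNgt; apply: contra KL => h.
  have cK (M : cell T) : (#|val M| <= #|val K :&: val L|)%N by rewrite (proj1 (nd M)).
  have h1 : val K :&: val L == val K by rewrite eqEcard subsetIl cK.
  have h2 : val K :&: val L == val L by rewrite eqEcard subsetIr cK.
  by apply/eqP/val_inj; rewrite -(eqP h1) {1}(eqP h2).
have eF : val K :&: val L \in faces T.
  by rewrite inE cE eqxx; apply/existsP; exists (val K); rewrite (valP K) subsetIl.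
by exists (Sub (val K :&: val L) eF); split; rewrite ?SubK// /incident SubK ?subsetIl ?subsetIr.
Qed.

(** Cells with [P] and cells without it cannot share a face, so they meet along simplices with at
    most [d] vertices, of codimension at least two. These do not separate small balls, so the
    interiors of the two unions are disjoint and cover the connected set [Omega]. *)
Lemma face_connected (P : pred (cell T)) :
  (forall (K L : cell T) (e : face T), incident K e -> incident L e -> P K -> P L) ->
  forall K L, P K -> P L.
Proof.
move=> hP K0 L0 PK0; apply: contrapT => /negP nPL0.
pose A := cells_of P; pose B := cells_of (predC P).
pose Zs := [seq zset (val KL.1 :&: val KL.2) |
  KL <- enum [pred KL : cell T * cell T | P KL.1 && ~~ P KL.2]].
have szZ Z : Z \in Zs -> (size Z < d.+1)%N.
  move=> /mapP[[K L]]; rewrite mem_enum inE /= => /andP[PK nPL] ->.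
  rewrite size_map -cardE ltnS leqNgt; apply/negP => h.
  have [|e [_ Ke Le]] := shared_face _ h; first by apply: contraNneq nPL => <-.
  by move/negP : nPL; apply; exact: hP Ke Le PK.
have ABZ x : A x -> B x -> exists2 Z, Z \in Zs & flat Z x.
  move=> [K PK Kx] [L nPL Lx]; exists (zset (val K :&: val L)).
    by apply/mapP; exists (K, L) => //; rewrite mem_enum inE /= PK.
  by apply: hull_flat; rewrite -partition_hullI.
have OAB x : Omega x -> A x \/ B x.
  move=> /subOmega[K Kx]; have [PK|PK] := boolP (P K); [left|right]; by exists K.
have cA : closed A by exact: closed_cells_of.
have cB : closed B by exact: closed_cells_of.
have loc x : Omega x -> A° x \/ B° x.
  move=> Ox; have /nbhs_ballP[e /= e0 eO] := open_nbhs_nbhs (conj oO Ox).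
  have xb : nbhs x (ball x e) by exact: nbhsx_ballx.
  have [||h|h] := @convex_open_side _ _ Zs A B (ball x e) cA cB (@ball_convex _ _ x e) _ _ szZ ABZ.
  - exact: ball_open.
  - by move=> y /eO /OAB.
  - by left; apply: filterS xb.
  - by right; apply: filterS xb.
(* A common interior point would put a nonempty open set inside finitely many flats. *)
have nAB x : A° x -> B° x -> False.
  move=> Ax Bx; have [||y [Ay By] hy] := @flat_thin _ _ Zs (A° `&` B°) _ _ szZ.
  - by apply: openI; exact: open_interior.
  - by exists x.
  have [Z ZZs fZ] := ABZ y (interior_subset Ay) (interior_subset By).
  exact: hy ZZs fZ.
have intP (Q : pred (cell T)) K : Q K -> exists2 x, Omega x & (cells_of Q)° x.
  move=> QK; have [x [Ox hx]] := open_hull_Omega K; exists x => //.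
  apply: (@filterS _ _ _ (open_hull (val K))); last exact: open_nbhs_nbhs (conj (@open_open_hull _ _ _ (val K)) hx).
  by move=> y hy; exists K => //; exact: open_hull_sub (nd K) _ hy.
have E : Omega `&` A° = Omega.
  apply: cO.
  - by have [x Ox Ax] := intP P K0 PK0; exists x.
  - by exists (A°) => //; exact: open_interior.
  - exists (~` B°); first by apply: open_closedC; exact: open_interior.
    apply/seteqP; split => x [Ox hx]; split => //; first by move=> /(nAB _ hx).
    by case: (loc x Ox).
have [x Ox Bx] := intP (predC P) L0 nPL0.
by move: Ox; rewrite -E => -[_ Ax]; exact: nAB Ax Bx.
Qed.

Lemma partition_unbounded : exists x, ~ closure Omega x.
Proof.
have /choice[M hM] : forall K : cell T, exists M : R, forall x, hull (val K) x -> `|x| <= M.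
  move=> K; have [M [_ hM]] := bounded_hull (val K); exists (`|M| + 1).
  by move=> x; apply: hM; rewrite ltr_pwDr// ler_norm.
exists (const_mx (\sum_K `|M K| + 1)) => /partition_closure[K /hM].
have := ler_coord_norm (const_mx (\sum_K `|M K| + 1) : 'rV[R]_d.+1) 0; rewrite mxE => h1 h2.
have := le_trans h1 h2; rewrite ger0_norm; last by rewrite addr_ge0// sumr_ge0.
apply/negP; rewrite -ltNge; apply: (@le_lt_trans _ _ (\sum_K `|M K|)); last by rewrite ltrDl.
by rewrite (bigD1 K)//= (le_trans (ler_norm _))// lerDl sumr_ge0.
Qed.

Section inner_face.
Variables (K : cell T) (e : face T) (a : V) (x : 'rV[R]_d.+1).
Hypotheses (Ke : incident K e) (aK : a \in val K) (eE : val e = val K :\ a).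
Hypotheses (xe : facedom e x) (xpos : forall v, v \in val e -> 0 < bary (val K) v x)
  (ne : ~ facedom e `<=` boundary Omega).

Let eK : val e \subset val K := Ke.

Let hull_eE y : facedom e y <-> hull (val K) y /\ bary (val K) a y = 0.
Proof.
rewrite /facedom (hull_subE (nd K) eK) /=; split=> -[h1 h2]; split => //.
  by apply: h2; rewrite !inE eE !inE eqxx.
by move=> v; rewrite !inE eE !inE negb_and negbK => /andP[/orP[/eqP ->|/negPf ->]].
Qed.

(** A point of the face off the boundary lies in [Omega], but possibly on a lower-dimensional
    subface; a small move towards [x], whose weights on [e] are positive, makes all weights positive
    without leaving [Omega]. *)
Lemma inner_face_point : exists y, Omega y /\
  [/\ bary (val K) a y = 0 & forall v, v \in val e -> 0 < bary (val K) v y].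
Proof.
move/existsNP : ne => [y /not_implyP[ey nby]].
have /hull_eE[Ky ya] := ey; have /hull_eE[Kx xa] := xe.
have Oy : Omega y.
  apply: contrapT => nO; apply: nby; split.
    by apply/partition_closure; exists K.
  by move: nO; rewrite -[X in ~ X y](interior_id _).1.
have [t t01 Ot] : exists2 t, 0 < t <= 1 & Omega (y + t *: (x - y)).
  have /nbhs_ballP[r /= r0 rO] := open_nbhs_nbhs (conj oO Oy).
  have d0 : 0 < `|x - y| + r by rewrite ltr_wpDl.
  exists (r / (`|x - y| + r + 1)).
    have h : 0 < `|x - y| + r + 1 by rewrite ltr_wpDl// ltW.
    by rewrite divr_gt0//= ler_pdivrMr// mul1r -addrA; have := normr_ge0 (x - y); lra.
  apply: rO; rewrite mx_norm_ball /ball_ /= opprD addrA subrr add0r normrN normrZ.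
  have h : 0 < `|x - y| + r + 1 by rewrite ltr_wpDl// ltW.
  rewrite ger0_norm ?divr_ge0 ?(ltW r0) ?(ltW h)// mulrAC ltr_pdivrMr// ltr_pM2l//.
  by lra.
exists (y + t *: (x - y)); split => //.
have bE v : v \in val K -> bary (val K) v (y + t *: (x - y)) =
    (1 - t) * bary (val K) v y + t * bary (val K) v x.
  move=> vK; rewrite (bary_line (nd K))// dotvBl.
  by rewrite (baryE (nd K) x vK) (baryE (nd K) y vK); ring.
have /andP[t0 t1] := t01.
split; first by rewrite bE// ya xa; ring.
move=> v ve; have vK := fintype.subsetP eK v ve.
rewrite bE// ltr_wpDl ?mulr_gt0 ?xpos// mulr_ge0 ?subr_ge0//.
by move: Ky; rewrite (hullE (nd K)); exact.
Qed.

(** An affine function is determined by its values at the vertices of [L], and the coordinate of [a]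
    vanishes at those of the common face, which leaves only [b]. *)
Lemma bary_neighbour (L : cell T) b z : val e \subset val L -> b \in val L ->
  val e = val L :\ b -> bary (val K) a z = bary (val L) b z * bary (val K) a (vert b).
Proof.
move=> eL bL eLE.
have -> : bary (val K) a z = \sum_(v in val L) bary (val L) v z * bary (val K) a (vert v).
  rewrite (baryE (nd K) z aK) -{1}(bary_comb (nd L) z) dotv_suml.
  rewrite -[bary (val K) a 0]mul1r -{1}(bary_sum (nd L) z) mulr_suml -big_split/=.
  by apply: eq_bigr => v vL; rewrite dotvZl (baryE (nd K) (vert v) aK) mulrDr.
rewrite (bigD1 b)//= big1 ?addr0// => v /andP[vL vb].
have ve : v \in val e by rewrite eLE !inE vb.
have vK := fintype.subsetP eK v ve.
rewrite (bary_vert (nd K))// (_ : a == v = false) ?mulr0//.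
by apply/negbTE; move: ve; rewrite eE !inE eq_sym => /andP[].
Qed.

(** A point of the face in [Omega] is pushed slightly away from [a]. It stays in [Omega], hence in
    some cell; conformity keeps it off the other cells that do not contain [e], and its negative
    coordinate keeps it off [K]. *)
Lemma inner_face_neighbour : exists (L : cell T) (b : V),
  [/\ val e \subset val L, b \in val L, val e = val L :\ b & bary (val K) a (vert b) < 0].
Proof.
have [y [Oy [ya ypos]]] := inner_face_point.
have Ky : hull (val K) y.
  rewrite (hullE (nd K)) => v vK; have [->|va] := eqVneq v a; first by rewrite ya.
  by apply/ltW/ypos; rewrite eE !inE va.
pose C := cells_of (fun L => (L != K) && ~~ (val e \subset val L)).
(* Conformity: at a common point of [K] and [L], the weight of a vertex of [e] missing from [L]
   would be 0, against the choice of [y]. *)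
have nCy : ~ C y.
  move=> [L /andP[LK /subsetPn[v ve vL]] Ly].
  have : (hull (val K) `&` hull (val L)) y by split.
  rewrite partition_hullI (hull_subE (nd K)) ?subsetIl// => -[_ /(_ v)].
  rewrite !inE (negPf vL) andbF (fintype.subsetP eK)//= => /(_ isT) h.
  by have := ypos v ve; rewrite h ltxx.
have oU : open (Omega `&` ~` C) by apply: openI => //; rewrite openC; exact: closed_cells_of.
have /nbhs_ballP[r /= r0 rU] := open_nbhs_nbhs (conj oU (conj Oy nCy)).
have /hull_eE[Kx xa] := xe.
pose u := vert a - x; have u1 : 0 < `|u| + 1 by rewrite ltr_wpDl.
pose s := r / (`|u| + 1); have s0 : 0 < s by rewrite divr_gt0.
pose z := y + (- s) *: u.
have [Oz nCz] : (Omega `&` ~` C) z.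
  apply: rU; rewrite mx_norm_ball /ball_ /= opprD addrA subrr add0r normrN normrZ normrN.
  by rewrite gtr0_norm// /s mulrAC ltr_pdivrMr// ltr_pM2l// ltrDl.
have za : bary (val K) a z < 0.
  rewrite /z (bary_line (nd K))// ya add0r /u dotvBl.
  have := baryE (nd K) (vert a) aK; have := baryE (nd K) x aK.
  rewrite xa (bary_vert (nd K))// eqxx mulr1n => h1 h2.
  have -> : dotv (vert a) (bgrad (val K) a) - dotv x (bgrad (val K) a) = 1 by lra.
  by rewrite mulr1 oppr_lt0.
have [L Lz] := subOmega Oz.
have LK : L != K.
  apply/eqP => LK; move: Lz; rewrite LK (hullE (nd K)) => /(_ a aK).
  by rewrite leNgt za.
have eL : val e \subset val L.
  by apply: contrapT => /negP neL; apply: nCz; exists L => //; rewrite LK.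
have [b [bL eLE]] := face_apex partition_nd eL.
exists L, b; split => //.
have b0 : 0 <= bary (val L) b z by move: Lz; rewrite (hullE (nd L)); exact.
by move: za; rewrite (bary_neighbour z eL bL eLE); apply: contraTlt => h; rewrite -leNgt mulr_ge0.
Qed.

(** [K] and its neighbour [L] together fill a neighbourhood of [x]: the sign of the coordinate of
    [a] decides in which of the two a nearby point lies. *)
Lemma inner_face_interior : ~ closure (~` closure Omega) x.
Proof.
have [L [b [eL bL eLE bneg]]] := inner_face_neighbour.
have /hull_eE[Kx xa] := xe.
have xL v : v \in val e -> bary (val L) v x = bary (val K) v x.
  move=> ve; pose w u := if u \in val e then bary (val K) u x else 0.
  have sumE (W : nmodType) (M : cell T) (c : V) (f : V -> W) : c \in val M ->
      val e = val M :\ c -> f c = 0 -> \sum_(u in val M) f u = \sum_(u in val e) f u.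
    move=> cM eM fc; rewrite (bigD1 c)//= fc add0r; apply: eq_bigl => u.
    by rewrite eM !inE andbC.
  rewrite (@bary_unique _ _ _ _ (nd L) x w) ?(fintype.subsetP eL)//.
  - by rewrite /w ve.
  - rewrite (sumE _ L b)//; last by rewrite /w eLE !inE eqxx.
    rewrite -[RHS](bary_sum (nd K) x) (sumE _ K a)//.
    by apply: eq_bigr => u ue; rewrite /w ue.
  - rewrite (sumE _ L b)//; last by rewrite /w eLE !inE eqxx scale0r.
    rewrite -[RHS](bary_comb (nd K) x) (sumE _ K a) ?xa ?scale0r//.
    by apply: eq_bigr => u ue; rewrite /w ue.
pose U := [set z | forall v, v \in val e -> 0 < bary (val K) v z] `&`
          [set z | forall v, v \in val e -> 0 < bary (val L) v z].
have oU : open U by apply: openI; exact: open_bary_pos.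
have Ux : U x by split => v ve /=; rewrite ?xL// xpos.
move=> /(_ U (open_nbhs_nbhs (conj oU Ux)))[z [nOz [zK zL]]]; apply: nOz.
apply/partition_closure; have [za|za] := leP 0 (bary (val K) a z).
  exists K; rewrite (hullE (nd K)) => v vK; have [->//|va] := eqVneq v a.
  by apply/ltW/zK; rewrite eE !inE va.
exists L; rewrite (hullE (nd L)) => v vL; have [->|vb] := eqVneq v b.
  rewrite leNgt; apply/negP => zb; move: za.
  by rewrite (bary_neighbour z eL bL eLE); apply/negP; rewrite -leNgt nmulr_lge0// ltW.
by apply/ltW/zL; rewrite eLE !inE vb.
Qed.

End inner_face.

(* Otherwise [closure Omega] and the closure of its complement meet only along
   simplices of codimension at least 2, which cannot separate the space. *)
Theorem exists_boundary_face :
  exists (K : cell T) (e : face T), incident K e /\ facedom e `<=` boundary Omega.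
Proof.
apply: contrapT => nb.
have nbd (K : cell T) (e : face T) : incident K e -> ~ facedom e `<=` boundary Omega.
  by move=> Ke eb; apply: nb; exists K, e.
pose A := closure Omega; pose B := closure (~` A).
pose Zs := [seq zset Z | Z <- enum [pred Z : {set V} | (#|Z| < d.+1)%N]].
have szZ Z : Z \in Zs -> (size Z < d.+1)%N.
  by move=> /mapP[S]; rewrite mem_enum inE => SZ ->; rewrite size_map -cardE.
have ABZ x : A x -> B x -> exists2 Z, Z \in Zs & flat Z x.
  move=> /[dup] Ax /partition_closure[K Kx] Bx.
  (* [N] spans the smallest subsimplex containing [x]. With at most [d] vertices it gives one of the
     listed flats; if it is all of [K], then [x] is interior; otherwise it is a face, to which
     [inner_face_interior] applies. *)
  pose N := [set v in val K | 0 < bary (val K) v x].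
  have NK : N \subset val K by apply/fintype.subsetP => v; rewrite inE => /andP[].
  have Nx : hull N x.
    rewrite (hull_subE (nd K) NK); split => // v; rewrite !inE negb_and => /andP[+ vK].
    rewrite vK /= -leNgt => h; apply/eqP; rewrite eq_le h.
    by move: Kx; rewrite (hullE (nd K)); exact.
  have [sN|] := boolP (#|N| < d.+1)%N.
    exists (zset N); last exact: hull_flat.
    by apply/mapP; exists N => //; rewrite mem_enum.
  rewrite -leqNgt => dN; exfalso.
  have [NE|NneK] := eqVneq N (val K).
    have Ox : open_hull (val K) x by move=> v; rewrite -{1}NE inE => /andP[].
    have := Bx _ (open_nbhs_nbhs (conj (@open_open_hull _ _ _ (val K)) Ox)).
    move=> [z [nAz hz]]; apply: nAz; apply/partition_closure; exists K.
    exact: open_hull_sub (nd K) _ hz.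
  have cN : #|N| = d.+1.
    apply/eqP; rewrite eqn_leq dN andbT -ltnS -(proj1 (nd K)).
    by rewrite proper_card// finset.properEneq NneK.
  have NF : N \in faces T.
    by rewrite inE cN eqxx; apply/existsP; exists (val K); rewrite (valP K).
  pose e : face T := Sub N NF.
  have Ke : incident K e by rewrite /incident SubK.
  have [a [aK eE]] := face_apex partition_nd Ke.
  apply: (inner_face_interior Ke aK eE _ _ (nbd K e Ke)) Bx.
    by rewrite /facedom SubK.
  by move=> v; rewrite SubK inE => /andP[].
have cT : convex [set: 'rV[R]_d.+1] by [].
have AB : [set: 'rV[R]_d.+1] `<=` A `|` B.
  by move=> x _; have [Ax|Ax] := pselect (A x); [left|right; exact: subset_closure].
have [U|U] := convex_open_side (@closed_closure _ _) (@closed_closure _ _) cT openT AB szZ ABZ.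
  by have [x nx] := partition_unbounded; apply: nx; exact: U.
have [K _] := exists_cell; have [x [Ox hx]] := open_hull_Omega K.
have := U x I _ (open_nbhs_nbhs (conj (@open_open_hull _ _ _ (val K)) hx)).
move=> [z [nAz hz]]; apply: nAz; apply/partition_closure; exists K.
exact: open_hull_sub (nd K) _ hz.
Qed.

End mesh_topology.

(** * Weak operators *)

Section polon.
Context {R : realType} {n : nat}.
Implicit Types (D : set 'rV[R]_n) (g h : 'rV[R]_n -> R).

(** The degree is forgotten and nothing is required off [D]: the property survives products such as
    [u_i kap_j], which leave the finite element spaces, and it suffices for the linearity of
    integrals. *)
Definition polon D g : Prop := exists j p, pol j p /\ forall x, D x -> g x = p x.

Lemma pol_polon D j g : pol j g -> polon D g.
Proof. by exists j, g. Qed.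

Lemma polon_ext D g h : (forall x, D x -> g x = h x) -> polon D g -> polon D h.
Proof. by move=> gh [j [p [pp gp]]]; exists j, p; split=> // x Dx; rewrite -gh// gp. Qed.

Lemma polon_cst D c : polon D (fun=> c).
Proof. by apply: (@pol_polon _ 0%N); exact: pol_cst. Qed.

Lemma polonD D g h : polon D g -> polon D h -> polon D (fun x => g x + h x).
Proof.
move=> [i [p [pp gp]]] [j [q [pq hq]]]; exists (maxn i j), (fun x => p x + q x); split.
  by apply: polD; [apply: pol_le pp; exact: leq_maxl|apply: pol_le pq; exact: leq_maxr].
by move=> x Dx; rewrite gp// hq.
Qed.

Lemma polonM D g h : polon D g -> polon D h -> polon D (fun x => g x * h x).
Proof.
move=> [i [p [pp gp]]] [j [q [pq hq]]]; exists (i + j)%N, (fun x => p x * q x); split.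
  exact: polM.
by move=> x Dx; rewrite gp// hq.
Qed.

Lemma polonZ D c g : polon D g -> polon D (fun x => c * g x).
Proof. by apply: polonM; exact: polon_cst. Qed.

Lemma polonN D g : polon D g -> polon D (fun x => - g x).
Proof. by move=> /(polonZ (-1)); apply: polon_ext => x _; rewrite mulN1r. Qed.

Lemma polon_sum D (I : Type) (s : seq I) (P : pred I) (g : I -> 'rV[R]_n -> R) :
  (forall i, polon D (g i)) -> polon D (fun x => \sum_(i <- s | P i) g i x).
Proof.
move=> pg; elim: s => [|i s ih].
  by apply: polon_ext (polon_cst D 0) => x _; rewrite big_nil.
apply: polon_ext (_ : polon D (fun x => (if P i then g i x else 0) +
    \sum_(i <- s | P i) g i x)) => [x _|].
  by rewrite big_cons; case: (P i); rewrite ?add0r.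
by apply: polonD => //; case: (P i); [exact: pg|exact: polon_cst].
Qed.

Lemma polon_exp D k g : polon D g -> polon D (fun x => g x ^+ k).
Proof.
move=> pg; elim: k => [|k ih]; first exact: polon_cst.
by apply: polon_ext (polonM pg ih) => x _; rewrite exprS.
Qed.

Lemma PolP D j g : Pol j D g <->
  (exists2 p, pol j p & forall x, D x -> g x = p x) /\ forall x, ~ D x -> g x = 0.
Proof.
split=> [[p /= /polyfunP pp <-]|[[p pp gp] g0]].
  split; first by exists p => // x Dx; rewrite patchE mem_set.
  by move=> x Dx; rewrite patchE memNset.
exists p; first exact/polyfunP.
apply/funext => x; rewrite patchE; case: ifPn => [/set_mem/gp //|].
by rewrite notin_setE => /g0.
Qed.

Lemma Pol_polon D j g : Pol j D g -> polon D g.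
Proof. by move=> /PolP[[p pp gp] _]; exists j, p. Qed.

Lemma Pol_lin D j a g h : Pol j D g -> Pol j D h -> Pol j D (fun x => a * g x + h x).
Proof.
move=> /PolP[[p pp gp] g0] /PolP[[q pq hq] h0]; apply/PolP; split.
  exists (fun x => a * p x + q x); first by apply: polD => //; exact: polZ.
  by move=> x Dx; rewrite gp// hq.
by move=> x Dx; rewrite g0// h0// mulr0 addr0.
Qed.

Lemma Pol0 D j : Pol j D (fun=> 0).
Proof. by apply/PolP; split=> //; exists (fun=> 0) => //; exact: pol_cst. Qed.

Lemma Pol_patch D j p : pol j p -> Pol j D (p \_ D).
Proof. by move=> /polyfunP pp; exists p. Qed.

Lemma Pol_inj D j i g h : Pol j D g -> Pol i D h -> (forall x, D x -> g x = h x) -> g = h.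
Proof.
move=> /PolP[_ g0] /PolP[_ h0] gh; apply/funext => x.
by have [Dx|Dx] := pselect (D x); [exact: gh|rewrite g0// h0].
Qed.

End polon.

(* The properties shared by the volume integral over a cell and the surface
   integral over a face that the Riesz representation of [projB], [wgrad] and
   [wdiv] depends on. *)
Record poly_integral {R : realType} {n} (D : set 'rV[R]_n) (I : ('rV[R]_n -> R) -> R) : Prop :=
  PolyIntegral {
  pint_ext : forall g h, (forall x, D x -> g x = h x) -> I g = I h ;
  pint_lin : forall a g h, polon D g -> polon D h ->
    I (fun x => a * g x + h x) = a * I g + I h ;
  pint_sqr_ge0 : forall g, polon D g -> 0 <= I (fun x => g x ^+ 2) ;
  pint_sqr_eq0 : forall g, polon D g -> I (fun x => g x ^+ 2) = 0 ->
    forall x, D x -> g x = 0 }.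

Section poly_integral_theory.
Context {R : realType} {n : nat}.
Variables (D : set 'rV[R]_n) (I : ('rV[R]_n -> R) -> R).
Hypothesis DI : poly_integral D I.
Implicit Types (g h : 'rV[R]_n -> R).

Lemma pint0 : I (fun=> 0) = 0.
Proof.
have := pint_lin DI (-1) (polon_cst D 0) (polon_cst D 0).
rewrite [X in _ = X](_ : _ = 0); last by rewrite mulN1r addNr.
by apply: etrans; apply: (pint_ext DI) => x _; rewrite mulr0 addr0.
Qed.

Lemma pintZ a g : polon D g -> I (fun x => a * g x) = a * I g.
Proof.
move=> pg; rewrite -[RHS]addr0 -pint0 -(pint_lin DI)//; last exact: polon_cst.
by apply: (pint_ext DI) => x _; rewrite addr0.
Qed.

Lemma pintD g h : polon D g -> polon D h -> I (fun x => g x + h x) = I g + I h.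
Proof.
move=> pg ph; rewrite -[I g]mul1r -(pint_lin DI)//.
by apply: (pint_ext DI) => x _; rewrite mul1r.
Qed.

Lemma pint_sum (J : Type) (s : seq J) (P : pred J) (g : J -> 'rV[R]_n -> R) :
  (forall i, polon D (g i)) ->
  I (fun x => \sum_(i <- s | P i) g i x) = \sum_(i <- s | P i) I (g i).
Proof.
move=> pg; elim: s => [|i s ih].
  by rewrite big_nil -[RHS]pint0; apply: (pint_ext DI) => x _; rewrite big_nil.
rewrite big_cons -ih; case: ifPn => Pi.
  rewrite -pintD//; last exact: polon_sum.
  by apply: (pint_ext DI) => x _; rewrite big_cons Pi.
by apply: (pint_ext DI) => x _; rewrite big_cons (negPf Pi).
Qed.

Section riesz.
Variables (j : nat) (l : ('rV[R]_n -> R) -> R).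
Hypothesis l_ext : forall g h, (forall x, g x = h x) -> l g = l h.
Hypothesis l_lin : forall a g h, pol j g -> pol j h ->
  l (fun x => a * g x + h x) = a * l g + l h.
Hypothesis l_eq0 : forall g, pol j g -> (forall x, D x -> g x = 0) -> l g = 0.

Let J := {ffun 'I_n -> 'I_j.+1}.
Let mono (a : J) (x : 'rV[R]_n) : R :=
  if (\sum_i a i <= j)%N then \prod_i x 0 i ^+ a i else 0.

Let pol_mono a : pol j (mono a).
Proof.
rewrite /mono; have [aj|_] := boolP (\sum_i a i <= j)%N; last exact: pol_cst.
by apply: pol_le aj _; exact: pol_monomial.
Qed.

Let monoE g : pol j g -> exists c : J -> R, forall x, g x = \sum_a c a * mono a x.
Proof.
move=> /polyfunP[c gc]; exists c => x; rewrite gc big_mkcond/=.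
by apply: eq_bigr => a _; rewrite /mono; case: ifP => // _; rewrite mulr0.
Qed.

Let l_comb (c : J -> R) : l (fun x => \sum_a c a * mono a x) = \sum_a c a * l (mono a).
Proof.
have pm (s : seq J) : pol j (fun x => \sum_(a <- s) c a * mono a x).
  by apply: pol_sum => a _; exact: polZ.
elim: (index_enum _) => [|a s ih].
  rewrite big_nil; apply: l_eq0; first exact: pm.
  by move=> x _; rewrite big_nil.
rewrite big_cons -ih -l_lin//; apply: l_ext => x; by rewrite big_cons.
Qed.

Let I_comb (c : J -> R) h : polon D h ->
  I (fun x => (\sum_a c a * mono a x) * h x) = \sum_a c a * I (fun x => mono a x * h x).
Proof.
move=> ph; have pa a : polon D (fun x => mono a x * h x).
  by apply: polonM => //; exact: pol_polon (pol_mono a).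
transitivity (I (fun x => \sum_a c a * (mono a x * h x))).
  by apply: (pint_ext DI) => x _; rewrite mulr_suml; apply: eq_bigr => a _; rewrite mulrA.
by rewrite pint_sum => [|a]; [apply: eq_bigr => a _; rewrite pintZ|exact: polonZ].
Qed.

(** The functional has to vanish on polynomials that are zero on [D], as [l_eq0] states, because
    these give the null vectors of the Gram matrix of monomials when [D] is a face. *)
Lemma riesz_pol : exists G, Pol j D G /\
  forall s, polyfun j s -> I (fun x => G x * s x) = l s.
Proof.
have pc (c : J -> R) : pol j (fun x => \sum_a c a * mono a x).
  by apply: pol_sum => a _; exact: polZ.
have [c c0|x hx] := @semidefinite_solve _ J
    (fun a b => I (fun x => mono a x * mono b x)) (l \o mono).
  rewrite /= -l_comb; apply: l_eq0 (pc c) _; apply: (pint_sqr_eq0 DI).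
    exact: pol_polon (pc c).
  rewrite -[RHS]c0 (pint_ext DI (h := fun x => (\sum_a c a * mono a x) * (\sum_a c a * mono a x))) //.
  rewrite I_comb; last exact: pol_polon (pc c).
  apply: eq_bigr => a _; under [RHS]eq_bigr do rewrite -mulrA; rewrite -mulr_sumr; congr (_ * _).
  rewrite (pint_ext DI (h := fun x => (\sum_b c b * mono b x) * mono a x)); last first.
    by move=> x _; rewrite mulrC.
  rewrite I_comb; last exact: pol_polon (pol_mono a).
  apply: eq_bigr => b _; congr (_ * _); apply: (pint_ext DI) => x _; exact: mulrC.
exists ((fun z => \sum_a x a * mono a z) \_ D); split; first exact: Pol_patch.
move=> s /polyfunP ps; have [c sc] := monoE ps.
rewrite (pint_ext DI (h := fun z => (\sum_a c a * mono a z) * (\sum_a x a * mono a z))); last first.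
  by move=> z Dz; rewrite patchE mem_set// sc mulrC.
rewrite I_comb; last exact: pol_polon (pc x).
rewrite (l_ext sc) l_comb; apply: eq_bigr => a _; rewrite -[l _]hx -I_comb; last first.
  exact: pol_polon (pol_mono a).
by congr (_ * _); apply: (pint_ext DI) => z _; rewrite mulrC.
Qed.

End riesz.

(** Test functions are polynomials on the whole space while [G] and [H] are cut off outside [D]; the
    test is a polynomial that agrees with [G - H] on [D]. *)
Lemma riesz_pol_unique j G H : Pol j D G -> Pol j D H ->
  (forall s, polyfun j s -> I (fun x => G x * s x) = I (fun x => H x * s x)) -> G = H.
Proof.
move=> PG PH GH; apply: (Pol_inj PG PH) => x Dx; apply/subr0_eq.
have pGH : polon D (fun x => G x - H x).
  by apply: polonD; [exact: Pol_polon PG|apply: polonN; exact: Pol_polon PH].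
apply: (pint_sqr_eq0 DI pGH _ Dx).
move: (PG) (PH) => /PolP[[g pg Gg] _] /PolP[[h ph Hh] _].
have pgh : pol j (fun x => g x - h x) by exact: polB.
rewrite (pint_ext DI (h := fun x => (-1) * (H x * (g x - h x)) + G x * (g x - h x))); last first.
  by move=> y Dy; rewrite Gg// Hh//; ring.
rewrite (pint_lin DI).
- by rewrite GH ?mulN1r ?addNr//; exact/polyfunP.
- by apply: polonM; [exact: Pol_polon PH|exact: pol_polon pgh].
- by apply: polonM; [exact: Pol_polon PG|exact: pol_polon pgh].
Qed.

End poly_integral_theory.

(** * Cell and face integrals as definite forms on polynomials *)

Section mesh_integrals.
Context {R : realType} {d : nat} {T : mesh R d.+1}.
Local Notation V := 'I_(nvert T).
Hypothesis mesh_nd : forall K : {set V}, K \in cells T -> nondegenerate K.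
Local Notation nd K := (cell_nd mesh_nd K).

Lemma polon_bm_hull (K : cell T) g : polon (celldom K) g -> bm (celldom K) g.
Proof.
move=> [j [p [pp gp]]]; apply: (bm_ext (g := p)); first by move=> x Kx; rewrite gp.
exact: pol_bm_hull pp.
Qed.

Lemma cint_poly_integral (K : cell T) : poly_integral (celldom K) (cint K).
Proof.
split.
- by move=> g h gh; apply: eq_Rintegral => x; rewrite inE => /gh.
- move=> a g h pg ph; rewrite /cint.
  have ig := integrable_hull (nd K) (polon_bm_hull pg).
  have ih := integrable_hull (nd K) (polon_bm_hull ph).
  have mK := measurable_hull (nd K).
  rewrite RintegralD//; first by rewrite RintegralZl.
  by apply: integrable_hull (nd K) _ _; apply: bmZ; exact: polon_bm_hull.
- by move=> g _; apply: Rintegral_ge0 => x _; exact: sqr_ge0.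
- move=> g [j [p [pp gp]]] g0 x Kx; rewrite gp//.
  have [c [e [e0 ce]]] := hull_ball (nd K).
  have := integral_sqr_eq0 pp (measurable_hull (nd K)) (@bounded_hull _ _ T (val K)) e0 ce.
  apply; rewrite -[RHS]g0; apply: eq_Rintegral => y; rewrite inE => Ky; rewrite gp//.
Qed.

Lemma face_in_cell (e : face T) : exists K : cell T, incident K e.
Proof.
have := valP e; rewrite inE => /andP[_ /existsP[K /andP[KT eK]]].
by exists (Sub K KT); rewrite /incident SubK.
Qed.

(** [facedom] is described by weights and [fint] by a parametrization; the weights of a point are
    the [bweight] of its parameter. *)
Lemma facedomP (e : face T) x : facedom e x <->
  exists2 t : 'rV[R]_d, unit_simplex t & x = simplex_map (points (enum (val e))) t.
Proof.
have ce := card_face e.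
have /card_gt0P[v0 v0e] : (0 < #|val e|)%N by rewrite ce.
have se : size (enum (val e)) = d.+1 by rewrite -cardE.
have ue := enum_uniq (val e).
have me v : (v \in enum (val e)) = (v \in val e) by exact: mem_enum.
split=> [[w [w0 w1 xE]]|[t]].
  pose t : 'rV[R]_d := \row_i w (nth v0 (enum (val e)) i.+1).
  have tE i : bweight t i = w (nth v0 (enum (val e)) i).
    case: (unliftP ord0 i) => [j|] ->.
      by rewrite bweight_lift mxE lift0.
    rewrite bweight0 -w1 -(sum_seq_set _ ue me) (sum_seq_nth v0 _ se) big_ord_recl/=.
    rewrite [X in _ - X](eq_bigr (fun j : 'I_d => w (nth v0 (enum (val e)) (lift ord0 j)))).
      by rewrite addrK.
    by move=> j _; rewrite mxE lift0.
  exists t.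
    by rewrite unit_simplexE => i; rewrite tE; apply: w0; rewrite -me mem_nth// se.
  rewrite xE -(sum_seq_set _ ue me) (sum_points v0 _ se) simplex_mapE.
  by apply: eq_bigr => i _; rewrite tE.
rewrite unit_simplexE => t0 ->.
exists (fun v => bweight t (inord (index v (enum (val e))))); split=> [v _||].
- exact: t0.
- rewrite -(sum_seq_set _ ue me) (sum_seq_nth v0 _ se) -[RHS](sum_bweight t).
  by apply: eq_bigr => i _; rewrite index_uniq ?se// inord_val.
- rewrite -(sum_seq_set _ ue me) (sum_points v0 _ se) simplex_mapE.
  by apply: eq_bigr => i _; rewrite index_uniq ?se// inord_val.
Qed.

Lemma polon_bm_face (e : face T) g : polon (facedom e) g ->
  bm (@unit_simplex R d) (fun t => g (simplex_map (points (enum (val e))) t)).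
Proof.
move=> [j [p [pp gp]]].
apply: (bm_ext (g := fun t => p (simplex_map (points (enum (val e))) t))).
  by move=> t t0; rewrite gp//; apply/facedomP; exists t.
by apply: pol_bm; [exact: pol_comp_affine pp|exact: bounded_unit_simplex].
Qed.

Lemma gram_gt0 (e : face T) : 0 < Num.sqrt (\det (fedges e *m (fedges e)^T)).
Proof.
have [K Ke] := face_in_cell e; have [a [aK eE]] := face_apex mesh_nd Ke.
by have [h []] := face_flux mesh_nd aK eE 0.
Qed.

Lemma fint_poly_integral (e : face T) : poly_integral (facedom e) (fint e).
Proof.
have mS := @measurable_unit_simplex R d.
split.
- move=> g h gh; rewrite !fintE; congr (_ * _); apply: eq_Rintegral => t.
  by rewrite inE => t0; apply: gh; apply/facedomP; exists t.
- move=> a g h pg ph; rewrite !fintE /rint.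
  have ig := integrable_unit_simplex (polon_bm_face pg).
  have ih := integrable_unit_simplex (polon_bm_face ph).
  rewrite RintegralD//; first by rewrite RintegralZl//; ring.
  by apply: integrable_unit_simplex; apply: bmZ; exact: polon_bm_face.
- move=> g _; rewrite fintE mulr_ge0 ?sqrtr_ge0//.
  by apply: Rintegral_ge0 => x _; exact: sqr_ge0.
- move=> g [j [p [pp gp]]] /eqP; rewrite fintE mulf_eq0 (gt_eqF (gram_gt0 e)) /= => /eqP g0 x.
  move=> /facedomP[t t0 xE]; rewrite gp; last by apply/facedomP; exists t.
  rewrite xE; have [c [r [r0 cr]]] := @unit_simplex_interior R d.
  have pm : pol j (fun s : 'rV[R]_d => p (simplex_map (points (enum (val e))) s)).
    exact: pol_comp_affine pp.
  have := integral_sqr_eq0 pm mS (@bounded_unit_simplex R d) r0 cr.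
  apply; rewrite -[RHS]g0; apply: eq_Rintegral => s; rewrite inE => s0; rewrite gp//.
  by apply/facedomP; exists s.
Qed.

Lemma pol_eq0_cell (K : cell T) j p : pol j p -> (forall x, celldom K x -> p x = 0) ->
  forall x, p x = 0.
Proof.
move=> pp p0; apply: (pol_eq0 pp (@open_open_hull _ _ T (val K)) (open_hull_nonempty (nd K))).
by move=> x /(open_hull_sub (nd K)); exact: p0.
Qed.

End mesh_integrals.

(** * Projection, weak gradient and weak divergence *)

Section weak_operators.
Context {R : realType} {d : nat} {T : mesh R d.+1}.
Local Notation V := 'I_(nvert T).
Hypothesis mesh_nd : forall K : {set V}, K \in cells T -> nondegenerate K.
Local Notation CI K := (cint_poly_integral mesh_nd K).
Local Notation FI e := (fint_poly_integral mesh_nd e).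

Lemma derive_ext (p q : 'rV[R]_d.+1 -> R) v x : (forall y, p y = q y) -> 'D_v p x = 'D_v q x.
Proof. by move=> /funext ->. Qed.

Lemma pol_deriveZD j a (p q : 'rV[R]_d.+1 -> R) v x : pol j p -> pol j q ->
  'D_v (fun y => a * p y + q y) x = a * 'D_v p x + 'D_v q x.
Proof.
move=> pp pq; have dp := @pol_derivable _ _ _ _ v x pp; have dq := @pol_derivable _ _ _ _ v x pq.
rewrite (_ : (fun y => _) = (a \*: p : _ -> R^o) + q)//.
by rewrite deriveD ?deriveZ//; exact: derivableZ.
Qed.

Lemma pol_deriveM i j (p q : 'rV[R]_d.+1 -> R) v x : pol i p -> pol j q ->
  'D_v (fun y => p y * q y) x = p x * 'D_v q x + q x * 'D_v p x.
Proof.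
move=> pp pq; have dp := @pol_derivable _ _ _ _ v x pp; have dq := @pol_derivable _ _ _ _ v x pq.
by rewrite (_ : (fun y => _) = p * q)// deriveM.
Qed.

Section projB.
Variables (k : nat) (e : face T).
Implicit Types g h : 'rV[R]_d.+1 -> R.

Lemma projBP g : polon (facedom e) g -> Pol k (facedom e) (projB k e g) /\
  forall q, pol k q -> fint e (fun x => projB k e g x * q x) = fint e (fun x => g x * q x).
Proof.
move=> pg; have [|||G [PG hG]] := @riesz_pol _ _ _ _ (FI e) k (fun q => fint e (fun x => g x * q x)).
- by move=> p q /funext ->.
- move=> a p q pp pq.
  have pgp : polon (facedom e) (fun x => g x * p x) by apply: polonM pg _; exact: pol_polon pp.
  have pgq : polon (facedom e) (fun x => g x * q x) by apply: polonM pg _; exact: pol_polon pq.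
  by rewrite -(pint_lin (FI e))//; apply: (pint_ext (FI e)) => x _; ring.
- move=> q _ q0; rewrite -(pint0 (FI e)); apply: (pint_ext (FI e)) => x ex.
  by rewrite q0// mulr0.
rewrite /projB; case: xgetP => [p _ [Pp hp]|/(_ G)[]]; last by split.
by split=> // q /polyfunP; exact: hp.
Qed.

Lemma projB_unique g G : polon (facedom e) g -> Pol k (facedom e) G ->
  (forall q, pol k q -> fint e (fun x => G x * q x) = fint e (fun x => g x * q x)) ->
  projB k e g = G.
Proof.
move=> pg PG hG; have [Pg hg] := projBP pg.
by apply: (riesz_pol_unique (FI e) Pg PG) => s /polyfunP ps; rewrite hg// hG.
Qed.

Lemma projB_lin a g h : polon (facedom e) g -> polon (facedom e) h ->
  projB k e (fun x => a * g x + h x) = fun x => a * projB k e g x + projB k e h x.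
Proof.
move=> pg ph; have [Pg hg] := projBP pg; have [Ph hh] := projBP ph.
apply: projB_unique; [by apply: polonD => //; exact: polonZ|exact: Pol_lin|].
move=> q pq; have qq := pol_polon (facedom e) pq.
transitivity (fint e (fun x => a * (projB k e g x * q x) + projB k e h x * q x)).
  by apply: (pint_ext (FI e)) => x _; ring.
have Pgq := polonM (Pol_polon Pg) qq; have Phq := polonM (Pol_polon Ph) qq.
have gq := polonM pg qq; have hq := polonM ph qq.
rewrite (pint_lin (FI e))// hg// hh// -(pint_lin (FI e))//.
by apply: (pint_ext (FI e)) => x _; ring.
Qed.

End projB.

Section gradient.
Variable K : cell T.
Local Notation DK := (celldom K).

Definition wpair (vi : 'rV[R]_d.+1 -> R) (vb : face T -> 'rV[R]_d.+1 -> R) : Prop :=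
  polon DK vi /\ forall e, polon (facedom e) (vb e).

(** Component [i] of the functional that defines the weak gradient. Summed over the components of a
    vector field it also defines the weak divergence, as [divf], so both operators share one
    theory. *)
Definition gradf (vi : 'rV[R]_d.+1 -> R) (vb : face T -> 'rV[R]_d.+1 -> R) (i : 'I_d.+1)
    (s : 'rV[R]_d.+1 -> R) : R :=
  - cint K (fun x => vi x * 'D_(ebasis i) s x) +
  \sum_(e : face T | incident K e) fint e (fun x => vb e x * s x * normal K e 0 i).

Lemma gradf_lin vi vb i j a (p q : 'rV[R]_d.+1 -> R) : wpair vi vb -> pol j p -> pol j q ->
  gradf vi vb i (fun x => a * p x + q x) = a * gradf vi vb i p + gradf vi vb i q.
Proof.
move=> [pvi pvb] pp pq; rewrite /gradf.
have D_ p' : pol j p' -> polon DK (fun x => vi x * 'D_(ebasis i) p' x).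
  by move=> /(pol_derive_pol (ebasis i)) /(pol_polon DK); exact: polonM.
have B_ p' e : pol j p' -> polon (facedom e) (fun x => vb e x * p' x * normal K e 0 i).
  move=> /(pol_polon (facedom e)) h; apply: polonM; last exact: polon_cst.
  exact: polonM.
rewrite (pint_ext (CI K) (h := fun x => a * (vi x * 'D_(ebasis i) p x) + vi x * 'D_(ebasis i) q x)); last first.
  by move=> x _; rewrite (pol_deriveZD _ _ _ pp pq); ring.
rewrite (pint_lin (CI K)); [|exact: D_|exact: D_].
rewrite (eq_bigr (fun e => a * fint e (fun x => vb e x * p x * normal K e 0 i) +
   fint e (fun x => vb e x * q x * normal K e 0 i))); last first.
  move=> e _; rewrite -(pint_lin (FI e)); [|exact: B_|exact: B_].
  by apply: (pint_ext (FI e)) => x _; ring.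
by rewrite big_split/= -mulr_sumr opprD mulrDr mulrN addrACA.
Qed.

(** A polynomial that vanishes on a cell vanishes everywhere, and its derivatives and traces with
    it. *)
Lemma gradf_eq0 vi vb i j (p : 'rV[R]_d.+1 -> R) : pol j p ->
  (forall x, DK x -> p x = 0) -> gradf vi vb i p = 0.
Proof.
move=> pp /(pol_eq0_cell mesh_nd pp) p0; rewrite /gradf.
rewrite (pint_ext (CI K) (h := fun=> 0)); last first.
  move=> x _; rewrite (derive_ext (q := fun=> 0))//.
  by rewrite derive_cst mulr0.
rewrite (pint0 (CI K)) oppr0 add0r big1// => e _.
rewrite -(pint0 (FI e)); apply: (pint_ext (FI e)) => x _.
by rewrite p0 mulr0 mul0r.
Qed.

Lemma gradf_data_lin a vi vb wi wb i j (p : 'rV[R]_d.+1 -> R) :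
  wpair vi vb -> wpair wi wb -> pol j p ->
  gradf (fun x => a * vi x + wi x) (fun e x => a * vb e x + wb e x) i p =
  a * gradf vi vb i p + gradf wi wb i p.
Proof.
move=> [pvi pvb] [pwi pwb] pp; rewrite /gradf.
have D_ v : polon DK v -> polon DK (fun x => v x * 'D_(ebasis i) p x).
  by move=> pv; apply: polonM pv _; exact: pol_polon (pol_derive_pol _ pp).
have B_ e v : polon (facedom e) v -> polon (facedom e) (fun x => v x * p x * normal K e 0 i).
  move=> pv; apply: polonM; last exact: polon_cst.
  by apply: polonM pv _; exact: pol_polon pp.
rewrite (pint_ext (CI K) (h := fun x => a * (vi x * 'D_(ebasis i) p x) + wi x * 'D_(ebasis i) p x)); last first.
  by move=> x _; ring.
rewrite (pint_lin (CI K)); [|exact: D_|exact: D_].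
rewrite (eq_bigr (fun e => a * fint e (fun x => vb e x * p x * normal K e 0 i) +
   fint e (fun x => wb e x * p x * normal K e 0 i))); last first.
  move=> e _; rewrite -(pint_lin (FI e)); [|exact: B_|exact: B_].
  by apply: (pint_ext (FI e)) => x _; ring.
by rewrite big_split/= -mulr_sumr opprD mulrDr mulrN addrACA.
Qed.

Section wgrad.
Variable gam : nat.
Implicit Types (vi : 'rV[R]_d.+1 -> R) (vb : face T -> 'rV[R]_d.+1 -> R).

Let wgrad_rhs vi vb s : wpair vi vb -> polyfunV gam s ->
  - cint K (fun x => vi x * div s x) +
  \sum_(e : face T | incident K e) fint e (fun x => vb e x * dotv (s x) (normal K e)) =
  \sum_i gradf vi vb i (fun x => s x 0 i).
Proof.
move=> [pvi pvb] ps.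
have psi i : pol gam (fun x => s x 0 i) by exact/polyfunP.
have -> : cint K (fun x => vi x * div s x) =
    \sum_i cint K (fun x => vi x * 'D_(ebasis i) (fun y => s y 0 i) x).
  rewrite -(pint_sum (CI K)); last first.
    by move=> i; apply: polonM pvi _; exact: pol_polon (pol_derive_pol _ (psi i)).
  by apply: (pint_ext (CI K)) => x _; rewrite mulr_sumr.
rewrite /gradf big_split/= sumrN exchange_big/=; congr (_ + _).
apply: eq_bigr => e _; rewrite -(pint_sum (FI e)); last first.
  move=> i; apply: polonM; last exact: polon_cst.
  by apply: polonM (pvb e) _; exact: pol_polon (psi i).
apply: (pint_ext (FI e)) => x _; rewrite mulr_sumr.
by apply: eq_bigr => i _; rewrite mulrA.
Qed.

Let cint_dotv G s : PolV gam DK G -> polyfunV gam s ->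
  cint K (fun x => dotv (G x) (s x)) = \sum_i cint K (fun x => G x 0 i * s x 0 i).
Proof.
move=> PG ps; rewrite -(pint_sum (CI K))// => i.
apply: polonM; first exact: Pol_polon (PG i).
by apply: (@pol_polon _ _ _ gam); exact/polyfunP.
Qed.

Lemma wgradP vi vb : wpair vi vb -> PolV gam DK (wgrad gam K vi vb) /\
  forall i p, pol gam p -> cint K (fun x => wgrad gam K vi vb x 0 i * p x) = gradf vi vb i p.
Proof.
move=> wv.
have /choice[G hG] : forall i, exists G, Pol gam DK G /\
    forall s, polyfun gam s -> cint K (fun x => G x * s x) = gradf vi vb i s.
  move=> i; apply: (riesz_pol (CI K)).
  - by move=> p q /funext ->.
  - by move=> a p q; exact: gradf_lin.
  - by move=> p; exact: gradf_eq0.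
rewrite /wgrad; case: xgetP => [W _ [PW hW]|/(_ (fun x => \row_i G i x))[]]; last first.
  have PG : PolV gam DK (fun x => \row_i G i x).
    move=> i; have [+ _] := hG i; congr (Pol _ _ _).
    by apply/funext => x; rewrite mxE.
  split=> // s ps; rewrite wgrad_rhs// cint_dotv//; apply: eq_bigr => i _.
  have [_ <-] := hG i; last exact: ps.
  by apply: (pint_ext (CI K)) => x _; rewrite mxE.
(* Vector test functions with the single component [i] recover the scalar equation for that
   component. *)
split=> // i p pp; pose s (x : 'rV[R]_d.+1) : 'rV[R]_d.+1 := p x *: ebasis i.
have sE j x : s x 0 j = (i == j)%:R * p x by rewrite !mxE eqxx mulrC eq_sym.
have ps : polyfunV gam s.
  move=> j; apply/polyfunP; apply: (pol_ext (p := fun x => (i == j)%:R * p x)).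
    by move=> x; rewrite sE.
  exact: polZ.
have := hW s ps; rewrite wgrad_rhs// cint_dotv//.
rewrite (bigD1 i)//= [X in _ + X]big1 ?addr0; last first.
  move=> j ij; rewrite -(pint0 (CI K)); apply: (pint_ext (CI K)) => x _.
  by rewrite sE eq_sym (negPf ij) mul0r mulr0.
rewrite [X in _ = X](bigD1 i)//= [X in _ = _ + X]big1 ?addr0; last first.
  move=> j ij; apply: (@gradf_eq0 _ _ _ gam); last by move=> x _; rewrite sE eq_sym (negPf ij) mul0r.
  exact/polyfunP.
have -> : (fun x => s x 0 i) = p by apply/funext => x; rewrite sE eqxx mul1r.
move=> <-; apply: (pint_ext (CI K)) => x _; by rewrite sE eqxx mul1r.
Qed.

Lemma wgrad_unique vi vb G : wpair vi vb -> PolV gam DK G ->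
  (forall i p, pol gam p -> cint K (fun x => G x 0 i * p x) = gradf vi vb i p) ->
  wgrad gam K vi vb = G.
Proof.
move=> wv PG hG; have [Pw hw] := wgradP wv.
apply/funext => x; apply/rowP => i.
suff : (fun x => wgrad gam K vi vb x 0 i) = (fun x => G x 0 i) by move=> /(congr1 (@^~ x)).
by apply: (riesz_pol_unique (CI K) (Pw i) (PG i)) => s /polyfunP ps; rewrite hw// hG.
Qed.

Lemma wgrad_lin a vi vb wi wb : wpair vi vb -> wpair wi wb ->
  wgrad gam K (fun x => a * vi x + wi x) (fun e x => a * vb e x + wb e x) =
  fun x => a *: wgrad gam K vi vb x + wgrad gam K wi wb x.
Proof.
move=> pv pw; have [Pv hv] := wgradP pv; have [Pw hw] := wgradP pw.
have PE i : (fun x => (a *: wgrad gam K vi vb x + wgrad gam K wi wb x) 0 i) =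
    (fun x => a * wgrad gam K vi vb x 0 i + wgrad gam K wi wb x 0 i).
  by apply/funext => x; rewrite !mxE.
apply: wgrad_unique.
- split; first by apply: polonD (proj1 pw); exact: polonZ (proj1 pv).
  by move=> e; apply: polonD (proj2 pw e); exact: polonZ (proj2 pv e).
- by move=> i; rewrite PE; exact: Pol_lin.
move=> i p pp; rewrite (gradf_data_lin _ _ pv pw pp) -hv// -hw// -(pint_lin (CI K)).
- by apply: (pint_ext (CI K)) => x _; rewrite !mxE; ring.
- by apply: polonM; [exact: Pol_polon (Pv i)|exact: pol_polon pp].
- by apply: polonM; [exact: Pol_polon (Pw i)|exact: pol_polon pp].
Qed.

End wgrad.
Section wdiv.
Variable gam : nat.
Implicit Types (wi : 'rV[R]_d.+1 -> 'rV[R]_d.+1) (wb : face T -> 'rV[R]_d.+1 -> 'rV[R]_d.+1).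

Definition divf wi wb p : R :=
  \sum_i gradf (fun x => wi x 0 i) (fun e x => wb e x 0 i) i p.

Definition wpairV wi wb : Prop :=
  forall i, wpair (fun x => wi x 0 i) (fun e x => wb e x 0 i).

Let wdiv_rhs wi wb p : wpairV wi wb -> pol gam p ->
  - cint K (fun x => dotv (wi x) (grad p x)) +
  \sum_(e : face T | incident K e) fint e (fun x => dotv (wb e x) (normal K e) * p x) =
  divf wi wb p.
Proof.
move=> pw pp.
have -> : cint K (fun x => dotv (wi x) (grad p x)) =
    \sum_i cint K (fun x => wi x 0 i * 'D_(ebasis i) p x).
  rewrite -(pint_sum (CI K)); last first.
    move=> i; apply: polonM; first exact: (proj1 (pw i)).
    exact: pol_polon (pol_derive_pol _ pp).
  by apply: (pint_ext (CI K)) => x _; apply: eq_bigr => i _; rewrite mxE.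
rewrite /divf /gradf big_split/= sumrN exchange_big/=; congr (_ + _).
apply: eq_bigr => e _; rewrite -(pint_sum (FI e)); last first.
  move=> i; apply: polonM; last exact: polon_cst.
  apply: polonM; first exact: (proj2 (pw i)).
  exact: pol_polon pp.
apply: (pint_ext (FI e)) => x _; rewrite mulr_suml.
by apply: eq_bigr => i _; ring.
Qed.

Lemma wdivP wi wb : wpairV wi wb -> Pol gam DK (wdiv gam K wi wb) /\
  forall p, pol gam p -> cint K (fun x => wdiv gam K wi wb x * p x) = divf wi wb p.
Proof.
move=> pw; have [|||G [PG hG]] := @riesz_pol _ _ _ _ (CI K) gam (divf wi wb).
- by move=> p q /funext ->.
- move=> a p q pp pq; rewrite /divf mulr_sumr -big_split/=.
  by apply: eq_bigr => i _; rewrite (gradf_lin _ _ (pw i) pp pq).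
- by move=> p pp p0; apply: big1 => i _; exact: gradf_eq0 pp p0.
rewrite /wdiv; case: xgetP => [W _ [PW hW]|/(_ G)[]]; last first.
  by split=> // p /[dup] /polyfunP pp; rewrite (wdiv_rhs pw pp); exact: hG.
by split=> // p pp; rewrite hW ?wdiv_rhs//; exact/polyfunP.
Qed.

Lemma wdiv_unique wi wb G : wpairV wi wb -> Pol gam DK G ->
  (forall p, pol gam p -> cint K (fun x => G x * p x) = divf wi wb p) ->
  wdiv gam K wi wb = G.
Proof.
move=> pw PG hG; have [Pw hw] := wdivP pw.
by apply: (riesz_pol_unique (CI K) Pw PG) => s /polyfunP ps; rewrite hw// hG.
Qed.

Lemma wdiv_lin a vi vb wi wb : wpairV vi vb -> wpairV wi wb ->
  wdiv gam K (fun x => a *: vi x + wi x) (fun e x => a *: vb e x + wb e x) =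
  fun x => a * wdiv gam K vi vb x + wdiv gam K wi wb x.
Proof.
move=> pv pw; have [Pv hv] := wdivP pv; have [Pw hw] := wdivP pw.
have PE i : (fun x => (a *: vi x + wi x) 0 i) = (fun x => a * vi x 0 i + wi x 0 i).
  by apply/funext => x; rewrite !mxE.
have PEb i : (fun e x => (a *: vb e x + wb e x) 0 i) = (fun e x => a * vb e x 0 i + wb e x 0 i).
  by apply/funext => e; apply/funext => x; rewrite !mxE.
apply: wdiv_unique.
- move=> i; rewrite PE PEb; split.
    by apply: polonD (proj1 (pw i)); exact: polonZ (proj1 (pv i)).
  by move=> e; apply: polonD (proj2 (pw i) e); exact: polonZ (proj2 (pv i) e).
- exact: Pol_lin.
move=> p pp; rewrite /divf.
rewrite (eq_bigr (fun i => a * gradf (fun x => vi x 0 i) (fun e x => vb e x 0 i) i p +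
  gradf (fun x => wi x 0 i) (fun e x => wb e x 0 i) i p)); last first.
  by move=> i _; rewrite PE PEb (gradf_data_lin _ _ (pv i) (pw i) pp).
rewrite big_split/= -mulr_sumr -/(divf vi vb p) -/(divf wi wb p) -hv// -hw// -(pint_lin (CI K)).
- by apply: (pint_ext (CI K)) => x _; ring.
- by apply: polonM; [exact: Pol_polon Pv|exact: pol_polon pp].
- by apply: polonM; [exact: Pol_polon Pw|exact: pol_polon pp].
Qed.

End wdiv.

Lemma dotv_ebasis i (u : 'rV[R]_d.+1) : dotv (ebasis i) u = u 0 i.
Proof.
rewrite /dotv (bigD1 i)//= big1 ?addr0 => [|k ki]; first by rewrite !mxE !eqxx mul1r.
by rewrite !mxE eqxx (negPf ki) mul0r.
Qed.

(** The divergence formula for [p q] trades the interior term for the classical derivative; what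
    remains on the faces is the mismatch [vb - p]. *)
Lemma gradf_by_parts vi vb i jp j p q : wpair vi vb -> pol jp p -> pol j q ->
  (forall x, DK x -> vi x = p x) ->
  gradf vi vb i q = cint K (fun x => 'D_(ebasis i) p x * q x) +
    \sum_(e : face T | incident K e) fint e (fun x => (vb e x - p x) * q x * normal K e 0 i).
Proof.
move=> [pvi pvb] pp pq vp; rewrite /gradf.
have qe e := pol_polon (facedom e) pq; have pe e := pol_polon (facedom e) pp.
rewrite [in RHS](eq_bigr (fun e => fint e (fun x => vb e x * q x * normal K e 0 i) -
    fint e (fun x => p x * q x * normal K e 0 i))); last first.
  move=> e _; rewrite -[X in _ = _ + X]mulN1r addrC -(pint_lin (FI e)).
  - by apply: (pint_ext (FI e)) => x _; ring.
  - by apply: polonM; [exact: polonM|exact: polon_cst].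
  - by apply: polonM; [exact: polonM|exact: polon_cst].
have h := cell_divergence mesh_nd K (ebasis i) (polM pp pq).
rewrite big_split/= sumrN addrCA addrC; congr (_ + _).
rewrite (eq_bigr (fun e => fint e (fun x => p x * q x * dotv (ebasis i) (normal K e)))); last first.
  by move=> e _; apply: (pint_ext (FI e)) => x _; rewrite dotv_ebasis.
rewrite -h (pint_ext (CI K) (h := fun x => p x * 'D_(ebasis i) q x)); last first.
  by move=> x Kx; rewrite vp.
rewrite (pint_ext (CI K) (h := fun x => 'D_(ebasis i) p x * q x + p x * 'D_(ebasis i) q x)
   (g := 'D_(ebasis i) (fun x => p x * q x))); last first.
  by move=> x _; rewrite (pol_deriveM _ _ pp pq); ring.
rewrite (pintD (CI K)); first by rewrite opprD addNKr.
- by apply: polonM; [exact: pol_polon (pol_derive_pol _ pp)|exact: pol_polon pq].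
- by apply: polonM; [exact: pol_polon pp|exact: pol_polon (pol_derive_pol _ pq)].
Qed.

End gradient.
End weak_operators.

(** * Definiteness of the discrete gradients *)

Section constants.
Context {R : realType} {n : nat}.

Lemma pol_const j (p : 'rV[R]_n -> R) : pol j p ->
  (forall i x, 'D_(ebasis i) p x = 0) -> forall x, p x = p 0.
Proof.
move=> pp D0 x; pose f (t : R) := p (t *: x).
have f0 (t : R) : is_derive t 1 (f : R -> R^o) 0.
  have dp := pol_differentiable (t *: x) pp.
  have [p' [_ _ hp']] := pol_derive x pp.
  have Dx : p' (t *: x) = 0.
    have [_ <-] := hp' (t *: x).
    by rewrite (pol_derive_lin _ _ pp) big1// => i _; rewrite D0 mulr0.
  have [dh eh] := hp' (t *: x).
  have qE : (fun h : R => h^-1 *: ((f \o shift t) (h *: 1) - f t)) =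
            (fun h : R => h^-1 *: ((p \o shift (t *: x)) (h *: x) - p (t *: x))).
    apply/funext => h /=; rewrite /f; congr (_ *: (p _ - _)).
    by rewrite scalerDl [h *: 1]mulr1.
  split; first by rewrite /derivable qE.
  by apply: etrans Dx; apply: etrans eh; rewrite /derive -qE.
by have := is_derive_0_is_cst 1 0 f0; rewrite /f scale1r scale0r.
Qed.

End constants.

Section definiteness.
Context {R : realType} {d : nat} {T : mesh R d.+1} {Omega : set 'rV[R]_d.+1}.
Local Notation V := 'I_(nvert T).
Hypotheses (oO : open Omega) (cO : connected Omega) (O0 : Omega !=set0)
  (bO : bounded_set Omega).
Hypothesis partT : partition_of T Omega.
Let mesh_nd := partition_nd partT.
Local Notation nd K := (cell_nd mesh_nd K).
Local Notation CI K := (cint_poly_integral mesh_nd K).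
Local Notation FI e := (fint_poly_integral mesh_nd e).

Lemma vert_hull (s : {set V}) v : v \in s -> hull s (vert v).
Proof.
move=> vs; exists (fun w => (w == v)%:R); split=> [w _||].
- exact: ler0n.
- rewrite (bigD1 v)//= eqxx big1 ?addr0// => w /andP[_ /negPf ->]//.
- rewrite (bigD1 v)//= eqxx scale1r big1 ?addr0// => w /andP[_ /negPf ->].
  by rewrite scale0r.
Qed.

Lemma facedom_nonempty (e : face T) : facedom e !=set0.
Proof.
have /card_gt0P[v ve] : (0 < #|val e|)%N by rewrite card_face.
by exists (vert v); exact: vert_hull.
Qed.

Lemma hK_gt0 (K : cell T) : 0 < hK K.
Proof.
have [a aK] : exists a, a \in val K.
  by apply/card_gt0P; rewrite (proj1 (nd K)).
have [b] : exists b, b \in val K :\ a.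
  by apply/card_gt0P; move: (cardsD1 a (val K)); rewrite (proj1 (nd K)) aK add1n => -[<-].
rewrite !inE => /andP[ba bK].
have ab : enorm (vert a - vert b) > 0.
  rewrite sqrtr_gt0 lt_def dotv_ge0 andbT; apply/eqP => /dotv_eq0/subr0_eq h.
  have := bary_vert (nd K) bK aK; rewrite h (bary_vert (nd K) bK bK) eqxx (negPf ba).
  by move/eqP; rewrite oner_eq0.
apply: (lt_le_trans ab); apply: ub_le_sup; last first.
  by exists (vert a, vert b) => //; split; exact: vert_hull.
have [M [_ hM]] := @bounded_hull _ _ T (val K).
pose B := M + 1; have M1 x : hull (val K) x -> `|x| <= B by apply: hM; rewrite ltrDl.
exists (Num.sqrt (\sum_(i < d.+1) (B + B) ^+ 2)) => _ [[x y] [/= Kx Ky] <-].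
rewrite ler_wsqrtr// /dotv; apply: ler_sum => i _; rewrite -expr2 -real_normK ?num_real//.
have B0 : 0 <= B by apply: le_trans (M1 _ Kx).
have BB : 0 <= B + B by rewrite -mulr2n mulrn_wge0.
apply: lerXn2r; rewrite ?nnegrE//.
rewrite !mxE; apply: (le_trans (ler_normB _ _)).
by apply: lerD; apply: le_trans (ler_coord_norm _ _) _; exact: M1.
Qed.

Lemma cint1_gt0 (K : cell T) : 0 < cint K (fun=> 1).
Proof.
have [c [e [e0 ce]]] := hull_ball (nd K).
exact: (ball_Rintegral1_gt0 (measurable_hull (nd K)) (lebesgue_hull_lty (nd K)) e0 ce).
Qed.

Section scalar_gradient.
Variables (K : cell T) (vi : 'rV[R]_d.+1 -> R) (vb : face T -> 'rV[R]_d.+1 -> R).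
Variables (gam j : nat) (p : 'rV[R]_d.+1 -> R).
Hypotheses (vp : wpair K vi vb) (pp : pol j p) (vE : forall x, celldom K x -> vi x = p x).
Hypothesis g0 : forall i q, pol gam q -> gradf K vi vb i q = 0.

(** Contraction with a constant direction [t] leaves the factor [dotv t (normal K e)], which
    vanishes on faces parallel to [t]; the choice of [t] thus selects the faces that contribute. *)
Lemma directional_gradf q t : pol gam q ->
  cint K (fun x => 'D_t p x * q x) +
  \sum_(e : face T | incident K e) fint e (fun x => (vb e x - p x) * q x * dotv t (normal K e)) = 0.
Proof.
move=> pq; have [pvi pvb] := vp.
have qe e := pol_polon (facedom e) pq; have pe e := pol_polon (facedom e) pp.
have De i := pol_polon (celldom K) (pol_derive_pol (ebasis i) pp).
have qK := pol_polon (celldom K) pq.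
have be e c : polon (facedom e) (fun x => (vb e x - p x) * q x * c).
  apply: polonM; last exact: polon_cst.
  by apply: polonM => //; apply: polonD => //; exact: polonN.
transitivity (\sum_i t 0 i * gradf K vi vb i q); last first.
  by apply: big1 => i _; rewrite g0// mulr0.
under [RHS]eq_bigr => i _ do rewrite (gradf_by_parts mesh_nd i vp pp pq vE) mulrDr mulr_sumr.
rewrite big_split/=; congr (_ + _).
  transitivity (cint K (fun x => \sum_i t 0 i * ('D_(ebasis i) p x * q x))).
    apply: (pint_ext (CI K)) => x _; rewrite (pol_derive_lin _ _ pp) mulr_suml.
    by apply: eq_bigr => i _; rewrite mulrA.
  rewrite (pint_sum (CI K)); last by move=> i; apply: polonZ; exact: polonM.
  by apply: eq_bigr => i _; rewrite (pintZ (CI K))//; exact: polonM.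
rewrite exchange_big/=; apply: eq_bigr => e _.
transitivity (fint e (fun x => \sum_i t 0 i * ((vb e x - p x) * q x * normal K e 0 i))).
  apply: (pint_ext (FI e)) => x _; rewrite /dotv mulr_sumr.
  by apply: eq_bigr => i _; ring.
rewrite (pint_sum (FI e)); last by move=> i; exact: polonZ.
by apply: eq_bigr => i _; rewrite (pintZ (FI e)).
Qed.

End scalar_gradient.

Lemma facedom_sub (K : cell T) (e : face T) : incident K e -> facedom e `<=` celldom K.
Proof. by move=> Ke x; rewrite /facedom (hull_subE (nd K) Ke) => -[]. Qed.

(** Traces are single-valued on faces, so cells that share a face carry the same constant, and
    [face_connected] spreads it. *)
Lemma constant_trace (c : cell T -> R) (vb : face T -> 'rV[R]_d.+1 -> R) :
  (forall K e, incident K e -> forall x, facedom e x -> vb e x = c K) ->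
  forall K L, c K = c L.
Proof.
move=> vc K L; apply/eqP; rewrite eq_sym.
have := @face_connected _ _ _ _ oO cO partT (fun M => c M == c K) _ K L.
apply => //.
move=> M N e Me Ne /eqP <-; have [x ex] := facedom_nonempty e.
by rewrite -(vc M e Me x ex) (vc N e Ne x ex).
Qed.

(* The jump condition turns the face terms into those of the divergence
   formula, so that testing with the gradient of [vi K] makes it vanish. *)
Lemma weak_gradient_definite (m k gam : nat) (vi : cell T -> 'rV[R]_d.+1 -> R)
    (vb : face T -> 'rV[R]_d.+1 -> R) : (m.-1 <= gam)%N -> (gam <= k)%N ->
  (forall K, Pol m (celldom K) (vi K)) -> (forall e, Pol k (facedom e) (vb e)) ->
  (forall K i q, pol gam q -> gradf K (vi K) vb i q = 0) ->
  (forall K e, incident K e -> forall x, facedom e x -> projB k e (vi K) x = vb e x) ->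
  (forall e, facedom e `<=` boundary Omega -> forall x, facedom e x -> vb e x = 0) ->
  (forall K x, vi K x = 0) /\ (forall e x, vb e x = 0).
Proof.
move=> mg gk Pvi Pvb g0 jump0 bd0.
have /choice[p hp] : forall K, exists p, pol m p /\ forall x, celldom K x -> vi K x = p x.
  by move=> K; have /PolP[[p pp vp] _] := Pvi K; exists p.
have pp K : pol m (p K) by case: (hp K).
have vp K : forall x, celldom K x -> vi K x = p K x by case: (hp K).
have pe K (e : face T) : incident K e -> forall x, facedom e x -> vi K x = p K x.
  by move=> Ke x /(facedom_sub Ke); exact: vp.
have wp K : wpair K (vi K) vb.
  by split=> [|e]; [exact: Pol_polon (Pvi K)|exact: Pol_polon (Pvb e)].
(* [vb] equals the projection of the interior trace, so the mismatch is orthogonal to every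
   polynomial of degree [k]. *)
have moment K (e : face T) q : incident K e -> pol k q ->
    fint e (fun x => (vb e x - p K x) * q x) = 0.
  move=> Ke pq; have qe := pol_polon (facedom e) pq; have pKe := pol_polon (facedom e) (pp K).
  have vKe : polon (facedom e) (vi K) by apply: polon_ext pKe => x ex; rewrite (pe K e Ke).
  have [_ /(_ q pq) h] := projBP mesh_nd k vKe.
  have vbe := Pol_polon (Pvb e).
  rewrite (pint_ext (FI e) (h := fun x => (-1) * (p K x * q x) + vb e x * q x)); last first.
    by move=> x _; ring.
  rewrite (pint_lin (FI e)); [|exact: polonM|exact: polonM].
  rewrite mulN1r addrC; apply/eqP; rewrite subr_eq0; apply/eqP.
  transitivity (fint e (fun x => projB k e (vi K) x * q x)).
    by apply: (pint_ext (FI e)) => x ex; rewrite jump0.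
  by rewrite h; apply: (pint_ext (FI e)) => x ex; rewrite (pe K e Ke).
have pc K : forall x, p K x = p K 0.
  apply: (pol_const (pp K)) => i.
  have pD := pol_derive_pol (ebasis i) (pp K).
  apply: (pol_eq0_cell mesh_nd pD); apply: (pint_sqr_eq0 (CI K) (pol_polon _ pD)).
  have := directional_gradf (wp K) (pp K) (vp K) (g0 K) (ebasis i) (pol_le mg pD).
  rewrite [X in _ + X]big1 ?addr0 => [|e Ke].
    by apply: etrans; apply: (pint_ext (CI K)) => x _; rewrite expr2.
  set t := dotv _ _.
  rewrite (pint_ext (FI e) (h := fun x => t * ((vb e x - p K x) * 'D_(ebasis i) (p K) x))); last first.
    by move=> x _; ring.
  rewrite (pintZ (FI e)); first by rewrite moment ?mulr0//; apply: pol_le pD; exact: leq_trans gk.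
  apply: polonM; last exact: pol_polon pD.
  by apply: polonD; [exact: Pol_polon (Pvb e)|apply: polonN; exact: pol_polon (pp K)].
have vbc K (e : face T) : incident K e -> forall x, facedom e x -> vb e x = p K 0.
  move=> Ke x ex; apply/subr0_eq.
  have /PolP[[b pb hb] _] := Pvb e.
  have pbc : pol k (fun x => b x - p K 0) by apply: polB => //; exact: pol_cst.
  have vbe : polon (facedom e) (fun x => vb e x - p K 0).
    by apply: polonD; [exact: Pol_polon (Pvb e)|exact: polon_cst].
  apply: (pint_sqr_eq0 (FI e) vbe) x ex; apply: etrans (moment K e _ Ke pbc).
  by apply: (pint_ext (FI e)) => x ex; rewrite hb// (pc K x) expr2.
have [K0 [e0 [Ke0 be0]]] := exists_boundary_face oO O0 partT.
have p0 K : p K 0 = 0.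
  rewrite (constant_trace (c := fun K => p K 0) vbc K K0).
  by have [x ex] := facedom_nonempty e0; rewrite -(vbc K0 e0 Ke0 x ex) bd0.
split=> [K x|e x].
  have [Kx|Kx] := pselect (celldom K x); first by rewrite vp// pc p0.
  by have /PolP[_ ->] := Pvi K.
have [ex|ex] := pselect (facedom e x); last by have /PolP[_ ->] := Pvb e.
by have [K Ke] := face_in_cell e; rewrite (vbc K e Ke x ex) p0.
Qed.

Section pressure_cell.
Variables (m : nat) (K : cell T) (qi : 'rV[R]_d.+1 -> R) (qb : face T -> 'rV[R]_d.+1 -> R).
Hypotheses (m0 : (0 < m)%N) (Pqi : Pol m.-1 (celldom K) qi)
  (Pqb : forall e, Pol m (facedom e) (qb e)).
Hypothesis g0 : forall i q, pol m q -> gradf K qi qb i q = 0.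

Let face_weights (e : face T) x : incident K e -> facedom e x ->
  [/\ forall v, v \in val K -> v \notin val e -> bary (val K) v x = 0,
      \sum_(v in val e) bary (val K) v x = 1 &
      x = \sum_(v in val e) bary (val K) v x *: vert v].
Proof.
move=> Ke; rewrite /facedom (hull_subE (nd K) Ke) => -[_ b0].
have {}b0 v : v \in val K -> v \notin val e -> bary (val K) v x = 0.
  by move=> vK ve; apply: b0; rewrite inE ve.
have sub (W : nmodType) (F : V -> W) : (forall v, v \in val K -> v \notin val e -> F v = 0) ->
    \sum_(v in val K) F v = \sum_(v in val e) F v.
  move=> F0; rewrite (big_setID (val e))/= (finset.setIidPr Ke) [X in _ + X]big1 ?addr0// => v.
  by rewrite inE => /andP[ve vK]; exact: F0.
split=> //.
  by rewrite -sub// (bary_sum (nd K)).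
by rewrite -sub ?(bary_comb (nd K))// => v vK ve; rewrite b0// scale0r.
Qed.

Let tangent (e : face T) i j : incident K e -> i \in val e -> j \in val e ->
  dotv (vert i - vert j) (normal K e) = 0.
Proof.
move=> Ke ie je; have [a [aK eE]] := face_apex mesh_nd Ke.
by have [_ h _] := normalP mesh_nd aK eE; exact: h.
Qed.

(** On the face the coordinates of its vertices sum to 1 and represent [x]: the first fact handles
    constants, the second replaces a factor [x_i] by a sum of coordinates, which leaves cofactors of
    degree one less. *)
Lemma face_decomposition (e : face T) j q : incident K e -> pol j q -> (0 < j)%N ->
  exists w : V -> 'rV[R]_d.+1 -> R, (forall v, pol j.-1 (w v)) /\
    forall x, facedom e x -> q x = \sum_(v in val e) bary (val K) v x * w v x.
Proof.
move=> Ke; elim=> [{}j c _|{}j i p pp _ _|{}j p q' pp hp pq hq j0].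
- exists (fun _ _ => c); split=> [v|x ex]; first exact: pol_cst.
  by have [_ h _] := face_weights Ke ex; rewrite -mulr_suml h mul1r.
- exists (fun v x => vert v 0 i * p x); split=> [v|x ex]; first exact: polZ.
  have [_ _ h] := face_weights Ke ex; rewrite {1}h summxE mulr_suml.
  by apply: eq_bigr => v _; rewrite mxE mulrA.
- have [w [pw hw]] := hp j0; have [w' [pw' hw']] := hq j0.
  exists (fun v x => w v x + w' v x); split=> [v|x ex]; first exact: polD.
  by rewrite hw// hw'// -big_split/=; apply: eq_bigr => v _; rewrite mulrDr.
Qed.

(* With [t] an edge vector of [K] joining the vertices i and j, the field
   [lambda_i lambda_j ('D_t p) t] has degree at most [m] and no flux through any
   face, which gives ['D_t p = 0]; if j is the vertex opposite to a face [e],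
   [lambda_i w t] has flux through [e] only, and on [e] these fluxes span all
   moments of degree [m]. *)
Lemma weak_pressure_gradient0 : exists c,
  (forall x, celldom K x -> qi x = c) /\
  forall e, incident K e -> forall x, facedom e x -> qb e x = c.
Proof.
have /PolP[[p pp qp] _] := Pqi.
have pm : pol m p by apply: pol_le pp; exact: leq_pred.
have wp : wpair K qi qb.
  by split=> [|e]; [exact: Pol_polon Pqi|exact: Pol_polon (Pqb e)].
have edge0 i j : i \in val K -> j \in val K -> forall x, 'D_(vert i - vert j) p x = 0.
  move=> iK jK; set t := vert i - vert j.
  (* For [m = 1] the interior pressure is constant already; for [m >= 2] the bubble times the
     derivative has degree [2 + (m - 2) = m]. *)
  have [m1|m1] := leqP m 1.
    have m1E : m.-1 = 0%N by case: (m) m1 => [|[]].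
    have [p' [_ p'0 dp]] := pol_derive t pp => x.
    by have [_ ->] := dp x; rewrite p'0.
  have pD := pol_derive_pol t pp.
  pose lam x := bary (val K) i x * bary (val K) j x.
  have pl : pol 2 lam by apply: (polM (i := 1) (j := 1)); exact: pol_bary.
  have plD : pol m (fun x => lam x * 'D_t p x).
    by apply: pol_le (polM pl pD); case: (m) m1 => [|[]].
  have plD2 := polM plD pD.
  have [c [e [e0 ce]]] := hull_ball (nd K).
  have z0 : forall x, lam x * 'D_t p x * 'D_t p x = 0.
    have := integral_pol_eq0 plD2 (measurable_hull (nd K)) (@bounded_hull _ _ T (val K)) e0 ce.
    apply=> [x|].
      rewrite (hullE (nd K)) => hx; rewrite -mulrA -expr2 mulr_ge0 ?sqr_ge0// mulr_ge0//; exact: hx.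
    have := directional_gradf wp pp qp g0 t plD.
    rewrite [X in _ + X]big1 ?addr0 => [|f Kf].
      by apply: etrans; apply: (pint_ext (CI K)) => x _; rewrite mulrC.
    rewrite -(pint0 (FI f)); apply: (pint_ext (FI f)) => x fx.
    have [b0 _ _] := face_weights Kf fx; rewrite /lam.
    have [fi|fi] := boolP (i \in val f); last by rewrite b0// !mul0r mulr0 mul0r.
    have [fj|fj] := boolP (j \in val f); last by rewrite (b0 j)// mulr0 mul0r mulr0 mul0r.
    by rewrite tangent// mulr0.
  apply: (pol_eq0 pD (@open_open_hull _ _ T (val K)) (open_hull_nonempty (nd K))) => x ox.
  have l0 : lam x != 0 by rewrite gt_eqF// /lam mulr_gt0// ox.
  move: (z0 x) => /eqP; rewrite mulf_eq0 [lam x * _ == 0]mulf_eq0 (negPf l0) /= orbb.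
  by move/eqP.
have D0 u x : 'D_u p x = 0.
  have /card_gt0P[v0 v0K] : (0 < #|val K|)%N by rewrite (proj1 (nd K)).
  have uE : u = \sum_(v in val K) dotv u (bgrad (val K) v) *: (vert v - vert v0).
    under eq_bigr do rewrite scalerBr.
    by rewrite sumrB -scaler_suml (sum_dotv_bgrad (nd K)) scale0r subr0; exact: direction_comb (nd K) u.
  have dp := pol_differentiable x pp.
  rewrite deriveE// {1}uE linear_sum big1// => v vK.
  by rewrite linearZ -deriveE// edge0//; exact: mulr0.
have pc := pol_const pp (fun i => D0 (ebasis i)).
exists (p 0); split=> [x Kx|e Ke]; first by rewrite qp// pc.
have [a [aK eE]] := face_apex mesh_nd Ke.
have ae : a \notin val e by rewrite eE !inE eqxx.
have [_ _ nneg] := normalP mesh_nd aK eE.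
have qbp f : polon (facedom f) (fun x => qb f x - p x).
  apply: polonD; [exact: Pol_polon (Pqb f)|apply: polonN; exact: pol_polon pp].
have vertex0 i w : i \in val e -> pol m.-1 w ->
    fint e (fun x => (qb e x - p x) * (bary (val K) i x * w x)) = 0.
  move=> ie pw; have iK := fintype.subsetP Ke _ ie.
  have pq : pol m (fun x => bary (val K) i x * w x).
    by have := polM (@pol_bary _ _ T (val K) i) pw; rewrite add1n prednK.
  have := directional_gradf wp pp qp g0 (vert a - vert i) pq.
  rewrite (pint_ext (CI K) (h := fun=> 0)) => [|x _]; last by rewrite D0 mul0r.
  rewrite (pint0 (CI K)) add0r (bigD1 e)//= [X in _ + X]big1 ?addr0; last first.
    move=> f /andP[Kf fe]; rewrite -(pint0 (FI f)); apply: (pint_ext (FI f)) => x fx.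
    have [b0 _ _] := face_weights Kf fx.
    have [fi|fi] := boolP (i \in val f); last by rewrite b0// mul0r mulr0 mul0r.
    (* A face of [K] other than [e] contains the apex [a]; both ends of the edge then lie on it, and
       there is no flux. *)
    rewrite tangent ?mulr0//; apply: contraNT fe => fa; apply/eqP/val_inj/eqP.
    rewrite eqEcard !card_face leqnn andbT; apply/fintype.subsetP => v vf.
    rewrite eE !inE (fintype.subsetP Kf)// andbT; apply: contraNneq fa => <-.
    exact: vf.
  set t := dotv _ _ => h.
  have t0 : t < 0 by exact: nneg.
  have : t * fint e (fun x => (qb e x - p x) * (bary (val K) i x * w x)) = 0.
    rewrite -(pintZ (FI e)); last by apply: polonM => //; exact: pol_polon pq.
    by apply: etrans h; apply: (pint_ext (FI e)) => x _; ring.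
  by move/eqP; rewrite mulf_eq0 (lt_eqF t0) => /eqP.
have moment q : pol m q -> fint e (fun x => (qb e x - p x) * q x) = 0.
  move=> pq; have [w [pw hw]] := face_decomposition Ke pq m0.
  rewrite (pint_ext (FI e) (h := fun x => \sum_(v in val e)
      (qb e x - p x) * (bary (val K) v x * w v x))); last first.
    by move=> x ex; rewrite hw// mulr_sumr.
  rewrite (pint_sum (FI e)); first by apply: big1 => v ve; exact: vertex0.
  move=> v; apply: polonM => //; apply: polonM; last exact: pol_polon (pw v).
  exact: pol_polon (@pol_bary _ _ T (val K) v).
move=> x ex; apply/subr0_eq; rewrite -(pc x).
have /PolP[[b pb hb] _] := Pqb e.
have pbp : pol m (fun x => b x - p x) by exact: polB.
apply: (pint_sqr_eq0 (FI e) (qbp e)) x ex; apply: etrans (moment _ pbp).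
by apply: (pint_ext (FI e)) => x ex; rewrite hb// expr2.
Qed.

End pressure_cell.

Lemma pressure_definite (m : nat) (q : wfunS T) : (0 < m)%N -> Qh0 m q ->
  (forall K i p, pol m p -> gradf K (q.1 K) q.2 i p = 0) ->
  (forall K x, q.1 K x = 0) /\ (forall e x, q.2 e x = 0).
Proof.
move=> m0 [Pq Pb mean0] g0.
have /choice[c hc] : forall K, exists c,
    (forall x, celldom K x -> q.1 K x = c) /\
    forall e, incident K e -> forall x, facedom e x -> q.2 e x = c.
  by move=> K; exact: weak_pressure_gradient0 m0 (Pq K) Pb (g0 K).
have vc K e : incident K e -> forall x, facedom e x -> q.2 e x = c K.
  by case: (hc K) => _; exact.
have cc := constant_trace vc.
have [K0 _] := exists_cell O0 partT.
have c0 : c K0 = 0.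
  move: mean0; rewrite (eq_bigr (fun K => c K0 * cint K (fun=> 1))); last first.
    move=> K _; rewrite -(pintZ (CI K)); last exact: polon_cst.
    by apply: (pint_ext (CI K)) => x Kx; rewrite mulr1 (cc K0 K); case: (hc K) => ->.
  rewrite -mulr_sumr => /eqP; rewrite mulf_eq0 => /orP[/eqP //|].
  rewrite gt_eqF// (bigD1 K0)//= ltr_pwDl ?cint1_gt0// sumr_ge0// => K _.
  exact: ltW (cint1_gt0 K).
have c_eq0 K : c K = 0 by rewrite (cc K K0).
split=> [K x|e x].
  have [Kx|Kx] := pselect (celldom K x); first by case: (hc K) => -> // _; exact: c_eq0.
  by have /PolP[_ ->] := Pq K.
have [ex|ex] := pselect (facedom e x); last by have /PolP[_ ->] := Pb e.
by have [K Ke] := face_in_cell e; rewrite (vc K e Ke x ex).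
Qed.

End definiteness.

(** * Finite-dimensional spaces and forms *)

Section finite_dimension.
Context {R : realType}.

(** The generators need not belong to [E], nor [E] be a subspace: the notion then passes to any
    subset, in particular to spaces cut out by boundary or mean conditions. *)
Definition findim (W : lmodType R) (E : set W) : Prop :=
  exists (I : finType) (w : I -> W), forall u, E u -> exists c : I -> R, u = \sum_i c i *: w i.

Lemma findim_image (W W' : lmodType R) (E : set W) (E' : set W') (f : W -> W') :
  (forall a u v, f (a *: u + v) = a *: f u + f v) ->
  (forall u', E' u' -> exists2 u, E u & u' = f u) -> findim E -> findim E'.
Proof.
move=> flin Ef [I [w wE]]; exists I, (f \o w) => u' /Ef[u /wE[c ->] ->].
have f0 : f 0 = 0.
  by have := flin (-1) 0 0; rewrite scaler0 addr0 scaleN1r addNr.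
exists c; elim/big_rec2: _ => // i y1 y2 _ <-; exact: flin.
Qed.

Lemma findim_pair (W W' : lmodType R) (E : set W) (E' : set W') :
  findim E -> findim E' -> findim [set u : W * W' | E u.1 /\ E' u.2].
Proof.
move=> [I [w wE]] [I' [w' wE']].
exists (I + I')%type, (fun s => match s with inl i => (w i, 0) | inr i => (0, w' i) end).
move=> [u u'] /= [/wE[c ->] /wE'[c' ->]].
exists (fun s => match s with inl i => c i | inr i => c' i end).
rewrite big_sumType/=.
have -> : \sum_i c i *: (w i, 0 : W') = (\sum_i c i *: w i, 0).
  elim/big_rec2: _ => // i y1 y2 _ ->.
  by congr pair; rewrite /= scaler0 add0r.
have -> : \sum_i c' i *: (0 : W, w' i) = (0, \sum_i c' i *: w' i).
  elim/big_rec2: _ => // i y1 y2 _ ->.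
  by congr pair; rewrite /= scaler0 add0r.
by congr pair; rewrite /= ?addr0 ?add0r.
Qed.

(** A family of spaces has a different finite index type for each member; indexing by an initial
    segment of [nat] puts them into one type, so that [choice] applies. *)
Lemma findim_nat (W : lmodType R) (E : set W) : findim E -> exists Nw : nat * (nat -> W),
  forall u, E u -> exists c : nat -> R, u = \sum_(i < Nw.1) c i *: Nw.2 i.
Proof.
move=> [I [w wE]].
exists (#|I|, fun i => if insub i is Some j then w (enum_val (j : 'I_#|I|)) else 0) => u /wE[c ->] /=.
exists (fun i => if insub i is Some j then c (enum_val (j : 'I_#|I|)) else 0).
rewrite (reindex_onto enum_val enum_rank) => [|i _]; last exact: enum_rankK.
by apply: eq_big => [i|i _]; rewrite ?enum_valK ?eqxx// !valK.
Qed.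

Lemma findim_fun (X : finType) (W : lmodType R) (E : X -> set W) :
  (forall x, findim (E x)) -> findim [set u : X -> W | forall x, E x (u x)].
Proof.
move=> /(_ _)/findim_nat hE; have /choice[Nw hw] := hE.
exists {x : X & 'I_(Nw x).1}, (fun (s : {x : X & 'I_(Nw x).1}) y => if y == tag s then (Nw (tag s)).2 (tagged s) else 0).
move=> u /= uE.
have /choice[c hc] : forall x, exists c : nat -> R, u x = \sum_(i < (Nw x).1) c i *: (Nw x).2 i.
  by move=> x; exact: hw (uE x).
exists (fun s : {x : X & 'I_(Nw x).1} => c (tag s) (tagged s)); apply/funext => y.
rewrite hc fct_sumE -(@sig_big_dep _ _ _ X (fun x => 'I_(Nw x).1) xpredT (fun=> xpredT)
  (fun x i => (c x i *: (fun z => if z == x then (Nw x).2 i else 0) : X -> W) y))/=.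
rewrite (bigD1 y)//= [X in _ + X]big1 ?addr0 => [|x xy].
  by apply: eq_bigr => i _; rewrite /GRing.scale/= eqxx.
by apply: big1 => i _; rewrite /GRing.scale/= eq_sym (negPf xy) scaler0.
Qed.

Lemma findim_Pol n j (D : set 'rV[R]_n) : findim (Pol j D : set ('rV[R]_n -> R)).
Proof.
exists {ffun 'I_n -> 'I_j.+1}, (fun a : {ffun 'I_n -> 'I_j.+1} =>
  if (\sum_i a i <= j)%N then (fun x => \prod_i x 0 i ^+ a i) \_ D else 0).
have scE (c : R) (f : 'rV[R]_n -> R) x : (c *: f) x = c * f x by [].
move=> _ [p [c pc] <-]; exists c; apply/funext => x; rewrite fct_sumE patchE.
case: ifPn => [xD|xD].
  rewrite pc big_mkcond/=; apply: eq_bigr => a _.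
  by rewrite scE; case: ifP => _; rewrite ?patchE ?xD// mulr0.
rewrite big1// => a _; rewrite scE.
by case: ifP => _; rewrite ?patchE ?(negPf xD) mulr0.
Qed.

Lemma findim_PolV n j (D : set 'rV[R]_n) : findim (PolV j D : set ('rV[R]_n -> 'rV[R]_n)).
Proof.
pose f (g : 'I_n -> 'rV[R]_n -> R) (x : 'rV[R]_n) : 'rV[R]_n := \row_i g i x.
apply: (@findim_image _ _ _ _ f) (findim_fun (fun _ : 'I_n => findim_Pol j D)).
  by move=> a u v; apply/funext => x; apply/rowP => i; rewrite !mxE.
move=> u Pu; exists (fun i x => u x 0 i) => //.
by apply/funext => x; apply/rowP => i; rewrite mxE.
Qed.

Lemma findim_sub (W : lmodType R) (E F : set W) : E `<=` F -> findim F -> findim E.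
Proof. by move=> EF [I [w hw]]; exists I, w => u /EF; exact: hw. Qed.

Lemma findim_basis (W : lmodType R) (E : set W) : findim E -> E 0 ->
  exists N (b : 'I_N -> W),
  [/\ forall i, E (b i),
      forall c : 'rV[R]_N, \sum_i c 0 i *: b i = 0 -> c = 0 &
      forall u, E u -> exists c : 'rV[R]_N, u = \sum_i c 0 i *: b i].
Proof. by move=> [I [w hw]] E0; exact: exists_basis E0 hw. Qed.

End finite_dimension.

Section spaces.
Context {R : realType} {n : nat} {T : mesh R n}.
Variable Omega : set 'rV[R]_n.

Lemma findim_Vh0 m k : findim (Vh0 Omega m k : set (wfunV T)).
Proof.
apply: findim_sub (findim_pair (findim_fun (fun K : cell T => findim_PolV m (celldom K)))
  (findim_fun (fun e : face T => findim_PolV k (facedom e)))).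
by move=> u [].
Qed.

Lemma findim_Qh0 m : findim (@Qh0 R n T m).
Proof.
apply: findim_sub (findim_pair (findim_fun (fun K : cell T => findim_Pol m.-1 (celldom K)))
  (findim_fun (fun e : face T => findim_Pol m (facedom e)))).
by move=> u [].
Qed.

End spaces.

Section vector_valued.
Context {R : realType} {n : nat} (D : set 'rV[R]_n).
Implicit Types g h : 'rV[R]_n -> 'rV[R]_n.

Definition polonV g := forall i, polon D (fun x => g x 0 i).

Lemma polonV_dotv g h : polonV g -> polonV h -> polon D (fun x => dotv (g x) (h x)).
Proof. by move=> pg ph; apply: polon_sum => i; exact: polonM. Qed.

Lemma polonV_lin a g h : polonV g -> polonV h -> polonV (fun x => a *: g x + h x).
Proof.
move=> pg ph i; apply: polon_ext (polonD (polonZ a (pg i)) (ph i)) => x _.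
by rewrite !mxE.
Qed.

Lemma PolV_polonV j g : PolV j D g -> polonV g.
Proof. by move=> Pg i; exact: Pol_polon (Pg i). Qed.

Lemma PolV_lin j a g h : PolV j D g -> PolV j D h -> PolV j D (fun x => a *: g x + h x).
Proof.
move=> Pg Ph i; have := Pol_lin a (Pg i) (Ph i); congr (Pol _ _ _).
by apply/funext => x; rewrite !mxE.
Qed.

Lemma PolV0 j : PolV j D (fun=> 0).
Proof.
move=> i; rewrite (_ : (fun=> _) = (fun=> 0)); first exact: Pol0.
by apply/funext => x; rewrite mxE.
Qed.

End vector_valued.

Lemma sum_lin (R : comRingType) (I : Type) (s : seq I) (P : pred I) (a : R) (f g h : I -> R) :
  (forall i, P i -> f i = a * g i + h i) ->
  \sum_(i <- s | P i) f i = a * \sum_(i <- s | P i) g i + \sum_(i <- s | P i) h i.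
Proof. by move=> fE; rewrite (eq_bigr _ fE) big_split mulr_sumr. Qed.

Lemma rowP_lin (R : pzRingType) n a (x y z : 'rV[R]_n) :
  (forall i, x 0 i = a * y 0 i + z 0 i) -> x = a *: y + z.
Proof. by move=> h; apply/rowP => i; rewrite !mxE h. Qed.

Section forms.
Context {R : realType} {d : nat} {T : mesh R d.+1} {Omega : set 'rV[R]_d.+1}.
Hypothesis partT : partition_of T Omega.
Let mesh_nd := partition_nd partT.
Local Notation CI K := (cint_poly_integral mesh_nd K).
Local Notation FI e := (fint_poly_integral mesh_nd e).
Implicit Types (u v w kap : wfunV T) (p q : wfunS T).

(** Multilinearity of the forms is proved at this level, independently of degrees and boundary
    conditions. *)
Definition wpolV v := (forall K, polonV (celldom K) (v.1 K)) /\
  forall e, polonV (facedom e) (v.2 e).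

Definition wpolS q := (forall K, polon (celldom K) (q.1 K)) /\
  forall e, polon (facedom e) (q.2 e).

Lemma wpolV_lin a u v : wpolV u -> wpolV v -> wpolV (a *: u + v).
Proof.
by move=> [pu1 pu2] [pv1 pv2]; split=> [K|e]; exact: polonV_lin.
Qed.

Lemma Vh0_wpolV m k v : Vh0 Omega m k v -> wpolV v.
Proof. by move=> [P1 P2 _]; split=> [K|e]; [exact: PolV_polonV (P1 K)|exact: PolV_polonV (P2 e)]. Qed.

Lemma Qh0_wpolS m q : Qh0 m q -> wpolS q.
Proof. by move=> [P1 P2 _]; split=> [K|e]; [exact: Pol_polon (P1 K)|exact: Pol_polon (P2 e)]. Qed.

Lemma Vh0_lin m k a u v : Vh0 Omega m k u -> Vh0 Omega m k v -> Vh0 Omega m k (a *: u + v).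
Proof.
move=> [P1 P2 P3] [Q1 Q2 Q3]; split=> [K|e|e eb x ex]; [exact: PolV_lin|exact: PolV_lin|].
transitivity (a *: u.2 e x + v.2 e x); first by [].
by rewrite P3// Q3// scaler0 addr0.
Qed.

Lemma Vh0_0 m k : Vh0 Omega m k (0 : wfunV T).
Proof. by split=> [K|e|//]; exact: PolV0. Qed.

Lemma Qh0_lin m a p q : Qh0 m p -> Qh0 m q -> Qh0 m (a *: p + q).
Proof.
move=> Qp Qq; have [wp1 wp2] := Qh0_wpolS Qp; have [wq1 wq2] := Qh0_wpolS Qq.
move: Qp Qq => [P1 P2 P3] [Q1 Q2 Q3]; split=> [K|e|].
- exact: (Pol_lin a (P1 K) (Q1 K)).
- exact: (Pol_lin a (P2 e) (Q2 e)).
rewrite (@sum_lin _ _ _ _ a _ (fun K => cint K (p.1 K)) (fun K => cint K (q.1 K))).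
  by rewrite P3 Q3 mulr0 addr0.
by move=> K _; rewrite -(pint_lin (CI K)).
Qed.

Lemma Qh0_0 m : Qh0 m (0 : wfunS T).
Proof.
split=> [K|e|]; [exact: Pol0|exact: Pol0|].
by rewrite big1// => K _; exact: (pint0 (CI K)).
Qed.

Lemma wpolV_wpair v K i : wpolV v -> wpair K (fun y => v.1 K y 0 i) (fun e y => v.2 e y 0 i).
Proof. by move=> [p1 p2]; split=> [|e]; [exact: p1|exact: p2]. Qed.

Lemma wpolS_wpair q K : wpolS q -> wpair K (q.1 K) q.2.
Proof. by move=> [p1 p2]; split=> [|e]; [exact: p1|exact: p2]. Qed.

Lemma wpolV_face v K e i : wpolV v -> incident K e -> polon (facedom e) (fun y => v.1 K y 0 i).
Proof.
move=> [p1 _] Ke; have [j [p [pp vp]]] := p1 K i; exists j, p; split=> // x ex.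
by apply: vp; exact: (facedom_sub partT Ke).
Qed.

Lemma gradhE gam v K x i j :
  gradh gam v K x i j = wgrad gam K (fun y => v.1 K y 0 i) (fun e y => v.2 e y 0 i) x 0 j.
Proof. by rewrite mxE. Qed.

Lemma wfunV_coord1 a u v K i : (fun y => (a *: u + v).1 K y 0 i) =
  fun y => a * u.1 K y 0 i + v.1 K y 0 i.
Proof. by apply/funext => y; rewrite !mxE. Qed.

Lemma wfunV_coord2 a u v i : (fun e y => (a *: u + v).2 e y 0 i) =
  fun e y => a * u.2 e y 0 i + v.2 e y 0 i.
Proof. by apply/funext => e; apply/funext => y; rewrite !mxE. Qed.

Lemma gradh_lin gam a u v K x : wpolV u -> wpolV v ->
  gradh gam (a *: u + v) K x = a *: gradh gam u K x + gradh gam v K x.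
Proof.
move=> pu pv; apply/matrixP => i j; rewrite !mxE.
by rewrite wfunV_coord1 wfunV_coord2 wgrad_lin ?mxE//; exact: wpolV_wpair.
Qed.

Lemma polon_gradh gam v K i j : wpolV v -> polon (celldom K) (fun x => gradh gam v K x i j).
Proof.
move=> pv; have [Pw _] := wgradP mesh_nd gam (wpolV_wpair K i pv).
by apply: polon_ext (Pol_polon (Pw j)) => x _; rewrite gradhE.
Qed.

Lemma polon_frob gam u v K : wpolV u -> wpolV v ->
  polon (celldom K) (fun x => frob (gradh gam u K x) (gradh gam v K x)).
Proof.
move=> pu pv; apply: polon_sum => i; apply: polon_sum => j.
by apply: polonM; exact: polon_gradh.
Qed.

Lemma jump_lin k a u v K e x : wpolV u -> wpolV v -> incident K e ->
  jump k (a *: u + v) K e x = a *: jump k u K e x + jump k v K e x.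
Proof.
move=> pu pv Ke; apply/rowP => i; rewrite !mxE.
rewrite wfunV_coord1 projB_lin//; [by ring|exact: wpolV_face|exact: wpolV_face].
Qed.

Lemma polon_jump k v K e i : wpolV v -> incident K e ->
  polon (facedom e) (fun x => jump k v K e x 0 i).
Proof.
move=> pv Ke; have [Pp _] := projBP mesh_nd k (wpolV_face i pv Ke).
apply: polon_ext (polonD (Pol_polon Pp) (polonN (proj2 pv e i))) => x _.
by rewrite !mxE.
Qed.

Lemma frobC n (A B : 'M[R]_n) : frob A B = frob B A.
Proof. by apply: eq_bigr => i _; apply: eq_bigr => j _; exact: mulrC. Qed.

Lemma frob_lin n a (A B C : 'M[R]_n) : frob (a *: A + B) C = a * frob A C + frob B C.
Proof.
by apply: sum_lin => i _; apply: sum_lin => j _; rewrite !mxE mulrDl mulrA.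
Qed.

Definition grad_energy m u v : R :=
  \sum_(K : cell T) cint K (fun x => frob (gradh m.-1 u K x) (gradh m.-1 v K x)).

Definition jump_energy k u v : R :=
  \sum_(K : cell T) \sum_(e : face T | incident K e)
    fint e (fun x => (hK K)^-1 * dotv (jump k u K e x) (jump k v K e x)).

(** The inner product behind [normV]. As [ah] is [nu] times it, coercivity and continuity of [ah]
    both have the constant [nu]. *)
Definition energy m k u v : R := grad_energy m u v + jump_energy k u v.

Lemma ahE nu m k u v : ah nu m k u v = nu * energy m k u v.
Proof. by rewrite /energy mulrDr. Qed.

Lemma grad_energyC m u v : grad_energy m u v = grad_energy m v u.
Proof.
by apply: eq_bigr => K _; apply: (pint_ext (CI K)) => x _; exact: frobC.
Qed.

Lemma jump_energyC k u v : jump_energy k u v = jump_energy k v u.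
Proof.
apply: eq_bigr => K _; apply: eq_bigr => e _; apply: (pint_ext (FI e)) => x _.
by rewrite dotvC.
Qed.

Lemma energyC m k u v : energy m k u v = energy m k v u.
Proof. by rewrite /energy grad_energyC jump_energyC. Qed.

Lemma polon_jumpM k u v K e : wpolV u -> wpolV v -> incident K e ->
  polon (facedom e) (fun x => (hK K)^-1 * dotv (jump k u K e x) (jump k v K e x)).
Proof.
move=> pu pv Ke; apply: polonZ; apply: polonV_dotv => i; exact: polon_jump.
Qed.

Lemma grad_energy_lin m a u v w : wpolV u -> wpolV v -> wpolV w ->
  grad_energy m (a *: u + v) w = a * grad_energy m u w + grad_energy m v w.
Proof.
move=> pu pv pw.
apply: sum_lin => K _; rewrite -(pint_lin (CI K)); [|exact: polon_frob|exact: polon_frob].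
by apply: (pint_ext (CI K)) => x _; rewrite gradh_lin// frob_lin.
Qed.

Lemma jump_energy_lin k a u v w : wpolV u -> wpolV v -> wpolV w ->
  jump_energy k (a *: u + v) w = a * jump_energy k u w + jump_energy k v w.
Proof.
move=> pu pv pw; apply: sum_lin => K _; apply: sum_lin => e Ke.
rewrite -(pint_lin (FI e)); [|exact: polon_jumpM|exact: polon_jumpM].
by apply: (pint_ext (FI e)) => x _; rewrite jump_lin// dotvDl dotvZl; ring.
Qed.

Lemma energy_lin m k a u v w : wpolV u -> wpolV v -> wpolV w ->
  energy m k (a *: u + v) w = a * energy m k u w + energy m k v w.
Proof.
move=> pu pv pw; rewrite /energy (grad_energy_lin m a pu pv pw).
rewrite (jump_energy_lin k a pu pv pw) mulrDr.
exact: addrACA.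
Qed.

Lemma bh_linl m a u v q : wpolV u -> wpolV v -> wpolS q ->
  bh m (a *: u + v) q = a * bh m u q + bh m v q.
Proof.
move=> [pu _] [pv _] pq; apply: sum_lin => K _.
have [Pw _] := wgradP mesh_nd m (wpolS_wpair K pq).
rewrite -(pint_lin (CI K)); [|exact: polonV_dotv (PolV_polonV Pw) _|exact: polonV_dotv (PolV_polonV Pw) _].
by apply: (pint_ext (CI K)) => x _; rewrite dotvDr dotvZr.
Qed.

Lemma bh_linr m a v p q : wpolV v -> wpolS p -> wpolS q ->
  bh m v (a *: p + q) = a * bh m v p + bh m v q.
Proof.
move=> [pv _] pp pq; apply: sum_lin => K _.
have [Pw _] := wgradP mesh_nd m (wpolS_wpair K pq).
have [Pw' _] := wgradP mesh_nd m (wpolS_wpair K pp).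
rewrite -(pint_lin (CI K)); [|exact: polonV_dotv (PolV_polonV Pw') _|exact: polonV_dotv (PolV_polonV Pw) _].
apply: (pint_ext (CI K)) => x _.
have -> : wgrad m K ((a *: p + q).1 K) (a *: p + q).2 =
   (fun x => a *: wgrad m K (p.1 K) p.2 x + wgrad m K (q.1 K) q.2 x).
  exact: (wgrad_lin mesh_nd m a (wpolS_wpair K pp) (wpolS_wpair K pq)).
by rewrite dotvDl dotvZl.
Qed.

Lemma divtensorE gam u kap K x i : divtensor gam u kap K x 0 i =
  wdiv gam K (fun y => u.1 K y 0 i *: kap.1 K y) (fun e y => u.2 e y 0 i *: kap.2 e y) x.
Proof.
have tE (y z : 'rV[R]_d.+1) : row i (tensor y z) = y 0 i *: z.
  by apply/rowP => j; rewrite !mxE big_ord1 !mxE.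
rewrite mxE; congr (wdiv _ _ _ _ _).
  by apply/funext => y; rewrite tE.
by apply/funext => e; apply/funext => y; rewrite tE.
Qed.

Lemma wpolV_wpairV u kap K i : wpolV u -> wpolV kap ->
  wpairV K (fun y => u.1 K y 0 i *: kap.1 K y) (fun e y => u.2 e y 0 i *: kap.2 e y).
Proof.
move=> [u1 u2] [k1 k2] j; split=> [|e].
  by apply: polon_ext (polonM (u1 K i) (k1 K j)) => x _; rewrite mxE.
by apply: polon_ext (polonM (u2 e i) (k2 e j)) => x _; rewrite mxE.
Qed.

Lemma polonV_divtensor gam u kap K : wpolV u -> wpolV kap ->
  polonV (celldom K) (divtensor gam u kap K).
Proof.
move=> pu pk i; have [Pw _] := wdivP mesh_nd gam (wpolV_wpairV K i pu pk).
by apply: polon_ext (Pol_polon Pw) => x _; rewrite divtensorE.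
Qed.

Lemma divtensor_linl gam a u v kap K x : wpolV u -> wpolV v -> wpolV kap ->
  divtensor gam (a *: u + v) kap K x = a *: divtensor gam u kap K x + divtensor gam v kap K x.
Proof.
move=> pu pv pk; apply: rowP_lin => i; apply: etrans (divtensorE _ _ _ _ _ _) _.
apply: etrans (esym (congr2 (fun s t => a * s + t)
  (divtensorE gam u kap K x i) (divtensorE gam v kap K x i))).
rewrite (_ : (fun y => _) = fun y => a *: (u.1 K y 0 i *: kap.1 K y) + v.1 K y 0 i *: kap.1 K y).
  rewrite (_ : (fun e y => _) = fun e y => a *: (u.2 e y 0 i *: kap.2 e y) + v.2 e y 0 i *: kap.2 e y).
    by rewrite wdiv_lin//; exact: wpolV_wpairV.
  by apply/funext => e; apply/funext => y; rewrite scalerA -scalerDl !mxE.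
by apply/funext => y; rewrite scalerA -scalerDl !mxE.
Qed.

Lemma divtensor_linr gam a u kap kap' K x : wpolV u -> wpolV kap -> wpolV kap' ->
  divtensor gam u (a *: kap + kap') K x = a *: divtensor gam u kap K x + divtensor gam u kap' K x.
Proof.
move=> pu pk pk'; apply: rowP_lin => i; apply: etrans (divtensorE _ _ _ _ _ _) _.
apply: etrans (esym (congr2 (fun s t => a * s + t)
  (divtensorE gam u kap K x i) (divtensorE gam u kap' K x i))).
rewrite (_ : (fun y => _) = fun y => a *: (u.1 K y 0 i *: kap.1 K y) + u.1 K y 0 i *: kap'.1 K y).
  rewrite (_ : (fun e y => _) = fun e y => a *: (u.2 e y 0 i *: kap.2 e y) + u.2 e y 0 i *: kap'.2 e y).
    by rewrite wdiv_lin//; exact: wpolV_wpairV.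
  by apply/funext => e; apply/funext => y; apply/rowP => j; rewrite !mxE; ring.
by apply/funext => y; apply/rowP => j; rewrite !mxE; ring.
Qed.

Definition convection m kap u v : R :=
  \sum_(K : cell T) cint K (fun x => dotv (divtensor m u kap K x) (v.1 K x)).

Lemma convection_lin1 m a kap kap' u v : wpolV kap -> wpolV kap' -> wpolV u -> wpolV v ->
  convection m (a *: kap + kap') u v = a * convection m kap u v + convection m kap' u v.
Proof.
move=> pk pk' pu [pv _]; apply: sum_lin => K _.
rewrite -(pint_lin (CI K)); [|exact: polonV_dotv (polonV_divtensor _ _ pu _) _..].
by apply: (pint_ext (CI K)) => x _; rewrite divtensor_linr// dotvDl dotvZl.
Qed.

Lemma convection_lin2 m a kap u v w : wpolV kap -> wpolV u -> wpolV v -> wpolV w ->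
  convection m kap (a *: u + v) w = a * convection m kap u w + convection m kap v w.
Proof.
move=> pk pu pv [pw _]; apply: sum_lin => K _.
rewrite -(pint_lin (CI K)); [|exact: polonV_dotv (polonV_divtensor _ _ _ pk) _..].
by apply: (pint_ext (CI K)) => x _; rewrite divtensor_linl// dotvDl dotvZl.
Qed.

Lemma convection_lin3 m a kap u v w : wpolV kap -> wpolV u -> wpolV v -> wpolV w ->
  convection m kap u (a *: v + w) = a * convection m kap u v + convection m kap u w.
Proof.
move=> pk pu [pv _] [pw _]; apply: sum_lin => K _.
rewrite -(pint_lin (CI K)); [|exact: polonV_dotv (polonV_divtensor _ _ pu pk) _..].
by apply: (pint_ext (CI K)) => x _; rewrite dotvDr dotvZr.
Qed.

Lemma dhE m kap u v : dh m kap u v = 2^-1 * (convection m kap u v - convection m kap v u).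
Proof. by rewrite mulrBr. Qed.

Lemma dhC m kap u v : dh m kap u v = - dh m kap v u.
Proof. by rewrite !dhE -mulrN opprB. Qed.

Let half_lin (a x y x' y' : R) : 2^-1 * ((a * x + y) - (a * x' + y')) =
  a * (2^-1 * (x - x')) + 2^-1 * (y - y').
Proof. by ring. Qed.

Lemma dh_lin1 m a kap kap' u v : wpolV kap -> wpolV kap' -> wpolV u -> wpolV v ->
  dh m (a *: kap + kap') u v = a * dh m kap u v + dh m kap' u v.
Proof.
move=> pk pk' pu pv; apply: etrans (dhE _ _ _ _) _.
apply: etrans (congr2 (fun s t => 2^-1 * (s - t)) (convection_lin1 m a pk pk' pu pv)
  (convection_lin1 m a pk pk' pv pu)) _.
apply: etrans (half_lin _ _ _ _ _) _; apply: esym.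
exact: (congr2 (fun s t => a * s + t) (dhE m kap u v) (dhE m kap' u v)).
Qed.

Lemma dh_lin2 m a kap u v w : wpolV kap -> wpolV u -> wpolV v -> wpolV w ->
  dh m kap (a *: u + v) w = a * dh m kap u w + dh m kap v w.
Proof.
move=> pk pu pv pw; apply: etrans (dhE _ _ _ _) _.
apply: etrans (congr2 (fun s t => 2^-1 * (s - t)) (convection_lin2 m a pk pu pv pw)
  (convection_lin3 m a pk pw pu pv)) _.
apply: etrans (half_lin _ _ _ _ _) _; apply: esym.
exact: (congr2 (fun s t => a * s + t) (dhE m kap u w) (dhE m kap v w)).
Qed.

End forms.

(** * An abstract saddle point problem *)

Section combinations.
Context {R : realType} {W : lmodType R}.

Definition comb N (b : 'I_N -> W) (x : 'rV[R]_N) : W := \sum_i x 0 i *: b i.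

Lemma comb_lin N (b : 'I_N -> W) a x y : comb b (a *: x + y) = a *: comb b x + comb b y.
Proof.
rewrite /comb scaler_sumr -big_split/=; apply: eq_bigr => i _.
by rewrite !mxE scalerDl scalerA.
Qed.

Lemma combB N (b : 'I_N -> W) x y : comb b (x - y) = comb b x - comb b y.
Proof. by rewrite (addrC x) -(scaleN1r y) comb_lin scaleN1r addrC. Qed.

Lemma comb0 N (b : 'I_N -> W) : comb b 0 = 0.
Proof. by rewrite /comb big1// => i _; rewrite mxE scale0r. Qed.

Lemma comb_mem (X : set W) N (b : 'I_N -> W) x : X 0 ->
  (forall a u v, X u -> X v -> X (a *: u + v)) -> (forall i, X (b i)) -> X (comb b x).
Proof.
move=> X0 Xlin Xb; rewrite /comb; elim/big_rec: _ => // i y _ Xy; exact: Xlin.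
Qed.

Lemma comb_linear (X : set W) N (b : 'I_N -> W) (f : W -> R) x : X 0 ->
  (forall a u v, X u -> X v -> X (a *: u + v)) -> (forall i, X (b i)) ->
  (forall a u v, X u -> X v -> f (a *: u + v) = a * f u + f v) ->
  f (comb b x) = \sum_i x 0 i * f (b i).
Proof.
move=> X0 Xlin Xb flin.
have f0 : f 0 = 0.
  by have := flin (-1) 0 0 X0 X0; rewrite scaler0 addr0 mulN1r addNr.
suff [_ ->] : X (comb b x) /\ f (comb b x) = \sum_i x 0 i * f (b i) by [].
rewrite /comb; elim/big_rec2: _ => // i y1 y2 _ [Xy <-].
by split; [exact: Xlin|rewrite flin].
Qed.

End combinations.

Section saddle_point.
Context {R : realType} {W Q : lmodType R}.
Variables (X : set W) (Y : set Q).
Hypotheses (Xfin : findim X) (X0 : X 0)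
  (Xlin : forall a u v, X u -> X v -> X (a *: u + v)).
Hypotheses (Yfin : findim Y) (Y0 : Y 0)
  (Ylin : forall a p q, Y p -> Y q -> Y (a *: p + q)).
Variables (E : W -> W -> R) (b : W -> Q -> R) (c dd : W -> W -> W -> R) (l : W -> R) (nu : R).
Hypotheses (nu0 : 0 < nu)
  (EC : forall u v, X u -> X v -> E u v = E v u)
  (Elin : forall a u v w, X u -> X v -> X w -> E (a *: u + v) w = a * E u w + E v w)
  (E_ge0 : forall u, X u -> 0 <= E u u)
  (E_eq0 : forall u, X u -> E u u = 0 -> u = 0).
Hypotheses (blinl : forall a u v q, X u -> X v -> Y q -> b (a *: u + v) q = a * b u q + b v q)
  (blinr : forall a v p q, X v -> Y p -> Y q -> b v (a *: p + q) = a * b v p + b v q)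
  (b_eq0 : forall q, Y q -> (forall v, X v -> b v q = 0) -> q = 0).
Hypotheses (clin : forall a k u v w, X k -> X u -> X v -> X w ->
    c k u (a *: v + w) = a * c k u v + c k u w)
  (c_mono : forall u v, X u -> X v -> 0 <= c u u (u - v) - c v v (u - v))
  (c_ge0 : forall u, X u -> 0 <= c u u u)
  (c_lip : forall N (e : 'I_N -> W) M, (forall i, X (e i)) -> exists2 C, 0 <= C &
    forall x y z : 'rV[R]_N, `|x| <= M -> `|y| <= M ->
    `|c (comb e x) (comb e x) (comb e z) - c (comb e y) (comb e y) (comb e z)| <=
      C * `|x - y| * `|z|).
Hypotheses (dlin1 : forall a k k' u v, X k -> X k' -> X u -> X v ->
    dd (a *: k + k') u v = a * dd k u v + dd k' u v)
  (dlin2 : forall a k u v w, X k -> X u -> X v -> X w ->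
    dd k (a *: u + v) w = a * dd k u w + dd k v w)
  (dC : forall k u v, dd k u v = - dd k v u).
Hypothesis (llin : forall a u v, X u -> X v -> l (a *: u + v) = a * l u + l v).

Definition kernel : set W := [set v | X v /\ forall q, Y q -> b v q = 0].
Definition enrm v : R := Num.sqrt (E v v).
(** Written so that it unfolds to [Nh] once [kernel] is [V0h]; like [Nh], it is a supremum over
    nonzero arguments without absolute values. *)
Definition trilinear_norm : R :=
  sup [set y | exists k u v, [/\ kernel k /\ k <> 0, kernel u /\ u <> 0,
    kernel v /\ v <> 0 & y = dd k u v / (enrm k * enrm u * enrm v)]].
Definition linear_norm : R :=
  sup [set y | exists v, [/\ kernel v, v <> 0 & y = l v / enrm v]].

Local Notation Z := kernel.
Local Notation NN := trilinear_norm.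
Local Notation FF := linear_norm.

Lemma dlin3 a k u v w : X k -> X u -> X v -> X w ->
  dd k u (a *: v + w) = a * dd k u v + dd k u w.
Proof. by move=> *; rewrite dC dlin2// dC [dd k w u]dC; ring. Qed.

Lemma kernel0 : Z 0.
Proof.
split=> // q Yq; have := blinl (-1) X0 X0 Yq.
by rewrite scaler0 addr0 mulN1r addNr.
Qed.

Lemma kernel_lin a u v : Z u -> Z v -> Z (a *: u + v).
Proof.
move=> [Xu bu] [Xv bv]; split=> [|q Yq]; first exact: Xlin.
by rewrite blinl// bu// bv// mulr0 addr0.
Qed.

Lemma kernelX v : Z v -> X v. Proof. by case. Qed.

Section bounds.
Variables (N : nat) (e : 'I_N -> W).
Hypotheses (Ze : forall i, Z (e i))
  (e_free : forall x : 'rV[R]_N, comb e x = 0 -> x = 0)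
  (e_span : forall u, Z u -> exists x, u = comb e x).

Let Zc x : Z (comb e x).
Proof. exact: comb_mem kernel0 kernel_lin Ze. Qed.
Let Xc x : X (comb e x). Proof. exact: kernelX (Zc x). Qed.

Let A (x y : 'rV[R]_N) := E (comb e x) (comb e y).

Let AC x y : A x y = A y x. Proof. by rewrite /A EC. Qed.
Let Alin a x y z : A (a *: x + y) z = a * A x z + A y z.
Proof. by rewrite /A comb_lin Elin. Qed.
Let A_ge0 x : 0 <= A x x. Proof. exact: E_ge0. Qed.
Let A_eq0 x : A x x = 0 -> x = 0.
Proof. by move=> /E_eq0 h; exact/e_free/h. Qed.

Let nrm := formnorm A.

Let nrm2 x : nrm x ^+ 2 = A x x. Proof. by rewrite sqr_sqrtr. Qed.

(** Expansion in the basis. The bound makes the supremum that defines [trilinear_norm] finite,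
    without which [sup] would carry no information. *)
Lemma trilinear_bounded : exists2 C, 0 <= C & forall x y z,
  `|dd (comb e x) (comb e y) (comb e z)| <= C * `|x| * `|y| * `|z|.
Proof.
exists (\sum_i \sum_j \sum_k `|dd (e i) (e j) (e k)|) => [|x y z].
  by do 3![apply: sumr_ge0 => ? _].
have Xe i : X (e i) by exact: kernelX.
have -> : dd (comb e x) (comb e y) (comb e z) =
    \sum_i \sum_j \sum_k x 0 i * (y 0 j * (z 0 k * dd (e i) (e j) (e k))).
  rewrite (comb_linear (f := fun k => dd k (comb e y) (comb e z)) x X0 Xlin Xe); last first.
    by move=> *; exact: dlin1.
  apply: eq_bigr => i _.
  rewrite (comb_linear (f := fun u => dd (e i) u (comb e z)) y X0 Xlin Xe); last first.
    by move=> *; exact: dlin2.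
  rewrite mulr_sumr; apply: eq_bigr => j _.
  rewrite (comb_linear (f := fun u => dd (e i) (e j) u) z X0 Xlin Xe); last first.
    by move=> *; exact: dlin3.
  by rewrite !mulr_sumr.
rewrite !mulr_suml; apply: (le_trans (ler_norm_sum _ _ _)); apply: ler_sum => i _.
rewrite !mulr_suml; apply: (le_trans (ler_norm_sum _ _ _)); apply: ler_sum => j _.
rewrite !mulr_suml; apply: (le_trans (ler_norm_sum _ _ _)); apply: ler_sum => k _.
rewrite !normrM [leRHS](_ : _ = `|x| * (`|y| * (`|z| * `|dd (e i) (e j) (e k)|))); last by ring.
do 3![apply: ler_pM; rewrite ?mulr_ge0 ?ler_coord_norm//].
Qed.

Lemma enrm_comb x : enrm (comb e x) = nrm x. Proof. by []. Qed.

Let enrm_gt0 v : Z v -> v <> 0 -> 0 < enrm v.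
Proof.
move=> Zv v0; rewrite sqrtr_gt0 lt_def E_ge0 ?andbT; last exact: kernelX.
by apply/eqP => /E_eq0 => h; apply/v0/h/kernelX.
Qed.

Let enrm0 : enrm 0 = 0.
Proof.
have := Elin (-1) X0 X0 X0; rewrite scaler0 addr0 mulN1r addNr /enrm => ->.
by rewrite sqrtr0.
Qed.

Let l0 : l 0 = 0.
Proof. by have := llin (-1) X0 X0; rewrite scaler0 addr0 mulN1r addNr. Qed.

Let enrmN v : Z v -> enrm (- v) = enrm v.
Proof.
move=> /e_span[x ->]; have N1 : - comb e x = comb e (- x).
  by rewrite -[RHS](congr1 _ (sub0r x)) combB comb0 sub0r.
by rewrite N1 !enrm_comb /nrm (formnormN AC Alin).
Qed.

Let dd0 k u v : Z k -> Z u -> Z v -> k = 0 \/ u = 0 \/ v = 0 -> dd k u v = 0.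
Proof.
move=> /kernelX Xk /kernelX Xu /kernelX Xv [->|[->|->]].
- by have := dlin1 (-1) X0 X0 Xu Xv; rewrite scaler0 addr0 mulN1r addNr.
- by have := dlin2 (-1) Xk X0 X0 Xv; rewrite scaler0 addr0 mulN1r addNr.
- by have := dlin3 (-1) Xk Xu X0 X0; rewrite scaler0 addr0 mulN1r addNr.
Qed.

(** The supremum bounds [dd] from above only; exchanging [u] and [v] changes the sign by
    skew-symmetry and gives the lower bound. Zero arguments, excluded from the supremum, make [dd]
    vanish. *)
Lemma trilinear_normP k u v : Z k -> Z u -> Z v ->
  `|dd k u v| <= NN * (enrm k * enrm u * enrm v).
Proof.
move=> Zk Zu Zv; have [C C0 hC] := trilinear_bounded.
have [n0 n00 hn] := norm_le_formnorm AC Alin A_ge0 A_eq0.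
have ub : has_ubound [set y | exists k u v, [/\ kernel k /\ k <> 0, kernel u /\ u <> 0,
    kernel v /\ v <> 0 & y = dd k u v / (enrm k * enrm u * enrm v)]].
  exists (C * n0 * n0 * n0) => _ [k' [u' [v' [[Zk' k0] [Zu' u0] [Zv' v0] ->]]]].
  rewrite ler_pdivrMr ?mulr_gt0 ?enrm_gt0//.
  move: (Zk') (Zu') (Zv') => /e_span[x ->] /e_span[y ->] /e_span[z ->].
  rewrite !enrm_comb; apply: (le_trans (ler_norm _)); apply: (le_trans (hC x y z)).
  rewrite [leRHS](_ : _ = C * (n0 * nrm x) * (n0 * nrm y) * (n0 * nrm z)); last by ring.
  do 2![apply: ler_pM; rewrite ?mulr_ge0 ?normr_ge0 ?hn//].
  by apply: ler_wpM2l; rewrite ?hn.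
have bound k' u' v' : Z k' -> Z u' -> Z v' -> k' <> 0 -> u' <> 0 -> v' <> 0 ->
    dd k' u' v' <= NN * (enrm k' * enrm u' * enrm v').
  move=> Zk' Zu' Zv' k0 u0 v0; rewrite -ler_pdivrMr ?mulr_gt0 ?enrm_gt0//.
  by apply: ub_le_sup => //; exists k', u', v'.
have [kuv0|/not_orP[k0 /not_orP[u0 v0]]] := pselect (k = 0 \/ u = 0 \/ v = 0).
  rewrite dd0// normr0; case: kuv0 => [->|[->|->]];
  by rewrite enrm0 ?(mul0r, mulr0).
rewrite ler_norml bound// andbT lerNl -dC.
rewrite (_ : enrm k * enrm u * enrm v = enrm k * enrm v * enrm u); last by ring.
exact: bound.
Qed.

(** A trivial kernel falls back on [sup set0 = 0]; otherwise any nonzero [v] bounds an absolute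
    value by [NN] times a positive number. *)
Lemma trilinear_norm_ge0 : 0 <= NN.
Proof.
have [[v [Zv v0]]|h] := pselect (exists v, Z v /\ v <> 0); last first.
  rewrite /trilinear_norm (_ : mkset _ = set0) ?sup0//.
  apply/seteqP; split=> // y [k [_ [_ [[Zk k0] _ _ _]]]].
  by apply: h; exists k.
have := trilinear_normP Zv Zv Zv; rewrite -(pmulr_lge0 NN (_ : 0 < enrm v * enrm v * enrm v)).
  exact: le_trans.
by rewrite !mulr_gt0// enrm_gt0.
Qed.

Lemma linear_normP v : Z v -> `|l v| <= FF * enrm v.
Proof.
move=> Zv; have [n0 n00 hn] := norm_le_formnorm AC Alin A_ge0 A_eq0.
have Xe i : X (e i) by exact: kernelX.
have lE x : l (comb e x) = \sum_i x 0 i * l (e i) by apply: comb_linear Xlin Xe _.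
have ub : has_ubound [set y | exists v, [/\ kernel v, v <> 0 & y = l v / enrm v]].
  exists ((\sum_i `|l (e i)|) * n0) => _ [w [Zw w0 ->]].
  rewrite ler_pdivrMr ?enrm_gt0//; move: (Zw) => /e_span[x ->].
  rewrite enrm_comb lE; apply: (le_trans (ler_norm _)); apply: (le_trans (ler_norm_sum _ _ _)).
  rewrite -mulrA mulr_suml; apply: ler_sum => i _; rewrite normrM mulrC.
  by apply: ler_wpM2l => //; apply: le_trans (hn x); exact: ler_coord_norm.
have bound w : Z w -> w <> 0 -> l w <= FF * enrm w.
  move=> Zw w0; rewrite -ler_pdivrMr ?enrm_gt0//.
  by apply: ub_le_sup => //; exists w.
have [->|v0] := pselect (v = 0).
  by rewrite l0 enrm0 normr0 mulr0.
have N1 : - v = (-1) *: v + 0 by rewrite addr0 scaleN1r.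
have lN : l (- v) = - l v by rewrite N1 (llin _ (kernelX Zv) X0) l0 addr0 mulN1r.
rewrite ler_norml bound// andbT lerNl -lN -(enrmN Zv); apply: bound.
  by rewrite N1; exact: kernel_lin kernel0.
by move=> /eqP; rewrite oppr_eq0 => /eqP.
Qed.

Lemma linear_norm_ge0 : 0 <= FF.
Proof.
have [[v [Zv v0]]|h] := pselect (exists v, Z v /\ v <> 0); last first.
  rewrite /linear_norm (_ : mkset _ = set0) ?sup0//.
  apply/seteqP; split=> // y [k [Zk k0 _]].
  by apply: h; exists k.
have := linear_normP Zv; rewrite -(pmulr_lge0 FF (enrm_gt0 Zv v0)).
exact: le_trans.
Qed.

Let P (x v : 'rV[R]_N) : R :=
  nu * A x v + c (comb e x) (comb e x) (comb e v) + dd (comb e x) (comb e x) (comb e v)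
  - l (comb e v).

Let dd_diff u v w : X u -> X v -> X w -> dd u u w - dd v v w = dd u (u - v) w + dd (u - v) v w.
Proof.
move=> Xu Xv Xw; have BE y z : y - z = (-1) *: z + y :> W by rewrite scaleN1r addrC.
by rewrite BE (dlin2 _ Xu Xv Xu Xw) (dlin1 _ Xv Xu Xv Xw); ring.
Qed.

Let dd_skew u v : dd u v v = 0.
Proof. by have := dC u v v => h; lra. Qed.

(** Tested with the difference, the convection terms differ by two parts, one of which has equal
    last arguments and vanishes by skew-symmetry; the other costs at most [NN rho] times the energy,
    and the monotone damping only helps. *)
Let strong rho x y : nrm x <= rho -> nrm y <= rho ->
  (nu - NN * rho) * A (x - y) (x - y) <= P x (x - y) - P y (x - y).
Proof.
move=> hx hy; have NN0 := trilinear_norm_ge0.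
have PE : P x (x - y) - P y (x - y) = nu * A (x - y) (x - y) +
    (c (comb e x) (comb e x) (comb e x - comb e y) - c (comb e y) (comb e y) (comb e x - comb e y)) +
    dd (comb e (x - y)) (comb e y) (comb e (x - y)).
  have h := dd_diff (Xc x) (Xc y) (Xc (x - y)).
  have hA : A x (x - y) - A y (x - y) = A (x - y) (x - y).
    by rewrite -(formNl Alin) -(formDl Alin).
  move: h; rewrite -!combB dd_skew add0r => <-; rewrite -hA /P; ring.
have := c_mono (Xc x) (Xc y).
have := trilinear_normP (Zc (x - y)) (Zc y) (Zc (x - y)).
rewrite ler_norml PE => /andP[+ _].
rewrite !enrm_comb.
have : NN * (nrm (x - y) * nrm y * nrm (x - y)) <= NN * rho * A (x - y) (x - y).
  rewrite -nrm2 expr2 -!mulrA; apply: ler_wpM2l => //.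
  rewrite mulrCA; apply: ler_wpM2r => //; rewrite mulr_ge0//; exact: formnorm_ge0.
by rewrite mulrBl; lra.
Qed.

Lemma saddle_velocity : NN / nu ^+ 2 * FF < 1 ->
  exists u, [/\ Z u,
    forall v, Z v -> nu * E u v + c u u v + dd u u v = l v &
    forall u', Z u' -> (forall v, Z v -> nu * E u' v + c u' u' v + dd u' u' v = l v) -> u' = u].
Proof.
move=> small; have NN0 := trilinear_norm_ge0; have FF0 := linear_norm_ge0.
have [rho [rho0 Frho Nrho]] : exists rho, [/\ 0 < rho, FF < nu * rho & NN * rho < nu].
  have sm : NN * FF < nu ^+ 2.
    by move: small; rewrite mulrAC ltr_pdivrMr ?mul1r// exprn_gt0.
  (* A point between [FF / nu] and [nu / NN] that avoids dividing by [NN], which may be 0: [FF] is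
     increased by the gap [nu^2 - NN FF] times [1 / (2 (NN + nu))], a factor below [1 / NN] when
     [NN] is positive. *)
  exists ((FF + (nu ^+ 2 - NN * FF) / (2 * (NN + nu))) / nu).
  have d0 : 0 < (nu ^+ 2 - NN * FF) / (2 * (NN + nu)).
    by rewrite divr_gt0 ?subr_gt0// mulr_gt0// ltr_wpDl.
  split.
  - by rewrite divr_gt0// ltr_wpDl.
  - by rewrite mulrC divfK ?gt_eqF// ltrDl.
  - rewrite mulrA ltr_pdivrMr// mulrDr -expr2 -ltrBrDl.
    rewrite mulrA ltr_pdivrMr; last by rewrite mulr_gt0// ltr_wpDl.
    rewrite [ltLHS]mulrC ltr_pM2l ?subr_gt0//.
    by rewrite mulr_natl mulr2n -[ltLHS]addr0 ltr_leD ?ltrDl// addr_ge0// ltW.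
have eqP_ x v : P x v = 0 <-> nu * E (comb e x) (comb e v) + c (comb e x) (comb e x) (comb e v)
    + dd (comb e x) (comb e x) (comb e v) = l (comb e v).
  by rewrite /P; split=> [/subr0_eq|->//]; rewrite ?subrr.
have uniq x y : nrm x <= rho -> nrm y <= rho -> (forall v, P x v = 0) ->
    (forall v, P y v = 0) -> x = y.
  move=> hx hy Px Py; apply/subr0_eq/A_eq0/eqP; rewrite eq_le A_ge0 andbT.
  have := strong hx hy; rewrite Px Py subrr.
  by rewrite pmulr_rle0// subr_gt0.
(* Testing with the solution itself removes the convection, and the damping has a sign:
   [nu nrm^2 <= FF nrm], so every solution lies in the ball where [uniq] applies. *)
have small_sol x : (forall v, P x v = 0) -> nrm x <= rho.
  move=> Px; have /eqP := Px x; rewrite /P dd_skew addr0 subr_eq0 => /eqP h.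
  have := linear_normP (Zc x); rewrite -h ger0_norm; last first.
    by rewrite addr_ge0 ?c_ge0// mulr_ge0// ltW.
  have c0 := c_ge0 (Xc x); rewrite enrm_comb => h1.
  have : nu * nrm x ^+ 2 <= FF * nrm x.
    by rewrite nrm2; apply: le_trans h1; rewrite lerDl.
  move=> h2; rewrite leNgt; apply/negP => hr.
  have nx0 : 0 < nrm x by exact: lt_trans hr.
  move: h2; rewrite expr2 mulrA ler_pM2r// leNgt => /negP; apply.
  by apply: lt_trans Frho _; rewrite ltr_pM2l.
have [x hx Px] : exists2 x, nrm x <= rho & forall v, P x v = 0.
  have [n0 n00 hn] := norm_le_formnorm AC Alin A_ge0 A_eq0.
  have Xe i : X (e i) by exact: kernelX.
  have [C C0 hC] := c_lip (n0 * rho) Xe.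
  have hnr z : nrm z <= rho -> `|z| <= n0 * rho.
    by move=> hz; apply: le_trans (hn z) _; apply: ler_wpM2l.
  (* [Lam] collects the Lipschitz constants: [nu] from the energy, [C n0^2] from the damping after
     passing from the sup norm to [nrm], and [NN rho] for each half of the convection difference. *)
  apply: (form_monotone_zero AC Alin A_ge0 A_eq0 (delta := nu - NN * rho)
    (Lam := nu + C * n0 * n0 + NN * rho *+ 2) rho0).
  - by rewrite subr_gt0.
  - move=> z a v w; rewrite /P comb_lin (formDr AC Alin) (formZr AC Alin).
    rewrite clin// dlin3// llin//; ring.
  - by move=> z w; exact: strong.
  - move=> z w v hz hw.
    have -> : P z v - P w v = nu * A (z - w) v +
      (c (comb e z) (comb e z) (comb e v) - c (comb e w) (comb e w) (comb e v)) +
      (dd (comb e z) (comb e (z - w)) (comb e v) + dd (comb e (z - w)) (comb e w) (comb e v)).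
      have h := dd_diff (Xc z) (Xc w) (Xc v).
      have hA : A z v - A w v = A (z - w) v by rewrite -(formNl Alin) -(formDl Alin).
      by rewrite combB -h -hA /P; ring.
    have h1 := trilinear_normP (Zc z) (Zc (z - w)) (Zc v).
    have h2 := trilinear_normP (Zc (z - w)) (Zc w) (Zc v).
    have h3 := hC z w v (hnr _ hz) (hnr _ hw).
    have h4 := form_CS_norm AC Alin A_ge0 A_eq0 (z - w) v.
    rewrite -/nrm in h4; rewrite !enrm_comb in h1 h2.
    have zw0 : 0 <= nrm (z - w) := formnorm_ge0 A _.
    have v0 : 0 <= nrm v := formnorm_ge0 A _.
    have zwv : 0 <= nrm (z - w) * nrm v by rewrite mulr_ge0.
    have h1' : NN * (nrm z * nrm (z - w) * nrm v) <= NN * rho * (nrm (z - w) * nrm v).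
      by rewrite -!mulrA; apply: ler_wpM2l => //; apply: ler_wpM2r.
    have h2' : NN * (nrm (z - w) * nrm w * nrm v) <= NN * rho * (nrm (z - w) * nrm v).
      rewrite -!mulrA; apply: ler_wpM2l => //; rewrite mulrCA; exact: ler_wpM2r.
    have h3' : C * `|z - w| * `|v| <= C * n0 * n0 * (nrm (z - w) * nrm v).
      rewrite [leRHS](_ : _ = C * ((n0 * nrm (z - w)) * (n0 * nrm v))); last by ring.
      by rewrite -mulrA; apply: ler_wpM2l => //; apply: ler_pM => //; exact: hn.
    have h5 : `|nu * A (z - w) v| <= nu * (nrm (z - w) * nrm v).
      by rewrite normrM gtr0_norm//; apply: ler_wpM2l => //; exact: ltW.
    rewrite -mulrA; apply: (le_trans (ler_normD _ _)); rewrite !mulrDl.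
    apply: lerD; first by apply: (le_trans (ler_normD _ _)); apply: lerD => //; exact: le_trans h3'.
    apply: (le_trans (ler_normD _ _)).
    by apply: lerD; [exact: le_trans h1'|exact: le_trans h2'].
  - move=> z; rewrite -/nrm => zr; rewrite /P dd_skew addr0 -nrm2 zr.
    have h := linear_normP (Zc z); rewrite enrm_comb zr in h.
    have h' : l (comb e z) <= FF * rho by exact: le_trans (ler_norm _) h.
    have h2 : FF * rho < nu * rho ^+ 2 by rewrite expr2 mulrA ltr_pM2r.
    have := c_ge0 (Xc z); lra.
exists (comb e x); split=> [|v /e_span[y ->]|u' /e_span[y ->] h]; first exact: Zc.
  exact/eqP_.
have Py v : P y v = 0 by apply/eqP_/h.
by rewrite (uniq y x)//; exact: small_sol.
Qed.

End bounds.

(* On the ball of radius [rho] with [FF / nu < rho < nu / NN], skew-symmetry of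
   [dd] makes the problem on the kernel strongly monotone with constant
   [nu - NN rho], and every solution lies in that ball; the pressure is then a
   multiplier for the constraint defining the kernel. *)
Theorem saddle_point_unique : NN / nu ^+ 2 * FF < 1 ->
  exists! up : W * Q, [/\ X up.1, Y up.2,
    forall v, X v -> nu * E up.1 v + b v up.2 + c up.1 up.1 v + dd up.1 up.1 v = l v &
    forall q, Y q -> b up.1 q = 0].
Proof.
move=> small.
have [N [e [Ze ef es]]] : exists N (e : 'I_N -> W), [/\ forall i, Z (e i),
    forall x : 'rV[R]_N, comb e x = 0 -> x = 0 & forall u, Z u -> exists x, u = comb e x].
  have Zfin : findim Z by apply: findim_sub Xfin => v [].
  exact: findim_basis Zfin kernel0.
have [u [Zu uE uniq]] := saddle_velocity Ze ef es small.
have Xu := kernelX Zu.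
have [M [g [Xg gf gs]]] := findim_basis Xfin X0.
have [K [q [Yq qf qs]]] := findim_basis Yfin Y0.
pose L v := l v - (nu * E u v + c u u v + dd u u v).
have Llin a v w : X v -> X w -> L (a *: v + w) = a * L v + L w.
  move=> Xv Xw; rewrite /L llin// EC ?Elin ?clin ?dlin3//; last exact: Xlin.
  by rewrite (EC Xu Xv) (EC Xu Xw); ring.
have bq v : X v -> (forall i, b v (q i) = 0) -> forall p, Y p -> b v p = 0.
  move=> Xv h p /qs[x ->]; rewrite -/(comb q x).
  rewrite (comb_linear (f := b v) x Y0 Ylin Yq); first by rewrite big1// => i _; rewrite h mulr0.
  by move=> a p' q' Yp' Yq'; exact: blinr.
(* Solvability for the pressure: coefficients annihilated by the matrix describe a velocity [v] in
   the kernel, and there the residual [L] vanishes by the velocity equation. *)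
have [x hx|x hx] := @fredholm_row _ K M (\matrix_(i, j) b (g j) (q i)) (\row_j L (g j)).
  pose v := comb g x^T.
  have Xv : X v by exact: comb_mem.
  have bv i : b v (q i) = 0.
    rewrite /v (comb_linear (f := fun v => b v (q i)) _ X0 Xlin Xg); last first.
      by move=> a v' w Xv' Xw; exact: blinl.
    have /colP/(_ i) := hx; rewrite !mxE => h; apply: etrans h; apply: eq_bigr => j _.
    by rewrite !mxE mulrC.
  have Lv : L v = 0.
    by rewrite /L uE ?subrr//; split=> // p; exact: bq.
  apply/matrixP => i j; rewrite !ord1 mxE [RHS]mxE; apply: etrans Lv.
  rewrite /v (comb_linear _ X0 Xlin Xg Llin); apply: eq_bigr => k _.
  by rewrite !mxE mulrC.
pose p := comb q x.
have Yp : Y p by exact: comb_mem.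
have bp v : X v -> b v p = L v.
  move=> /gs[y ->]; rewrite -/(comb g y) (comb_linear _ X0 Xlin Xg Llin).
  rewrite (comb_linear (f := fun v => b v p) _ X0 Xlin Xg); last first.
    by move=> a v' w Xv' Xw; exact: blinl.
  apply: eq_bigr => j _; congr (_ * _).
  rewrite (comb_linear (f := b (g j)) x Y0 Ylin Yq); last first.
    by move=> a p' q' Yp' Yq'; exact: blinr.
  have /rowP/(_ j) := hx; rewrite !mxE => <-; apply: eq_bigr => i _.
  by rewrite mxE.
exists (u, p); split.
  split=> //= [v Xv|]; last by case: Zu.
  by rewrite bp// /L; ring.
move=> [u' p'] /= [Xu' Yp' eq' div'].
have Zu' : Z u' by split.
(* Tested within the kernel, the pressure term drops out, so [u'] solves the reduced equation. *)
have uu : u' = u.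
  apply: uniq => // v [Xv bv]; have := eq' v Xv; rewrite bv// => <-; ring.
congr pair => //; apply/subr0_eq.
have pE : p - p' = (-1) *: p' + p by rewrite scaleN1r addrC.
rewrite pE; apply: b_eq0 => [|v Xv]; first exact: Ylin.
rewrite blinr// bp// /L -(eq' v Xv) uu; ring.
Qed.

End saddle_point.

(** * The damping term and the load *)

Section power_law.
Context {R : realType} {n : nat}.
Implicit Types x y z : 'rV[R]_n.

Let dotv_lin (a : R) x y z : dotv (a *: x + y) z = a * dotv x z + dotv y z.
Proof. by rewrite dotvDl dotvZl. Qed.

Lemma enorm_ge0 x : 0 <= enorm x. Proof. exact: sqrtr_ge0. Qed.

Lemma sqr_enorm x : enorm x ^+ 2 = dotv x x.
Proof. by rewrite sqr_sqrtr// dotv_ge0. Qed.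

Lemma dotv_le_enorm x y : `|dotv x y| <= enorm x * enorm y.
Proof. exact: (form_CS_norm (@dotvC _ _) dotv_lin (@dotv_ge0 _ _) (@dotv_eq0 _ _)). Qed.

Lemma enormD x y : enorm (x + y) <= enorm x + enorm y.
Proof. exact: (formnormD (@dotvC _ _) dotv_lin (@dotv_ge0 _ _) (@dotv_eq0 _ _)). Qed.

Lemma enormZ a x : enorm (a *: x) = `|a| * enorm x.
Proof. exact: (formnormZ (@dotvC _ _) dotv_lin). Qed.

Lemma enorm_dist x y : `|enorm x - enorm y| <= enorm (x - y).
Proof. exact: (formnormB (@dotvC _ _) dotv_lin (@dotv_ge0 _ _) (@dotv_eq0 _ _)). Qed.

(* Bernoulli: with [t = b / a <= 1] and [N >= s], [1 - t^s <= 1 - t^N <= N (1 - t)]. *)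
Lemma powR_diff_le (s a b : R) N : 0 <= s -> s <= N%:R -> 0 <= b -> b <= a ->
  (a `^ s - b `^ s) * b <= N%:R * a `^ s * (a - b).
Proof.
move=> s0 sN b0 ba; have [->|bn0] := eqVneq b 0.
  by rewrite mulr0 subr0 !mulr_ge0 ?powR_ge0// (le_trans b0).
have bgt0 : 0 < b by rewrite lt_def bn0.
have a0 : 0 < a by exact: lt_le_trans ba.
set t := b / a; have t0 : 0 < t by rewrite divr_gt0.
have t1 : t <= 1 by rewrite ler_pdivrMr// mul1r.
have bE : b = t * a by rewrite divfK// gt_eqF.
have -> : a `^ s - b `^ s = a `^ s * (1 - t `^ s).
  by rewrite bE powRM ?(ltW t0) ?(ltW a0)//; ring.
have tN : t ^+ N <= t `^ s.
  have tt : 0 < t <= 1 by rewrite t0.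
  by rewrite -powR_mulrn ?(ltW t0)//; exact: (ger_powR tt sN).
have bern : 1 - t ^+ N <= N%:R * (1 - t).
  elim: N {sN tN} => [|N ih]; first by rewrite expr0 subrr mul0r.
  rewrite exprS -natr1 mulrDl mul1r.
  have -> : 1 - t * t ^+ N = (1 - t) + t * (1 - t ^+ N) by ring.
  rewrite addrC lerD2r; apply: le_trans ih; rewrite ler_piMl// subr_ge0.
  by rewrite exprn_ile1// ltW.
have d0 : 0 <= 1 - t by rewrite subr_ge0.
have -> : a - b = (1 - t) * a by rewrite {1}bE; ring.
have h1 : (1 - t `^ s) * b <= N%:R * (1 - t) * a.
  apply: (@le_trans _ _ (N%:R * (1 - t) * b)); last by rewrite ler_wpM2l// mulr_ge0.
  by rewrite ler_wpM2r//; apply: le_trans bern; rewrite lerD2l lerN2.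
rewrite -mulrA; apply: le_trans (ler_wpM2l (powR_ge0 a s) h1) _.
by rewrite [leLHS](_ : _ = N%:R * a `^ s * ((1 - t) * a))//; ring.
Qed.

Variable s : R.
Hypothesis s0 : 0 <= s.

Definition power_law x : 'rV[R]_n := enorm x `^ s *: x.

(** Symmetrizing gives a nonnegative multiple of [enorm (x - y) ^+ 2] plus a product of differences
    of two increasing functions of the norms, which have the same sign. *)
Lemma power_law_monotone x y : 0 <= dotv (power_law x - power_law y) (x - y).
Proof.
have E : dotv (power_law x - power_law y) (x - y) =
  2^-1 * (enorm x `^ s + enorm y `^ s) * enorm (x - y) ^+ 2 +
  2^-1 * ((enorm x `^ s - enorm y `^ s) * (enorm x ^+ 2 - enorm y ^+ 2)).
  rewrite !sqr_enorm /power_law !dotvBl !dotvBr !dotvZl (dotvC y x).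
  by field.
have h2 : 0 <= 2^-1 :> R by rewrite invr_ge0.
have nn z : enorm z \in Num.nneg by rewrite nnegrE enorm_ge0.
rewrite E; apply: addr_ge0.
  by apply: mulr_ge0 (sqr_ge0 _); apply: mulr_ge0 => //; rewrite addr_ge0 ?powR_ge0.
apply: mulr_ge0 => //; have [xy|/ltW yx] := leP (enorm x) (enorm y).
  by rewrite mulr_le0// subr_le0 ?ge0_ler_powR// ler_sqr.
by rewrite mulr_ge0// subr_ge0 ?ge0_ler_powR// ler_sqr.
Qed.

(** With [enorm y <= enorm x], only the difference of powers is delicate: for [0 < s < 1] the power
    is not Lipschitz at 0, but in [powR_diff_le] it comes multiplied by the smaller norm. *)
Lemma power_law_lipschitz : exists2 C, 0 <= C & forall M x y, enorm x <= M -> enorm y <= M ->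
  enorm (power_law x - power_law y) <= C * M `^ s * enorm (x - y).
Proof.
have [N sN] : exists N, s <= N%:R.
  by exists (Num.truncn s).+1; rewrite ltW// truncnS_gt.
exists (N%:R + 1) => [|M]; first by rewrite addr_ge0.
have main x y : enorm y <= enorm x -> enorm x <= M ->
    enorm (power_law x - power_law y) <= (N%:R + 1) * M `^ s * enorm (x - y).
  move=> yx xM; have M0 : 0 <= M by apply: le_trans xM; exact: enorm_ge0.
  have -> : power_law x - power_law y =
      enorm x `^ s *: (x - y) + (enorm x `^ s - enorm y `^ s) *: y.
    by rewrite /power_law scalerBr scalerBl addrA subrK.
  apply: (le_trans (enormD _ _)); rewrite !enormZ ger0_norm ?powR_ge0//.
  rewrite ger0_norm; last by rewrite subr_ge0 ge0_ler_powR// nnegrE enorm_ge0.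
  have h := powR_diff_le s0 sN (enorm_ge0 y) yx.
  have xs : enorm x `^ s <= M `^ s by rewrite ge0_ler_powR// nnegrE ?enorm_ge0.
  have d0 := enorm_ge0 (x - y).
  have dd : enorm x - enorm y <= enorm (x - y) by apply: le_trans (ler_norm _) (enorm_dist _ _).
  rewrite [leRHS](_ : _ = M `^ s * enorm (x - y) + N%:R * M `^ s * enorm (x - y)); last by ring.
  apply: lerD; first exact: ler_wpM2r.
  apply: (le_trans h); apply: ler_pM => //.
  - by rewrite mulr_ge0// powR_ge0.
  - by rewrite subr_ge0.
  - exact: ler_wpM2l.
move=> x y xM yM; have [xy|/ltW yx] := leP (enorm x) (enorm y); last exact: main.
have enormC (u v : 'rV[R]_n) : enorm (u - v) = enorm (v - u).
  by rewrite -(opprB v u) -scaleN1r enormZ normrN1 mul1r.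
by rewrite enormC [X in _ <= _ * X]enormC; exact: main.
Qed.

End power_law.

Section bounded_measurable_powers.
Context {R : realType} d (T : measurableType d) (D : set T).
Hypothesis mD : measurable D.

Lemma bm_sqrt (g : T -> R) : bm D g -> bm D (fun x => Num.sqrt (g x)).
Proof.
move=> [mg [M hM]]; split.
  apply: (@measurableT_comp _ _ _ _ _ _ (@Num.sqrt R)) => //.
  by apply: continuous_measurable_fun; exact: sqrt_continuous.
exists (Num.sqrt M) => x Dx; rewrite ger0_norm ?sqrtr_ge0//.
by rewrite ler_wsqrtr// (le_trans (ler_norm _))// hM.
Qed.

Lemma bm_powR s (g : T -> R) : 0 <= s -> (forall x, 0 <= g x) -> bm D g ->
  bm D (fun x => g x `^ s).
Proof.
move=> s0 g0 [mg [M hM]]; split.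
  by apply: (@measurableT_comp _ _ _ _ _ _ (fun y => powR y s)) => //; exact: measurable_powR.
exists (M `^ s) => x Dx; rewrite ger0_norm ?powR_ge0//.
have gM : g x <= M by rewrite (le_trans (ler_norm _))// hM.
by apply: ge0_ler_powR => //; rewrite nnegrE// (le_trans (g0 x)).
Qed.

End bounded_measurable_powers.

Section cell_bounded.
Context {R : realType} {d : nat} {T : mesh R d.+1} {Omega : set 'rV[R]_d.+1}.
Local Notation mu := (lebesgue_rV R d.+1).
Hypothesis partT : partition_of T Omega.
Let mesh_nd := partition_nd partT.
Local Notation nd K := (cell_nd mesh_nd K).
Implicit Types (u v w kap : wfunV T).

Let mK (K : cell T) : measurable (celldom K) := measurable_hull (nd K).
Let iK (K : cell T) g : bm (celldom K) g -> mu.-integrable (celldom K) (EFin \o g).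
Proof. exact: (integrable_hull (nd K)). Qed.

Lemma cint_bm_lin (K : cell T) a g h : bm (celldom K) g -> bm (celldom K) h ->
  cint K (fun x => a * g x + h x) = a * cint K g + cint K h.
Proof.
move=> bg bh; rewrite /cint RintegralD//; [|exact/iK/bmZ|exact: iK].
by rewrite RintegralZl//; exact: iK.
Qed.

Lemma cint_bm_bound (K : cell T) g C : bm (celldom K) g ->
  (forall x, celldom K x -> `|g x| <= C) -> `|cint K g| <= C * cint K (fun=> 1).
Proof.
move=> bg gC; apply: (le_trans (le_normr_Rintegral (mK K) (iK bg))).
have -> : C * cint K (fun=> 1) = cint K (fun=> C).
  by rewrite /cint !Rintegral_cst// mul1r.
apply: le_Rintegral => //; [|exact/iK/bm_cst].
apply: iK; split; first by apply: measurableT_comp => //; exact: (proj1 bg).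
by exists C => x Kx; rewrite normr_id gC.
Qed.

Lemma wpolV_bm v (K : cell T) i : wpolV v -> bm (celldom K) (fun x => v.1 K x 0 i).
Proof. by move=> [pv _]; exact: polon_bm_hull (pv K i). Qed.

Lemma wpolV_bm_dotv u v (K : cell T) : wpolV u -> wpolV v ->
  bm (celldom K) (fun x => dotv (u.1 K x) (v.1 K x)).
Proof. by move=> pu pv; apply: bm_sum => i; apply: bmM; exact: wpolV_bm. Qed.

Lemma wpolV_bm_enorm v (K : cell T) : wpolV v -> bm (celldom K) (fun x => enorm (v.1 K x)).
Proof. by move=> pv; apply: bm_sqrt => //; exact: wpolV_bm_dotv. Qed.

Section damping.
Variables (alpha r : R).
Hypotheses (alpha0 : 0 < alpha) (r2 : 2 <= r).
Let s0 : 0 <= r - 2. Proof. by rewrite subr_ge0. Qed.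

Lemma damping_bm kap u v (K : cell T) : wpolV kap -> wpolV u -> wpolV v ->
  bm (celldom K) (fun x => enorm (kap.1 K x) `^ (r - 2) * dotv (u.1 K x) (v.1 K x)).
Proof.
move=> pk pu pv; apply: bmM; last exact: wpolV_bm_dotv.
by apply: bm_powR => //; [move=> x; exact: enorm_ge0|exact: wpolV_bm_enorm].
Qed.

Lemma ch_lin a kap u v w : wpolV kap -> wpolV u -> wpolV v -> wpolV w ->
  ch alpha r kap u (a *: v + w) = a * ch alpha r kap u v + ch alpha r kap u w.
Proof.
move=> pk pu pv pw; rewrite /ch mulrCA -mulrDr; congr (_ * _).
apply: sum_lin => K _; rewrite -cint_bm_lin; [|exact: damping_bm|exact: damping_bm].
by apply: eq_Rintegral => x _; rewrite dotvDr dotvZr; ring.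
Qed.

Lemma ch_ge0 u : 0 <= ch alpha r u u u.
Proof.
apply: mulr_ge0; first exact: ltW.
apply: sumr_ge0 => K _; apply: Rintegral_ge0 => x _.
by rewrite mulr_ge0 ?powR_ge0 ?dotv_ge0.
Qed.

Lemma power_law_bm u v w (K : cell T) : wpolV u -> wpolV v -> wpolV w ->
  bm (celldom K) (fun x =>
    dotv (power_law (r - 2) (u.1 K x) - power_law (r - 2) (v.1 K x)) (w.1 K x)).
Proof.
move=> pu pv pw; apply: bm_ext (bmD (damping_bm K pu pu pw) (bmN (damping_bm K pv pv pw))).
by move=> x _; rewrite /power_law dotvBl !dotvZl.
Qed.

Lemma ch_diff u v w : wpolV u -> wpolV v -> wpolV w ->
  ch alpha r u u w - ch alpha r v v w =
  alpha * \sum_(K : cell T) cint K (fun x =>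
    dotv (power_law (r - 2) (u.1 K x) - power_law (r - 2) (v.1 K x)) (w.1 K x)).
Proof.
move=> pu pv pw; rewrite /ch -mulrBr; congr (_ * _).
rewrite -sumrB; apply: eq_bigr => K _.
rewrite -[X in X - _ = _]mul1r -[X in _ - X]mul1r -mulNr [LHS]addrC mul1r -cint_bm_lin.
- by apply: eq_Rintegral => x _; rewrite /power_law dotvBl !dotvZl; ring.
- exact: damping_bm.
- exact: damping_bm.
Qed.

Lemma ch_monotone u v : wpolV u -> wpolV v ->
  0 <= ch alpha r u u (u - v) - ch alpha r v v (u - v).
Proof.
move=> pu pv; have puv : wpolV (u - v).
  by rewrite addrC -scaleN1r; exact: wpolV_lin.
rewrite ch_diff//; apply: mulr_ge0; first exact: ltW.
apply: sumr_ge0 => K _; apply: Rintegral_ge0 => x _; exact: power_law_monotone.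
Qed.

Lemma wpolV_comb N (e : 'I_N -> wfunV T) x : (forall i, wpolV (e i)) -> wpolV (comb e x).
Proof.
move=> pe; apply: comb_mem => //; last by move=> *; exact: wpolV_lin.
by split=> [K|f] i; apply: polon_ext (polon_cst _ 0) => y _; rewrite mxE.
Qed.

Lemma comb_enorm_le N (e : 'I_N -> wfunV T) : (forall i, wpolV (e i)) ->
  exists2 B, 0 <= B & forall x K y, celldom K y -> enorm ((comb e x).1 K y) <= B * `|x|.
Proof.
move=> pe.
have /choice[b hb] : forall iK : 'I_N * cell T, exists b, forall y, celldom iK.2 y ->
    enorm ((e iK.1).1 iK.2 y) <= b.
  move=> [i K]; have [_ [b hb]] := wpolV_bm_enorm K (pe i).
  by exists b => y Ky; exact: le_trans (ler_norm _) (hb y Ky).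
exists (\sum_i \sum_K `|b (i, K)|) => [|x K y Ky].
  by apply: sumr_ge0 => i _; exact: sumr_ge0.
rewrite mulr_suml; have -> : (comb e x).1 K y = \sum_i x 0 i *: (e i).1 K y.
  rewrite /comb; elim/big_rec2: _ => // i y1 y2 _ <-.
  by [].
apply: (@le_trans _ _ (\sum_i `|x 0 i| * enorm ((e i).1 K y))).
  elim/big_rec2: _ => [|i y1 y2 _ h]; first by rewrite /enorm dotv0l sqrtr0.
  by apply: (le_trans (enormD _ _)); rewrite enormZ lerD2l.
apply: ler_sum => i _; rewrite mulrC; apply: ler_pM => //.
- exact: enorm_ge0.
- apply: (le_trans (hb (i, K) y Ky)); apply: (le_trans (ler_norm _)).
  by rewrite (bigD1 K)//= lerDl sumr_ge0.
- exact: ler_coord_norm.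
Qed.

(** The pointwise bound for the power law, on the ball of radius [B M] that contains the values of
    the velocities, is integrated over the cells; the two further factors [B] pass from the
    coefficients [x - y] and [z] to values. *)
Lemma ch_lipschitz N (e : 'I_N -> wfunV T) M : (forall i, wpolV (e i)) ->
  exists2 C, 0 <= C & forall x y z : 'rV[R]_N, `|x| <= M -> `|y| <= M ->
    `|ch alpha r (comb e x) (comb e x) (comb e z) - ch alpha r (comb e y) (comb e y) (comb e z)| <=
      C * `|x - y| * `|z|.
Proof.
move=> pe; have [B B0 hB] := comb_enorm_le pe.
have [L L0 hL] := @power_law_lipschitz R d.+1 _ s0.
pose vol := \sum_(K : cell T) cint K (fun=> 1).
have v1 (K : cell T) : 0 <= cint K (fun=> 1) by apply: Rintegral_ge0.
exists (alpha * (L * (B * M) `^ (r - 2) * B * B * vol)) => [|x y z xM yM].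
  by rewrite !mulr_ge0 ?powR_ge0 ?sumr_ge0// ltW.
have pc t : wpolV (comb e t) by exact: wpolV_comb.
rewrite ch_diff// normrM gtr0_norm// -!mulrA; apply: ler_wpM2l; first exact: ltW.
apply: (le_trans (ler_norm_sum _ _ _)).
rewrite [leRHS](_ : _ = \sum_(K : cell T) L * (B * M) `^ (r - 2) * (B * `|x - y|) * (B * `|z|) *
    cint K (fun=> 1)); last by rewrite -mulr_sumr -/vol; ring.
apply: ler_sum => K _; apply: cint_bm_bound => [|t Kt].
  exact: power_law_bm.
apply: (le_trans (dotv_le_enorm _ _)); apply: ler_pM; rewrite ?enorm_ge0 ?hB//.
have xB : enorm ((comb e x).1 K t) <= B * M.
  by apply: (le_trans (hB x K t Kt)); exact: ler_wpM2l.
have yB : enorm ((comb e y).1 K t) <= B * M.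
  by apply: (le_trans (hB y K t Kt)); exact: ler_wpM2l.
apply: (le_trans (hL _ _ _ xB yB)); apply: ler_wpM2l.
  by rewrite mulr_ge0// powR_ge0.
by have := hB (x - y) K t Kt; rewrite combB.
Qed.

End damping.

(** * The load functional *)

Section load.
Hypotheses (oO : open Omega).
Variable f : 'rV[R]_d.+1 -> 'rV[R]_d.+1.
Hypothesis f2 : forall i, L2 Omega (fun x => f x 0 i).

Lemma load_integrable v (K : cell T) : wpolV v ->
  mu.-integrable (Omega `&` celldom K) (EFin \o (fun x => dotv (f x) (v.1 K x))).
Proof.
move=> pv; have mO := open_measurable_rV oO.
have mOK : measurable (Omega `&` celldom K) by exact: measurableI.
have sO : Omega `&` celldom K `<=` Omega by move=> x [].
have sK : Omega `&` celldom K `<=` celldom K by move=> x [].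
have mv i : measurable_fun (Omega `&` celldom K) (fun x => v.1 K x 0 i).
  exact: measurable_funS (mK K) sK (proj1 (wpolV_bm K i pv)).
have mf i : measurable_fun (Omega `&` celldom K) (fun x => f x 0 i).
  exact: measurable_funS mO sO (proj1 (f2 i)).
have ifv i : mu.-integrable (Omega `&` celldom K) (EFin \o (fun x => f x 0 i * v.1 K x 0 i)).
  have [_ [M hM]] := wpolV_bm K i pv.
  (* [f] is only square integrable; the product is dominated through [t <= 1 + t^2], applied to the
     absolute value of a component of [f]. *)
  have i1 : mu.-integrable (Omega `&` celldom K) (EFin \o (fun x => `|M| * (1 + f x 0 i ^+ 2))).
    rewrite (_ : EFin \o _ = fun x => (`|M|%:E * ((cst 1%E) \+ (fun x => (f x 0 i ^+ 2)%:E)) x)%E)//.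
    apply: integrableZl => //; apply: integrableD => //.
      apply: (integrableS (mK K)) => //.
      exact: (iK (bm_cst (celldom K) 1)).
    exact: integrableS mO mOK sO (proj2 (f2 i)).
  apply: (le_integrable mOK _ _ i1).
    by apply/measurable_EFinP; exact: measurable_funM.
  move=> x [_ Kx] /=; rewrite lee_fin normrM mulrC [leRHS]ger0_norm; last first.
    by rewrite mulr_ge0// addr_ge0 ?sqr_ge0.
  apply: ler_pM => //; first by apply: (le_trans (hM x Kx)); exact: ler_norm.
  rewrite -[f x 0 i ^+ 2]real_normK ?num_real//.
  have := sqr_ge0 (`|f x 0 i| - 2^-1); rewrite sqrrB => h.
  have : 0 <= `|f x 0 i| by []; lra.
rewrite (_ : EFin \o _ = fun x => (\sum_(i < d.+1) (f x 0 i * v.1 K x 0 i)%:E)%E); last first.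
  by apply/funext => x /=; rewrite sumEFin.
have := @integrable_sum _ _ _ mu _ mOK _ (index_enum 'I_d.+1) xpredT
  (fun i x => (f x 0 i * v.1 K x 0 i)%:E) (fun i _ => ifv i).
by [].
Qed.

Lemma load_lin a u v : wpolV u -> wpolV v ->
  load Omega f (a *: u + v) = a * load Omega f u + load Omega f v.
Proof.
move=> pu pv; have mO := open_measurable_rV oO.
have mOK (K : cell T) : measurable (Omega `&` celldom K) by exact: measurableI.
apply: sum_lin => K _.
rewrite -RintegralZl//; last exact: load_integrable.
rewrite -RintegralD//; last 2 first.
- rewrite (_ : EFin \o _ = fun x => (a%:E * (EFin \o (fun x => dotv (f x) (u.1 K x))) x)%E)//.
  by apply: integrableZl => //; exact: load_integrable.
- exact: load_integrable.
by apply: eq_Rintegral => x _; rewrite dotvDr dotvZr.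
Qed.

End load.

End cell_bounded.

(** * Well-posedness of the scheme *)

Section well_posedness.
Context {R : realType} {d : nat} {T : mesh R d.+1} {Omega : set 'rV[R]_d.+1}.
Hypotheses (oO : open Omega) (cO : connected Omega) (O0 : Omega !=set0).
Hypothesis partT : partition_of T Omega.
Let mesh_nd := partition_nd partT.
Local Notation CI K := (cint_poly_integral mesh_nd K).
Local Notation FI e := (fint_poly_integral mesh_nd e).
Implicit Types (u v w kap : wfunV T).

Lemma frob_ge0 n (A : 'M[R]_n) : 0 <= frob A A.
Proof. by apply: sumr_ge0 => i _; apply: sumr_ge0 => j _; rewrite -expr2 sqr_ge0. Qed.

Lemma grad_energy_cell_ge0 m v K :
  0 <= cint K (fun x => frob (gradh m.-1 v K x) (gradh m.-1 v K x)).
Proof. by apply: Rintegral_ge0 => x _; exact: frob_ge0. Qed.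

Lemma jump_energy_face_ge0 k v K e :
  0 <= fint e (fun x => (hK K)^-1 * dotv (jump k v K e x) (jump k v K e x)).
Proof.
rewrite fintE mulr_ge0 ?sqrtr_ge0//; apply: Rintegral_ge0 => t _.
by rewrite mulr_ge0 ?dotv_ge0// invr_ge0 ltW// (hK_gt0 partT).
Qed.

Lemma energy_ge0 m k v : 0 <= energy m k v v.
Proof.
apply: addr_ge0; apply: sumr_ge0 => K _; first exact: grad_energy_cell_ge0.
by apply: sumr_ge0 => e _; exact: jump_energy_face_ge0.
Qed.

(** A vanishing sum of nonnegative terms; positivity of [hK] lets the jump terms be freed from their
    weight. *)
Lemma energy_eq0P m k v : wpolV v -> energy m k v v = 0 ->
  (forall K i j x, celldom K x -> gradh m.-1 v K x i j = 0) /\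
  (forall K e i x, incident K e -> facedom e x -> jump k v K e x 0 i = 0).
Proof.
move=> pv.
have g0 : 0 <= grad_energy m v v by apply: sumr_ge0 => K _; exact: grad_energy_cell_ge0.
have j0 : 0 <= jump_energy k v v.
  by apply: sumr_ge0 => K _; apply: sumr_ge0 => e _; exact: jump_energy_face_ge0.
move=> /eqP; rewrite paddr_eq0// => /andP[/eqP gE /eqP jE]; split.
  move=> K i j; apply: (pint_sqr_eq0 (CI K) (polon_gradh partT m.-1 K i j pv)).
  have /eqP := gE; rewrite psumr_eq0; last by move=> L _; exact: grad_energy_cell_ge0.
  move=> /allP/(_ K (mem_index_enum _))/=/eqP.
  have pgg i' j' : polon (celldom K) (fun x => gradh m.-1 v K x i' j' ^+ 2).
    exact: polon_exp (polon_gradh partT m.-1 K i' j' pv).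
  have -> : cint K (fun x => frob (gradh m.-1 v K x) (gradh m.-1 v K x)) =
      \sum_i \sum_j cint K (fun x => gradh m.-1 v K x i j ^+ 2).
    under [RHS]eq_bigr => i' _ do rewrite -(pint_sum (CI K) _ _ (pgg i')).
    rewrite -(pint_sum (CI K)); last by move=> i'; exact: polon_sum.
    by apply: (pint_ext (CI K)) => x _; apply: eq_bigr => i' _; apply: eq_bigr.
  have gg0 i' j' : 0 <= cint K (fun x => gradh m.-1 v K x i' j' ^+ 2).
    by apply: Rintegral_ge0 => x _; exact: sqr_ge0.
  move/eqP; rewrite psumr_eq0 => [|i' _]; last exact: sumr_ge0.
  move=> /allP/(_ i (mem_index_enum _))/=; rewrite psumr_eq0 => [|j' _//].
  by move=> /allP/(_ j (mem_index_enum _))/=/eqP.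
move=> K e i x Ke.
apply: (pint_sqr_eq0 (FI e) (polon_jump partT k i pv Ke)).
have /eqP := jE; rewrite psumr_eq0; last first.
  by move=> L _; apply: sumr_ge0 => f _; exact: jump_energy_face_ge0.
move=> /allP/(_ K (mem_index_enum _))/=; rewrite psumr_eq0; last first.
  by move=> f _; exact: jump_energy_face_ge0.
move=> /allP/(_ e (mem_index_enum _))/=; rewrite Ke /=.
have pjj i' : polon (facedom e) (fun x => jump k v K e x 0 i' ^+ 2).
  exact: polon_exp (polon_jump partT k i' pv Ke).
rewrite (pintZ (FI e)); last by apply: polonV_dotv => i'; exact: (polon_jump partT k i' pv Ke).
rewrite mulf_eq0 invr_eq0 gt_eqF ?(hK_gt0 partT)//=.
have -> : fint e (fun x => dotv (jump k v K e x) (jump k v K e x)) =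
    \sum_i fint e (fun x => jump k v K e x 0 i ^+ 2).
  rewrite -(pint_sum (FI e))//.
rewrite psumr_eq0; last by move=> i' _; exact: (pint_sqr_ge0 (FI e) (polon_jump partT k i' pv Ke)).
by move=> /allP/(_ i (mem_index_enum _))/=/eqP.
Qed.

(** The weak gradient and the projection act componentwise, so [weak_gradient_definite] applies to
    each scalar component, with test degree [m.-1]. *)
Lemma energy_definite m k v : (m.-1 <= k)%N -> Vh0 Omega m k v ->
  energy m k v v = 0 -> v = 0.
Proof.
move=> mk Vv; have pv := Vh0_wpolV Vv.
move=> /(energy_eq0P pv)[G0 J0]; move: (Vv) => [P1 P2 P3].
have comp i : (forall K x, v.1 K x 0 i = 0) /\ (forall e x, v.2 e x 0 i = 0).
  apply: (weak_gradient_definite oO cO O0 partT (m := m) (k := k) (gam := m.-1)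
    (vi := fun K x => v.1 K x 0 i) (vb := fun e x => v.2 e x 0 i)) => //.
  - by move=> K; exact: P1.
  - by move=> e; exact: P2.
  - move=> K j q pq; have [_ h] := wgradP mesh_nd m.-1 (wpolV_wpair K i pv).
    rewrite -h// -(pint0 (CI K)); apply: (pint_ext (CI K)) => x Kx.
    by rewrite -gradhE G0// mul0r.
  - move=> K e Ke x ex; apply/subr0_eq; have := J0 K e i x Ke ex.
    by rewrite /jump /projBV !mxE.
  - by move=> e eb x ex; rewrite P3// mxE.
case: v comp {Vv pv G0 J0 P1 P2 P3} => v1 v2 /= comp.
congr pair.
  by apply/funext => K; apply/funext => x; apply/rowP => i; rewrite (proj1 (comp i)) mxE.
by apply/funext => e; apply/funext => x; apply/rowP => i; rewrite (proj2 (comp i)) mxE.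
Qed.

(** The weak gradient of [q] is itself an admissible interior velocity, of degree [m], with zero
    boundary part; testing with it makes it vanish. *)
Lemma bh_definite m k (q : wfunS T) : (0 < m)%N -> Qh0 m q ->
  (forall v, Vh0 Omega m k v -> bh m v q = 0) -> q = 0.
Proof.
move=> m0 Qq b0; have pq := Qh0_wpolS Qq.
have Pw K : PolV m (celldom K) (wgrad m K (q.1 K) q.2).
  by have [] := wgradP mesh_nd m (wpolS_wpair K pq).
pose v : wfunV T := (fun K => wgrad m K (q.1 K) q.2, fun _ _ => 0).
have Vv : Vh0 Omega m k v by split=> // e; exact: PolV0.
have cell_ge0 K : 0 <= cint K (fun x => dotv (wgrad m K (q.1 K) q.2 x) (v.1 K x)).
  by apply: Rintegral_ge0 => x _; exact: dotv_ge0.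
have w0 K i x : celldom K x -> wgrad m K (q.1 K) q.2 x 0 i = 0.
  apply: (pint_sqr_eq0 (CI K) (Pol_polon (Pw K i))).
  have /eqP := b0 v Vv; rewrite psumr_eq0 => [|L _]; last exact: cell_ge0.
  move=> /allP/(_ K (mem_index_enum _))/=/eqP.
  have -> : cint K (fun x => dotv (wgrad m K (q.1 K) q.2 x) (v.1 K x)) =
     \sum_i cint K (fun x => wgrad m K (q.1 K) q.2 x 0 i ^+ 2).
    rewrite -(pint_sum (CI K))// => j; apply: polon_exp; exact: Pol_polon (Pw K j).
  move/eqP; rewrite psumr_eq0 => [|j _].
    by move=> /allP/(_ i (mem_index_enum _))/=/eqP.
  by apply: Rintegral_ge0 => y _; exact: sqr_ge0.
have [] := pressure_definite oO cO O0 partT m0 Qq.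
  move=> K i p pp; have [_ h] := wgradP mesh_nd m (wpolS_wpair K pq).
  rewrite -h// -(pint0 (CI K)); apply: (pint_ext (CI K)) => x Kx.
  by rewrite w0// mul0r.
case: q {Qq b0 pq Pw v Vv cell_ge0 w0} => q1 q2 /= z1 z2.
congr pair.
  by apply/funext => K; apply/funext => x; rewrite z1.
by apply/funext => e; apply/funext => x; rewrite z2.
Qed.

Lemma well_posed (nu alpha r : R) (f : 'rV[R]_d.+1 -> 'rV[R]_d.+1) (m k : nat) :
  0 < nu -> 0 < alpha -> 2 <= r -> (forall i, L2 Omega (fun x => f x 0 i)) ->
  (0 < m)%N -> (m.-1 <= k)%N -> Nh T Omega m k / nu ^+ 2 * dual_norm T Omega f m k < 1 ->
  exists! up : wfunV T * wfunS T, WG_solution Omega nu alpha r f m k up.1 up.2.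
Proof.
move=> nu0 alpha0 r2 f2 m0 mk small.
have VW v : Vh0 Omega m k v -> wpolV v by exact: Vh0_wpolV.
have QW (q : wfunS T) : Qh0 m q -> wpolS q by exact: Qh0_wpolS.
have [[u p] [[/= Xu Yp eq_up div_u] uniq]] : exists! up : wfunV T * wfunS T,
    [/\ Vh0 Omega m k up.1, Qh0 m up.2,
      forall v, Vh0 Omega m k v -> nu * energy m k up.1 v + bh m v up.2 +
        ch alpha r up.1 up.1 v + dh m up.1 up.1 v = load Omega f v &
      forall q, Qh0 m q -> bh m up.1 q = 0].
  apply: (@saddle_point_unique R (wfunV T) (wfunS T) (Vh0 Omega m k) (@Qh0 R d.+1 T m)).
  - exact: findim_Vh0.
  - exact: Vh0_0.
  - by move=> *; exact: Vh0_lin.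
  - exact: findim_Qh0.
  - exact: Qh0_0 partT m.
  - by move=> a p q Qp Qq; apply: (Qh0_lin partT).
  - exact: nu0.
  - by move=> v w _ _; exact: (energyC partT).
  - by move=> a u v w /VW Vu /VW Vv /VW Vw; exact: (energy_lin partT).
  - by move=> v _; exact: energy_ge0.
  - by move=> v Vv; exact: energy_definite.
  - by move=> a u v q /VW Vu /VW Vv /QW; exact: (bh_linl partT).
  - by move=> a v p q /VW Vu /QW Vv /QW; exact: (bh_linr partT).
  - by move=> q; exact: bh_definite.
  - by move=> a k' u v w /VW h1 /VW h2 /VW h3 /VW h4; exact: (ch_lin partT).
  - by move=> u v /VW h1 /VW h2; exact: (ch_monotone partT).
  - by move=> u _; exact: (ch_ge0 _ _).
  - by move=> N e M Ve; apply: (ch_lipschitz partT) => // i; exact/VW/Ve.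
  - by move=> a k1 k2 u v /VW h1 /VW h2 /VW h3 /VW h4; exact: (dh_lin1 partT).
  - by move=> a k1 u v w /VW h1 /VW h2 /VW h3 /VW h4; exact: (dh_lin2 partT).
  - by move=> k1 u v; exact: dhC.
  - by move=> a u v /VW h1 /VW h2; exact: (load_lin partT).
  - exact: small.
exists (u, p); split.
  by split=> //= v Vv; rewrite ahE; exact: eq_up.
move=> [u' p'] [/= Xu' Yp' eq' div']; apply: uniq; split=> //= v Vv.
by rewrite -ahE; exact: eq'.
Qed.

End well_posedness.

Theorem theorem3p2 (R : realType) (n : nat) (Omega : set 'rV[R]_n)
    (nu alpha r sigma : R) (f : 'rV[R]_n -> 'rV[R]_n)
    (T : mesh R n) (m k : nat) :
  n = 2%N \/ n = 3%N ->
  lipschitz_polyhedral_domain Omega ->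
  0 < nu -> 0 < alpha -> 2 <= r ->
  (forall i, L2 Omega (fun x => f x 0 i)) ->
  partition_of T Omega -> shape_regular T sigma ->
  (1 <= m)%N -> k = m.-1 \/ k = m ->
  Nh T Omega m k / nu ^+ 2 * dual_norm T Omega f m k < 1 ->
  exists! up : wfunV T * wfunS T, WG_solution Omega nu alpha r f m k up.1 up.2.
Proof.
(* The theory is written in dimension [d.+1], so that the [n.-1] of the face integrals reduces to
   [d]; the hypothesis on [n] excludes 0. *)
case: n Omega f T => [|d] Omega f T; first by case.
move=> _ [dom _ _ _] nu0 alpha0 r2 f2 partT _ m0 mk small.
have [nonempty openO conn] := dom; apply: well_posed => //; case: mk => -> //; exact: leq_pred.
Qed.
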